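(* Let $1<p<\infty$, $-\frac np<r<0$, $r+\varrho=-n$ and let $w\in A_p$. Then the predual space of $L^r_p(w,\mathbb{R}^n)$ is $H^{\varrho}L_{p'}(w,\mathbb{R}^n)$. More precisely, $g\in\big(H^{\varrho}L_{p'}(w,\mathbb{R}^n)\big)'$ if, and only if, $g$ can be uniquely represented as $$g(f)=\int_{\mathbb{R}^n}\widetilde g(x)f(x)\,dx\qquad\text{for all } f\in D(\mathbb{R}^n)$$ where $\widetilde g\in L^r_p(w,\mathbb{R}^n)$ (that is: every bounded linear functional $g$ has such a representation with a unique $\widetilde g$, and for every $\widetilde g\in L^r_p(w,\mathbb{R}^n)$ the formula determines, by continuous extension from the dense subset $D(\mathbb{R}^n)$, a bounded linear functional), and $$\big\|g\,\big|\big(H^{\varrho}L_{p'}(w,\mathbb{R}^n)\big)'\big\|\cong\|\widetilde g|L^r_p(w,\mathbb{R}^n)\|$$ with equivalence constants independent of $g$.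
   Context: All functions are complex-valued; $p'=p/(p-1)$; $w(M)=\int_M w(x)\,dx$. $D(\mathbb{R}^n)$ denotes the compactly supported infinitely differentiable functions. $A_p$ ($1<p<\infty$): $w\in L_1^{\mathrm{loc}}(\mathbb{R}^n)$ with $w>0$ a.e. belongs to $A_p$ if $[w]_{A_p}=\sup_Q \frac{w(Q)}{|Q|}\big(\frac{w^{1-p'}(Q)}{|Q|}\big)^{p-1}<\infty$, the supremum over all cubes with sides parallel to the axes. $\|f|L_{p,w}(M)\|=(\int_M|f(x)|^pw(x)\,dx)^{1/p}$; $Q_{J,M}=2^{-J}(M+[-1,1]^n)$ for $J\in\mathbb{Z}$, $M\in\mathbb{Z}^n$. Weighted Morrey space: $L^r_p(w,\mathbb{R}^n)$ consists of all $f\in L_1^{\mathrm{loc}}(\mathbb{R}^n)$ with $\|f|L^r_p(w,\mathbb{R}^n)\|=\sup_{J\in\mathbb{Z},M\in\mathbb{Z}^n}w(Q_{J,M})^{-(\frac1p+\frac rn)}\|f|L_{p,w}(Q_{J,M})\|<\infty$. Space $H^{\varrho}L_q(w,\mathbb{R}^n)$ ($1<q<\infty$, $-n<\varrho<-n/q$, $w\in A_{q'}$): all $h\in S'(\mathbb{R}^n)$ representable as $h=\sum_{J\in\mathbb{Z},M\in\mathbb{Z}^n}h_{J,M}$ in $S'(\mathbb{R}^n)$ with $\operatorname{supp}h_{J,M}\subset Q_{J,M}$ and $\sum_{J,M}w(Q_{J,M})^{-(\frac1q+\frac\varrho n)}\|h_{J,M}w^{-1/q'}|L_q(\mathbb{R}^n)\|<\infty$;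 the norm is the infimum of these sums over all such representations. Here $q=p'$, $q'=p$. $(X)'$ is the space of bounded linear functionals on $X$ with the usual dual norm. $A\cong B$ means $cA\le B\le CA$ for constants $c,C>0$. *)

(* Defs.v *)
From HB Require Import structures.
From mathcomp Require Export all_boot all_order all_algebra finmap.
From mathcomp Require Export complex.
From mathcomp Require Export all_classical all_reals all_analysis measurable_realfun.
Export Order.TTheory GRing.Theory Num.Theory.
Export numFieldNormedType.Exports.

Set Implicit Arguments.
Unset Strict Implicit.
Unset Printing Implicit Defensive.

Local Open Scope classical_set_scope.
Local Open Scope ring_scope.

(* The library has no Lebesgue measure on R^n; it is built here on 'rV[R]_n,   *)
(* whose sigma-algebra is the product one (generated by the coordinates), i.e. *)
(* the Borel sigma-algebra.  lebesgue_rV n is the n-fold product of the        *)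
(* one-dimensional Lebesgue measure, transported along cons_rV.  As in the     *)
(* library, "measurable" is Borel measurable: every Lebesgue measurable        *)
(* function has a Borel representative in its a.e. class.                      *)
Section lebesgue_rV.
Context {R : realType}.

Section measurable_rV.
Variable n : nat.

Definition coord_rV (i : 'I_n) (x : 'rV[R]_n) : measurableTypeR R := x ord0 i.

Let rV_set0 : g_sigma_preimage coord_rV set0.
Proof. exact: sigma_algebra0. Qed.

Let rV_setC A : g_sigma_preimage coord_rV A -> g_sigma_preimage coord_rV (~` A).
Proof. exact: sigma_algebraC. Qed.

Let rV_bigcup (F : (set 'rV[R]_n)^nat) :
  (forall i, g_sigma_preimage coord_rV (F i)) ->
  g_sigma_preimage coord_rV (\bigcup_i (F i)).
Proof. exact: sigma_algebra_bigcup. Qed.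

HB.instance Definition _ := @isMeasurable.Build default_measure_display
  'rV[R]_n (g_sigma_preimage coord_rV) rV_set0 rV_setC rV_bigcup.

End measurable_rV.

Definition cons_rV n (tx : measurableTypeR R * 'rV[R]_n) : 'rV[R]_n.+1 :=
  \row_i (if unlift ord0 i is Some j then tx.2 ord0 j else tx.1).

Lemma measurable_coord_rV n (i : 'I_n) : measurable_fun [set: 'rV[R]_n] (coord_rV i).
Proof.
move=> _ Y mY; rewrite setTI; apply: sub_sigma_algebra => /=.
rewrite -bigcup_seq/=; exists i => /=; first by rewrite mem_index_enum.
by exists Y => //; rewrite setTI.
Qed.

Lemma measurable_fun_rVP d (T : measurableType d) n (f : T -> 'rV[R]_n) :
  measurable_fun [set: T] f <->
  forall i, measurable_fun [set: T] (coord_rV i \o f).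
Proof.
split=> [mf i|mf].
  apply: measurableT_comp mf; exact: measurable_coord_rV.
apply: (@measurability _ _ _ _ _ _ (\big[setU/set0]_(i < n)
  preimage_set_system setT (coord_rV i) measurable)) => //.
move=> _ [B + <-].
rewrite -bigcup_seq => -[i _ [C mC <-]].
rewrite !setTI -comp_preimage.
by rewrite -[X in measurable X]setTI; exact: mf.
Qed.

Lemma coord_cons_rV0 n tx : coord_rV ord0 (@cons_rV n tx) = tx.1.
Proof. by rewrite /coord_rV mxE unlift_none. Qed.

Lemma coord_cons_rV_lift n (j : 'I_n) tx :
  coord_rV (lift ord0 j) (@cons_rV n tx) = coord_rV j tx.2.
Proof. by rewrite /coord_rV mxE liftK. Qed.

Lemma measurable_cons_rV n : measurable_fun setT (@cons_rV n).
Proof.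
apply/measurable_fun_rVP => i; case: (unliftP ord0 i) => [j|] ->.
- rewrite [X in measurable_fun _ X](_ : _ = coord_rV j \o snd).
    by apply: measurableT_comp => //; exact: measurable_coord_rV.
  by apply/funext => tx /=; rewrite coord_cons_rV_lift.
- rewrite [X in measurable_fun _ X](_ : _ = fst) //.
  by apply/funext => tx /=; rewrite coord_cons_rV0.
Qed.

Let uncons_rV n (x : 'rV[R]_n.+1) : measurableTypeR R * 'rV[R]_n :=
  (coord_rV ord0 x, \row_i coord_rV (lift ord0 i) x).

Let measurable_uncons_rV n : measurable_fun setT (@uncons_rV n).
Proof.
apply/measurable_fun_pairP; split; first exact: measurable_coord_rV.
apply/measurable_fun_rVP => i.
rewrite [X in measurable_fun _ X](_ : _ = coord_rV (lift ord0 i)).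
  exact: measurable_coord_rV.
by apply/funext => x /=; rewrite /coord_rV mxE.
Qed.

Let cons_rVK n : cancel (@cons_rV n) (@uncons_rV n).
Proof.
move=> tx; rewrite /uncons_rV coord_cons_rV0 [RHS]surjective_pairing.
congr pair; apply/rowP => i.
by rewrite mxE coord_cons_rV_lift.
Qed.

Fixpoint lebesgue_rV n : set 'rV[R]_n -> \bar R :=
  match n with
  | 0 => dirac (0 : 'rV[R]_0)
  | m.+1 => pushforward (lebesgue_measure \x @lebesgue_rV m)%E (@cons_rV m)
  end.
Arguments lebesgue_rV : clear implicits.


Section step.
Variables (n : nat) (m : {sigma_finite_measure set 'rV[R]_n -> \bar R}).

Let step := pushforward (lebesgue_measure \x m)%E (@cons_rV n).

Let step0 : step set0 = 0%E.
Proof. by rewrite /step /pushforward preimage_set0 measure0. Qed.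

Let step_ge0 A : (0 <= step A)%E.
Proof. exact: (measure_ge0 (lebesgue_measure \x m)%E). Qed.

Let step_sigma_additive : semi_sigma_additive step.
Proof.
move=> F mF tF mUF; rewrite /step /pushforward preimage_bigcup.
have mcF A : measurable A -> measurable (@cons_rV n @^-1` A).
  by move=> mA; rewrite -[X in measurable X]setTI; exact: measurable_cons_rV.
apply: (@measure_semi_sigma_additive _ _ _ (lebesgue_measure \x m)%E (fun k => @cons_rV n @^-1` F k)).
- by move=> k; exact: mcF.
- apply/trivIsetP => /= i j _ _ ij; rewrite -preimage_setI.
  by move/trivIsetP : tF => /(_ _ _ _ _ ij) ->//; rewrite preimage_set0.
- by rewrite -preimage_bigcup; exact: mcF.
Qed.

HB.instance Definition _ := isMeasure.Build _ _ _ step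
  step0 step_ge0 step_sigma_additive.

Let step_sigma_finite : sigma_finite setT step.
Proof.
have /sigma_finiteP[F [TF ndF Foo]] := sigma_finiteT (@lebesgue_measure R).
have /sigma_finiteP[G [TG ndG Goo]] := sigma_finiteT m.
exists (fun k => @uncons_rV n @^-1` (F k `*` G k)).
  apply/esym/seteqP; split => // x _.
  have [i _ Fi] : (\bigcup_k F k) (uncons_rV x).1 by rewrite -TF.
  have [j _ Gj] : (\bigcup_k G k) (uncons_rV x).2 by rewrite -TG.
  exists (maxn i j) => //; split.
    by move: Fi; exact/subsetPset/ndF/leq_maxl.
  by move: Gj; exact/subsetPset/ndG/leq_maxr.
move=> k; have [mF Fk] := Foo k; have [mG Gk] := Goo k; split.
  rewrite -[X in measurable X]setTI; apply: measurable_uncons_rV => //.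
  exact: measurableX.
rewrite /step /pushforward -comp_preimage.
rewrite (_ : _ \o _ = id); last exact/funext/cons_rVK.
by rewrite preimage_id product_measure1E// lte_mul_pinfty// ge0_fin_numE.
Qed.

HB.instance Definition _ := Measure_isSigmaFinite.Build _ _ _ step
  step_sigma_finite.

Definition lebesgue_rV_step : {sigma_finite_measure set 'rV[R]_n.+1 -> \bar R} :=
  step.

End step.

Let lebesgue_rVE n : exists m : {sigma_finite_measure set 'rV[R]_n -> \bar R},
  lebesgue_rV n = m.
Proof.
elim: n => [|n [m IH]]; first by exists (dirac (0 : 'rV[R]_0)).
by exists (lebesgue_rV_step m); rewrite /= IH.
Qed.

Section instances.
Variable n : nat.

Let leb0 : lebesgue_rV n set0 = 0%E.
Proof. by have [m ->] := lebesgue_rVE n; exact: measure0. Qed.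

Let leb_ge0 A : (0 <= lebesgue_rV n A)%E.
Proof. by have [m ->] := lebesgue_rVE n; exact: measure_ge0. Qed.

Let leb_sigma_additive : semi_sigma_additive (lebesgue_rV n).
Proof. by have [m ->] := lebesgue_rVE n; exact: measure_semi_sigma_additive. Qed.

HB.instance Definition _ := isMeasure.Build _ _ _ (lebesgue_rV n)
  leb0 leb_ge0 leb_sigma_additive.

Let leb_sigma_finite : sigma_finite setT (lebesgue_rV n).
Proof. by have [m ->] := lebesgue_rVE n; exact: sigma_finiteT. Qed.

HB.instance Definition _ := Measure_isSigmaFinite.Build _ _ _ (lebesgue_rV n)
  leb_sigma_finite.

End instances.

Lemma lebesgue_rV_prod n (A : 'I_n -> set (measurableTypeR R)) :
  (forall i, measurable (A i)) ->
  lebesgue_rV n [set x | forall i, A i (coord_rV i x)] =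
  (\prod_(i < n) lebesgue_measure (A i))%E.
Proof.
elim: n A => [|n IH] A mA.
  rewrite big_ord0 /= diracE (_ : _ \in _ = true)//.
  by apply/mem_set => -[].
rewrite big_ord_recl -IH; last by move=> i; exact: mA.
rewrite -product_measure1E//; last first.
  rewrite (_ : [set _ | _] = \bigcap_(i in [set: 'I_n])
      (coord_rV i @^-1` A (lift ord0 i))).
    apply: fin_bigcap_measurable => // i _.
    by rewrite -[X in measurable X]setTI; exact: measurable_coord_rV.
  by apply/seteqP; split => x /= h i; [move=> _|]; exact: h.
congr ((_ \x _)%E _); apply/seteqP; split => [tx /= h|tx /= [h0 h] i].
  split; first by rewrite -coord_cons_rV0; exact: h.
  by move=> i; rewrite -coord_cons_rV_lift; exact: h.
case: (unliftP ord0 i) => [j|] ->.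
  by rewrite coord_cons_rV_lift; exact: h.
by rewrite coord_cons_rV0.
Qed.

End lebesgue_rV.

Section complex_functions.
Context {R : realType} {n : nat}.
Implicit Types (f g : 'rV[R]_n -> R[i]) (u : 'rV[R]_n -> R).

Local Notation mu := (@lebesgue_rV R n).

(* The library's norm `|z| is R[i]-valued; cabs z is the real number |z|. *)
Definition cabs (z : R[i]) : R := Normc.normc z.

Lemma cabs_ge0 z : 0 <= cabs z.
Proof. by case: z => a b; exact: sqrtr_ge0. Qed.

Definition measurable_cfun f :=
  measurable_fun setT (fun x => complex.Re (f x)) /\
  measurable_fun setT (fun x => complex.Im (f x)).

Definition cintegral f : R[i] :=
  Complex (\int[mu]_x complex.Re (f x)) (\int[mu]_x complex.Im (f x)).

Definition loc_integrable u :=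
  measurable_fun setT u /\
  forall K : set 'rV[R]_n, compact K -> mu.-integrable K (EFin \o u).

Definition loc_cintegrable f :=
  loc_integrable (fun x => complex.Re (f x)) /\ loc_integrable (fun x => complex.Im (f x)).

(* Support of an a.e. class of functions: complement of the largest open set   *)
(* on which f vanishes a.e.                                                    *)
Definition ess_support f : set 'rV[R]_n :=
  ~` \bigcup_(U in [set U | open U /\ {ae mu, forall x, U x -> f x = 0}]) U.

Definition wLp_norm (p : R) (w : 'rV[R]_n -> R) (A : set 'rV[R]_n) f : \bar R :=
  ((\int[mu]_(x in A) (cabs (f x) `^ p * w x)%:E) `^ p^-1)%E.

Definition pderiv (i : 'I_n) u : 'rV[R]_n -> R := 'D_(delta_mx ord0 i) u.

Definition pderivs (s : seq 'I_n) u : 'rV[R]_n -> R := foldr pderiv u s.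

Definition smooth u :=
  forall s, continuous (pderivs s u) /\
    forall i x, derivable (pderivs s u) x (delta_mx ord0 i).

Definition csmooth f :=
  smooth (fun x => complex.Re (f x)) /\ smooth (fun x => complex.Im (f x)).

Definition cpderivs (s : seq 'I_n) f (x : 'rV[R]_n) : R[i] :=
  Complex (pderivs s (fun y => complex.Re (f y)) x)
    (pderivs s (fun y => complex.Im (f y)) x).

Definition test_function f :=
  csmooth f /\ compact (closure [set x | f x != 0]).

(* `|x| is the maximum norm on 'rV[R]_n; multi-indices are encoded as sequences *)
(* of directions, size s being the order of the derivative.                     *)
Definition schwartz_norm (N : nat) f : \bar R :=
  ereal_sup [set ((1 + `|sx.2|) ^+ N * cabs (cpderivs sx.1 f sx.2))%:E |
    sx in [set sx : seq 'I_n * 'rV[R]_n | (size sx.1 <= N)%N]].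

Definition schwartz f :=
  csmooth f /\ forall N, (schwartz_norm N f < +oo)%E.

Lemma pderivs_lin (a b : R) u v : smooth u -> smooth v -> forall s,
  pderivs s (fun x => a * u x + b * v x) =
  (fun x => a * pderivs s u x + b * pderivs s v x).
Proof.
move=> su sv; elim=> [//|i s /= ->].
have [_ du] := su s; have [_ dv] := sv s.
apply/funext => x; rewrite /pderiv /=.
rewrite (_ : (fun _ => _) = a *: pderivs s u + b *: pderivs s v)//.
by rewrite deriveD ?deriveZ//; exact: derivableZ.
Qed.

Lemma smooth_lin (a b : R) u v : smooth u -> smooth v ->
  smooth (fun x => a * u x + b * v x).
Proof.
move=> su sv s; rewrite pderivs_lin//.
have [cu du] := su s; have [cv dv] := sv s; split=> [x|i x].
  exact: cvgD (cvgM (cvg_cst _) (cu x)) (cvgM (cvg_cst _) (cv x)).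
by apply: (@derivableD _ _ _ (a *: pderivs s u) (b *: pderivs s v));
  exact: derivableZ.
Qed.

Lemma csmooth_lin (a : R[i]) f g : csmooth f -> csmooth g ->
  csmooth (a *: f + g) /\
  forall s x, cpderivs s (a *: f + g) x = a * cpderivs s f x + cpderivs s g x.
Proof.
move=> [rf jf] [rg jg].
have ReE : (fun x => complex.Re ((a *: f + g) x)) =
    (fun x => 1 * (complex.Re a * complex.Re (f x) +
                   - complex.Im a * complex.Im (f x)) +
              1 * complex.Re (g x)).
  apply/funext => x; rewrite !mul1r mulNr.
  rewrite (_ : (a *: f + g) x = a * f x + g x)//.
  by case: (a) (f x) (g x) => [? ?] [? ?] [? ?].
have ImE : (fun x => complex.Im ((a *: f + g) x)) =
    (fun x => 1 * (complex.Re a * complex.Im (f x) +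
                   complex.Im a * complex.Re (f x)) +
              1 * complex.Im (g x)).
  apply/funext => x; rewrite !mul1r.
  rewrite (_ : (a *: f + g) x = a * f x + g x)//.
  by case: (a) (f x) (g x) => [? ?] [? ?] [? ?].
split.
  by rewrite /csmooth ReE ImE; split; apply: smooth_lin => //; exact: smooth_lin.
move=> s x; rewrite /cpderivs ReE ImE.
rewrite !(pderivs_lin _ _ (smooth_lin _ _ _ _))// !pderivs_lin//.
by case: a {ReE ImE} => a b /=; rewrite !mul1r mulNr.
Qed.

Lemma schwartz_submod_closed : submod_closed [pred f | `[< schwartz f >]].
Proof.
split => [|a f g].
  apply/asboolP.
  have S0 s : pderivs s (cst (0 : R) : 'rV[R]_n -> R) = cst 0.
    by elim: s => [//|i s /= ->]; apply/funext => x; rewrite /pderiv/= derive_cst.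
  have s0 : smooth (cst (0 : R) : 'rV[R]_n -> R).
    by move=> s; rewrite S0; split=> [x|i x]; [exact: cst_continuous|exact: derivable_cst].
  split; first by [].
  move=> N; apply: (@le_lt_trans _ _ 0%E); last exact: ltry.
  apply: ge_ereal_sup => _ [[s x] _ <-].
  rewrite (_ : cpderivs _ _ _ = 0); first by rewrite /cabs Normc.normc0 mulr0.
  exact: (congr2 (fun u v => Complex (u x) (v x)) (S0 s) (S0 s)).
move=> /asboolP[sf nf] /asboolP[sg ng]; apply/asboolP.
have [sh hE] := csmooth_lin a sf sg; split => // N.
apply: (@le_lt_trans _ _
    ((cabs a)%:E * schwartz_norm N f + schwartz_norm N g)%E).
  apply: ge_ereal_sup => _ [[s x] sN <-]; rewrite hE [(s, x).1]/= [(s, x).2]/=.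
  apply: (@le_trans _ _ (((cabs a) * ((1 + `|x|) ^+ N * cabs (cpderivs s f x)))%:E + ((1 + `|x|) ^+ N * cabs (cpderivs s g x))%:E)%E).
    rewrite -EFinD lee_fin mulrCA -mulrDr ler_wpM2l ?exprn_ge0 ?addr_ge0//.
    by rewrite /cabs -Normc.normcM; exact: le_normcD.
  rewrite EFinM; apply: leeD.
    apply: lee_wpmul2l; first by rewrite lee_fin cabs_ge0.
    by apply: ereal_sup_ubound; exists (s, x).
  by apply: ereal_sup_ubound; exists (s, x).
rewrite lte_add_pinfty ?ng// lte_mul_pinfty ?nf//.
by rewrite lee_fin cabs_ge0.
Qed.

End complex_functions.

Section schwartz_space.
Variables (R : realType) (n : nat).

Definition schwartz_pred : {pred 'rV[R]_n -> R[i]} :=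
  [pred f | `[< schwartz f >]].

HB.instance Definition _ := GRing.isSubmodClosed.Build R[i] ('rV[R]_n -> R[i])
  schwartz_pred (@schwartz_submod_closed R n).

Record schwartz_space := SchwartzFun {
  schwartz_fun :> 'rV[R]_n -> R[i];
  _ : schwartz_fun \in schwartz_pred }.

HB.instance Definition _ := [isSub for schwartz_fun].
HB.instance Definition _ := [Choice of schwartz_space by <:].
HB.instance Definition _ :=
  [SubChoice_isSubLmodule of schwartz_space by <:].

End schwartz_space.

Section distributions.
Context {R : realType} {n : nat}.

Definition tempered (T : schwartz_space R n -> R[i]) :=
  linear T /\
  exists (C : R) (N : nat), forall phi : schwartz_space R n,
    ((cabs (T phi))%:E <= C%:E * schwartz_norm N phi)%E.

Definition regular (T : schwartz_space R n -> R[i]) (f : 'rV[R]_n -> R[i]) :=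
  forall phi : schwartz_space R n, T phi = cintegral (fun x => f x * phi x).

(* Unordered (net over finite subsets) summation of a complex family. *)
Definition unordered_sum (I : choiceType) (a : I -> R[i]) (l : R[i]) :=
  forall e : R, 0 < e -> exists A0 : {fset I}, forall A : {fset I},
    (A0 `<=` A)%fset -> cabs (\sum_(k <- A) a k - l) < e.

End distributions.

Section weighted_spaces.
Context {R : realType} {n : nat}.
Implicit Types (p q r rho : R) (w : 'rV[R]_n -> R) (f : 'rV[R]_n -> R[i]).

Local Notation mu := (@lebesgue_rV R n).

Definition conjugate p : R := p / (p - 1).

Definition wmeas w (A : set 'rV[R]_n) : \bar R := (\int[mu]_(x in A) (w x)%:E)%E.

Definition cube (a : 'rV[R]_n) (l : R) : set 'rV[R]_n :=
  [set x | forall i, a ord0 i <= x ord0 i <= a ord0 i + l].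

Definition Ap_constant p w : \bar R :=
  ereal_sup [set
    (let Q := cube al.1 al.2 in
     wmeas w Q / mu Q *
     (wmeas (fun x => w x `^ (1 - conjugate p))%R Q / mu Q) `^ (p - 1))%E |
    al in [set al : 'rV[R]_n * R | 0 < al.2]].

Definition Ap p w :=
  [/\ loc_integrable w, {ae mu, forall x, 0 < w x} & (Ap_constant p w < +oo)%E].

Definition dcube (k : int * 'rV[int]_n) : set 'rV[R]_n :=
  [set 2 ^ (- k.1) *: (map_mx intr k.2 + y) |
    y in [set y : 'rV[R]_n | forall i, -1 <= y ord0 i <= 1]].

Definition morrey_norm p r w f : \bar R :=
  ereal_sup [set (wmeas w (dcube k) `^ (- (p^-1 + r / n%:R)) *
                  wLp_norm p w (dcube k) f)%E | k in setT].

Definition morrey p r w : set ('rV[R]_n -> R[i]) :=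
  [set f | loc_cintegrable f /\ (morrey_norm p r w f < +oo)%E].

Definition HL_representation (h : schwartz_space R n -> R[i])
    (a : int * 'rV[int]_n -> 'rV[R]_n -> R[i]) :=
  [/\ forall k, measurable_cfun (a k),
      forall k, ess_support (a k) `<=` dcube k &
      forall phi : schwartz_space R n,
        unordered_sum (fun k => cintegral (fun x => a k x * phi x)) (h phi)].

Definition HL_cost q rho w (a : int * 'rV[int]_n -> 'rV[R]_n -> R[i]) : \bar R :=
  (\esum_(k in setT) (wmeas w (dcube k) `^ (- (q^-1 + rho / n%:R)) *
    wLp_norm q (cst 1%R) setT
      (fun x => (w x `^ (- (conjugate q)^-1))%:C%C * a k x)%R))%E.

Definition HL q rho w : set (schwartz_space R n -> R[i]) :=
  [set h | tempered h /\
    exists a, HL_representation h a /\ (HL_cost q rho w a < +oo)%E].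

Definition HL_norm q rho w (h : schwartz_space R n -> R[i]) : \bar R :=
  ereal_inf [set HL_cost q rho w a |
    a in [set a | HL_representation h a /\ (HL_cost q rho w a < +oo)%E]].

End weighted_spaces.

Section dual.
Context {R : realType} {V : lmodType R[i]}.
Variables (X : set V) (N : V -> \bar R).

(* g is a function on the subspace X of V; linearity is expressed on elements  *)
(* of X through their values in V.                                             *)
Definition bounded_linear (g : X -> R[i]) :=
  (forall (a : R[i]) (u v s : X),
     \val s = a *: \val u + \val v -> g s = a * g u + g v) /\
  exists C : R, forall u : X, ((cabs (g u))%:E <= C%:E * N (\val u))%E.

Definition dual_norm (g : X -> R[i]) : \bar R :=
  ereal_sup [set (cabs (g u))%:E | u in [set u : X | (N (\val u) <= 1)%E]].

End dual.

Definition represents {R : realType} {n : nat}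
    (X : set (schwartz_space R n -> R[i])) (g : X -> R[i])
    (gt : 'rV[R]_n -> R[i]) :=
  forall (f : 'rV[R]_n -> R[i]) (u : X), test_function f ->
    regular (\val u) f -> g u = cintegral (fun x => gt x * f x).

(* Main.v *)
(* Let s = 1/p + r/n, so that 0 < s < 1/p, let q = p' and let v = w^(1 - q) be the
   dual weight.  As r + rho = -n, an atom a on a cube Q costs
   w(Q)^s (int |a|^q v)^(1/q), whereas a Morrey function g controls
   w(Q)^(-s) (int_Q |g|^p w)^(1/p): by Hoelder's inequality on each cube, the
   pairing of a representation with g is at most cost times norm.  Bounded
   functions of bounded support are Morrey functions (this uses s < 1/p), so the
   atoms of h in H^rho L_q sum in L_1 on bounded sets to a density A, which the
   action of h on bumps determines, and h |-> int A g is the functional given by g.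
   Conversely, a bounded functional restricted to bounded functions on a fixed
   cube is continuous for the norm of L_q(v), so the Radon-Nikodym theorem
   represents it by a locally integrable U; testing on |U|^(p-1) w sgn U, which is
   a single atom on Q, bounds the norm of U in L_p(w, Q).  Test functions are dense
   because finitely many atoms carry all but a small part of the cost, and their
   sum is approximated in L_q(v) by test functions inside one large cube. *)

(* The obstacle is that an element of H^rho L_q is only a tempered functional: it acts on Schwartz
   functions, not on Morrey functions, and it has many representations. A density determined almost
   everywhere removes both difficulties: the pairing becomes an integral, and linearity and
   independence of the representation reduce to uniqueness of the density. Smoothing is done without
   convolution. The bumps exp(-c / ((t - a)(b - t))), multiplied over the coordinates, tend to the
   indicator of an open box as c tends to 0, so a property stable under linear combinations and
   bounded limits passes from bumps to all bounded measurable functions on a cube. This principle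
   gives both the uniqueness of densities and the approximation in L_q(v) by smooth functions. Real
   and imaginary parts are estimated separately, which is the origin of the final constants: 2 comes
   from |z| <= |Re z| + |Im z|, and 4 from the same splitting followed by (x + y)^p <= 2^p (x^p +
   y^p). Before all this, w is changed on a null set so as to be positive everywhere. *)
From HB Require Import structures.
Require Import Defs.
From mathcomp Require Import ring lra.

Set Implicit Arguments.
Unset Strict Implicit.
Unset Printing Implicit Defensive.

Local Open Scope classical_set_scope.
Local Open Scope ring_scope.

(** * Borel sets of R^n *)

Section borel_rV.
Context {R : realType} {n : nat}.
Local Notation mu := (@lebesgue_rV R n).
Implicit Types (U : set 'rV[R]_n) (x : 'rV[R]_n).

Definition rat_ball (qk : 'rV[rat]_n * nat) : set 'rV[R]_n :=
  ball (map_mx ratr qk.1 : 'rV[R]_n) (qk.2.+1%:R^-1).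

(** A countable base. It makes open sets measurable for the coordinate sigma-algebra, and it
    replaces the uncountable union in [ess_support] by a countable one. *)
Lemma rat_ball_basis U x : open U -> U x -> exists qk, rat_ball qk x /\ rat_ball qk `<=` U.
Proof.
move=> oU Ux.
have /nbhs_ballP[e /= e0 eU] : nbhs x U by exact: open_nbhs_nbhs.
pose k := Num.trunc (2 / e).
have k1 : (k.+1%:R^-1 : R) <= e / 2.
  rewrite -[leRHS]invrK lef_pV2 ?posrE ?invr_gt0 ?divr_gt0 ?ltr0n// invf_div.
  by apply/ltW; exact: truncnS_gt.
have q i : exists q : rat, `|x ord0 i - ratr q| < k.+1%:R^-1.
  have [|q] := @rat_in_itvoo R (x ord0 i - k.+1%:R^-1) (x ord0 i + k.+1%:R^-1).
    by rewrite ltrD2l -subr_gt0 opprK addr_gt0// invr_gt0 ltr0n.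
  by rewrite in_itv/= => /andP[q1 q2]; exists q; rewrite distrC ltr_distl q1 q2.
pose qv : 'rV[rat]_n := \row_i projT1 (cid (q i)).
exists (qv, k); split.
  split; first by rewrite invr_gt0.
  move=> i j; rewrite ord1 !mxE; case: cid => r /= xr.
  by rewrite /ball/= distrC.
move=> y [_ ky]; apply: eU; split => // i j.
rewrite ord1; have := ky ord0 j; rewrite !mxE; case: cid => r /= xr.
rewrite /ball/= => ry.
rewrite (le_lt_trans (ler_distD (ratr r) _ _))//.
by rewrite (splitr e) ltrD// (lt_le_trans _ k1).
Qed.

Lemma measurable_ball_rV x (e : R) : measurable (ball x e).
Proof.
(* For [e <= 0] the ball is empty, whereas the intersection over the coordinates is not when n =
   0. *)
have [e0|e0] := ltP 0 e; last first.
  rewrite (_ : ball _ _ = set0)//; apply/seteqP; split => // y [].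
  by rewrite ltNge e0.
rewrite (_ : ball _ _ = \bigcap_(i in [set: 'I_n])
    (coord_rV i @^-1` (ball (x ord0 i) e))).
  apply: fin_bigcap_measurable => // i _.
  rewrite -[X in measurable X]setTI; apply: measurable_coord_rV => //.
  exact: measurable_ball.
apply/seteqP; split => [y [_ h] i _|y h]; first exact: h.
by split=> // i j; rewrite ord1; exact: h.
Qed.

Lemma open_measurable_rV U : open U -> measurable U.
Proof.
move=> oU.
rewrite (_ : U = \bigcup_(qk : 'rV[rat]_n * nat)
   (if `[< rat_ball qk `<=` U >] then rat_ball qk else set0)).
  apply: countable_bigcupT_measurable; first exact: countableP.
  by move=> qk; case: ifP => // _; exact: measurable_ball_rV.
apply/seteqP; split => [x Ux|x [qk _]]; last by case: asboolP => // + qx; exact.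
have [qk [qx qU]] := rat_ball_basis oU Ux.
by exists qk => //; rewrite asboolT.
Qed.

Lemma closed_measurable_rV U : closed U -> measurable U.
Proof.
move=> cU; rewrite -[U]setCK; apply: measurableC.
by apply: open_measurable_rV; exact: closed_openC.
Qed.

Lemma compact_measurable_rV U : compact U -> measurable U.
Proof.
move=> cU; apply: closed_measurable_rV; exact: compact_closed.
Qed.

Lemma continuous_measurable_rV (f : 'rV[R]_n -> R) : continuous f -> measurable_fun setT f.
Proof.
move=> /continuousP cf; apply: (measurability _ (RGenOpens.measurableE R)) => //.
move=> _ [_ [a [b ->]] <-]; rewrite setTI; apply: open_measurable_rV.
exact/cf/interval_open.
Qed.

(** Uncountably many open sets may occur in the definition of [ess_support]. Only the rational balls
    on which f vanishes almost everywhere are kept: they cover the same union, and their exceptional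
    sets [N k] are countably many, hence together null. *)
Lemma ess_support_subP (f : 'rV[R]_n -> R[i]) (A : set 'rV[R]_n) : closed A ->
  ess_support f `<=` A <-> {ae mu, forall x, ~ A x -> f x = 0}.
Proof.
move=> cA; split => [fA|fA]; last first.
  rewrite -[X in _ `<=` X]setCK; apply/subsetC => x nAx.
  by exists (~` A) => //; split=> //; exact: closed_openC.
pose N (k : nat) : set 'rV[R]_n :=
  if (@choice.unpickle _ k : option ('rV[rat]_n * nat)%type) is Some qk then
    (if `[< {ae mu, forall x, rat_ball qk x -> f x = 0} >]
     then ~` [set x | rat_ball qk x -> f x = 0] else set0) else set0.
have N0 : mu.-negligible (\bigcup_(k : nat) (N k : set 'rV[R]_n)).
  apply: negligible_bigcup => k; rewrite /N.
  case: choice.unpickle => [qk|]; last exact: negligible_set0.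
  by case: asboolP => [//|_]; exact: negligible_set0.
apply: negligibleS N0 => x /= /not_implyP[nAx fx0].
have [U [oU Uf] Ux] : (\bigcup_(U in [set U | open U /\ {ae mu, forall x, U x -> f x = 0}]) U) x.
  by apply: contrapT => nx; apply: nAx; apply: fA.
have [qk [qx qU]] := rat_ball_basis oU Ux.
exists (choice.pickle qk) => //; rewrite /N choice.pickleK asboolT; last first.
  by apply: filterS Uf => y h qy; apply: h; exact: qU.
by move=> /= /(_ qx).
Qed.

End borel_rV.

(** * Smooth bumps *)

Section bump1.
Context {R : realType}.
Variables (a b c : R).
Hypothesis c_gt0 : 0 < c.
Implicit Types (P : {poly R}) (k : nat) (t : R).

Let D : {poly R} := ('X - a%:P) * (b%:P - 'X).

Let DE t : D.[t] = (t - a) * (b - t).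
Proof. by rewrite !hornerE. Qed.

(* Derivatives of exp(- c / D) have the form P / D ^ k * exp(- c / D), a class
   closed under differentiation. *)
Definition bump1 P k t : R :=
  if a < t < b then P.[t] * D.[t]^-1 ^+ k * expR (- c * D.[t]^-1) else 0.

(** The numerator of the derivative of P / D ^ k * exp(- c / D) over the common denominator D ^ (k +
    2). *)
Definition bump1_deriv P k : {poly R} :=
  P^`() * D ^+ 2 - k%:R%:P * P * D^`() * D + c%:P * P * D^`().

(** A single term (c y)^k / k! of the exponential series is at most exp(c y). With y = 1 / D this
    beats the poles of the bumps. *)
Lemma exprn_expRN_le k (y : R) : 0 <= y -> y ^+ k * expR (- c * y) <= k`!%:R / c ^+ k.
Proof.
move=> y0; rewrite mulNr expRN ler_pdivrMr ?expR_gt0// mulrAC ler_pdivlMr ?exprn_gt0//.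
rewrite -exprMn [y * c]mulrC.
case: k => [|k].
  by rewrite expr0 fact0 mul1r -expR0 ler_expR; apply: mulr_ge0 => //; exact: ltW.
have f0 : (0 : R) < k.+1`!%:R by rewrite ltr0n fact_gt0.
rewrite [leRHS]mulrC -ler_pdivrMr//.
by apply: le_trans (@expR_ge1Dxn R (c * y) k (mulr_ge0 (ltW c_gt0) y0)); rewrite lerDr ler01.
Qed.

Lemma bump1_le P k : exists2 M, 0 <= M & forall t, `|bump1 P k t| <= M.
Proof.
have [M0 M0P] := poly_itv_bound P a b.
have f0 : 0 <= k`!%:R / c ^+ k by rewrite divr_ge0 ?exprn_ge0 ?ltW// ltr0n fact_gt0.
exists (Num.max 0 M0 * (k`!%:R / c ^+ k)).
  by rewrite mulr_ge0// le_max lexx.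
move=> t; rewrite /bump1; case: ifPn => [/andP[at0 tb]|_]; last first.
  by rewrite normr0 mulr_ge0// le_max lexx.
have D0 : 0 < D.[t] by rewrite DE mulr_gt0 ?subr_gt0.
rewrite -mulrA normrM ler_pM//.
  by rewrite le_max M0P ?orbT// !ltW.
rewrite ger0_norm; last by rewrite mulr_ge0 ?expR_ge0// exprn_ge0// invr_ge0 ltW.
by apply: exprn_expRN_le; rewrite invr_ge0 ltW.
Qed.

(** Raising k by two frees a factor D(t)^2, and D(t) <= |b - a| |t - t0| because t0 lies beyond one
    of the end points. The quadratic bound gives derivative 0 at every point outside the open
    interval. *)
Lemma bump1_le_sqr P k : exists2 M, 0 <= M & forall t t0, ~~ (a < t0 < b) ->
  `|bump1 P k t| <= M * (t - t0) ^+ 2.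
Proof.
have [M M0 MP] := bump1_le P k.+2.
exists (M * (b - a) ^+ 2) => [|t t0 t0ab]; first by apply: mulr_ge0 => //; exact: sqr_ge0.
have [/andP[at0 tb]|tab] := boolP (a < t < b); last first.
  rewrite /bump1 (negbTE tab) normr0; apply: mulr_ge0; last exact: sqr_ge0.
  by apply: mulr_ge0 => //; exact: sqr_ge0.
have D0 : 0 < D.[t] by rewrite DE mulr_gt0 ?subr_gt0.
have -> : bump1 P k t = bump1 P k.+2 t * D.[t] ^+ 2.
  rewrite /bump1 at0 tb; move: D0; move: D.[t] => y y0.
  rewrite !exprS expr0; move: (expR _) (y^-1 ^+ k) => E Z.
  by move=> /=; field; rewrite gt_eqF.
rewrite normrM -mulrA ler_pM// ger0_norm ?sqr_ge0//.
rewrite -exprMn -[leRHS]ger0_norm ?sqr_ge0// normrX ler_pXn2r ?nnegrE ?(ltW D0)//.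
have ta : 0 <= t - a by lra.
have bt : 0 <= b - t by lra.
have ba : `|b - a| = b - a by rewrite ger0_norm; lra.
move: t0ab; rewrite negb_and -!leNgt DE normrM ba => /orP[t0a|bt0].
  by rewrite mulrC ler_pM// ?ger0_norm; lra.
by rewrite ler_pM// ?ler0_norm; lra.
Qed.

Lemma is_derive_bump1 P k t : is_derive t 1 (bump1 P k) (bump1 (bump1_deriv P k) k.+2 t).
Proof.
have [tab|tab] := boolP (a < t < b).
  have [at0 tb] := andP tab.
  have D0 : 0 < D.[t] by rewrite DE mulr_gt0 ?subr_gt0.
  pose g := (horner P * (fun t => D.[t]^-1) ^+ k) * (expR \o ((- c) *: (fun t => D.[t]^-1))).
  apply: (@near_eq_is_derive _ _ _ g).
    have : \forall y \near t, y \in `]a, b[.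
      exact: near_in_itvoo.
    apply: filterS => y; rewrite in_itv/= => yab.
    rewrite /bump1 yab /g /= !fctE /=.
    by congr (_ * _ * expR _).
  have dP := is_derive_poly P t.
  have dD := is_derive_poly D t.
  have dV := @is_deriveV _ _ _ _ _ (lt0r_neq0 D0) dD.
  have dX := is_deriveX k dV.
  have dPX := is_deriveM dP dX.
  have dc := is_deriveZ (- c) dV.
  have de := is_derive1_comp (is_derive_expR _) dc.
  have dg := is_deriveM dPX de.
  apply: DeriveDef; first exact: (@ex_derive _ _ _ _ _ _ _ dg).
  rewrite (@derive_val _ _ _ _ _ _ _ dg) /bump1 tab /= !fctE /=.
  have -> : (bump1_deriv P k).[t] = P^`().[t] * D.[t] ^+ 2
      - k%:R * P.[t] * D^`().[t] * D.[t] + c * P.[t] * D^`().[t].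
    rewrite /bump1_deriv; move: D D^`() => D1 D2.
    by rewrite expr2 !(hornerD, hornerN, hornerM, hornerC) expr2.
  move: D0; rewrite /GRing.scale /=.
  move: (D.[t]) (D^`().[t]) (P.[t]) (P^`().[t]) => y d Pt P't y0.
  move: (expR _) => E.
  have yE : y != 0 by rewrite gt_eqF.
  case: k {dX dPX dg g} => [|k].
    by rewrite /= !expr0; field.
  by rewrite /= !exprS; move: (y^-1 ^+ k) => Z; field.
(* Outside the open interval, end points included, the function vanishes at t and the difference
   quotient is at most M |h|. *)
have [M M0 MP] := bump1_le_sqr P k.
have -> : bump1 (bump1_deriv P k) k.+2 t = 0 by rewrite /bump1 (negbTE tab).
have cv : (h^-1 *: (bump1 P k (h *: 1 + t) - bump1 P k t)) @[h --> 0^'] --> (0 : R).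
  apply/cvgr0Pnorm_le => e e0.
  have B0 : bump1 P k t = 0 by rewrite /bump1 (negbTE tab).
  near=> h.
  rewrite B0 subr0 normrZ normfV.
  have h0 : h != 0 by near: h; exact: nbhs_dnbhs_neq.
  rewrite mulrC ler_pdivrMr ?normr_gt0//.
  rewrite (le_trans (MP _ t tab))// /GRing.scale /= mulr1 addrK.
  rewrite -[h ^+ 2]ger0_norm ?sqr_ge0// normrX expr2 mulrA ler_wpM2r//.
  have hM : `|h| <= e / (M + 1).
    near: h; apply: dnbhs0_le; rewrite divr_gt0//; lra.
  have M1 : 0 < M + 1 by lra.
  rewrite ler_pdivlMr// in hM.
  have := normr_ge0 h; nra.
by apply: DeriveDef; [apply/cvg_ex; exists 0|exact: cvg_lim].
Unshelve. all: by end_near.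
Qed.

Lemma continuous_bump1 P k : continuous (bump1 P k).
Proof.
move=> t; apply: differentiable_continuous; apply/derivable1_diffP.
exact: (@ex_derive _ _ _ _ _ _ _ (is_derive_bump1 P k t)).
Qed.

End bump1.

Section bump_rV.
Context {R : realType} {n : nat}.
Implicit Types (F : 'I_n -> {poly R} * nat) (x : 'rV[R]_n) (u : 'rV[R]_n -> R).

Lemma compact_box (a b : 'I_n -> R) : compact [set x : 'rV[R]_n | forall i, a i <= x ord0 i <= b i].
Proof.
rewrite (_ : [set _ | _] = [set x : 'rV[R]_n | forall i, `[a i, b i]%classic (x ord0 i)]).
  apply: (@rV_compact R n (fun i => `[a i, b i]%classic)) => i.
  exact: segment_compact.
by apply/seteqP; split => x /= h i; have := h i; rewrite /= in_itv.
Qed.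

Lemma closed_box (a b : 'I_n -> R) : closed [set x : 'rV[R]_n | forall i, a i <= x ord0 i <= b i].
Proof. by have := compact_box (a := a) (b := b); exact: compact_closed. Qed.

Lemma pderivs0 s : pderivs s (cst 0 : 'rV[R]_n -> R) = cst 0.
Proof. by elim: s => [//|i s /= ->]; apply/funext => x; rewrite /pderiv/= derive_cst. Qed.

Lemma smooth0 : smooth (cst 0 : 'rV[R]_n -> R).
Proof.
by move=> s; rewrite pderivs0; split=> [x|i x]; [exact: cst_continuous|exact: derivable_cst].
Qed.

Definition toC u (x : 'rV[R]_n) : R[i] := (u x)%:C%C.

Lemma csmooth_toC u : smooth u -> csmooth (toC u).
Proof. by move=> su; split; [exact: su|exact: smooth0]. Qed.

Lemma cabs_toC (z : R) : cabs z%:C%C = `|z|.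
Proof. by rewrite /cabs /= expr0n addr0 sqrtr_sqr. Qed.

Lemma cpderivs_toC s u : cpderivs s (toC u) = toC (pderivs s u).
Proof.
by apply/funext => x; congr Complex; rewrite -[RHS]/((cst 0 : 'rV[R]_n -> R) x) -(pderivs0 s).
Qed.

Variables (a b : 'I_n -> R) (c : R).
Hypothesis c_gt0 : 0 < c.

(** Each coordinate carries its own pair (P, k), so that the family of these products is closed
    under partial derivatives: direction j changes only the factor of index j. *)
Definition bump_rV F x : R :=
  \prod_i bump1 (a i) (b i) c (F i).1 (F i).2 (x ord0 i).

Definition bump_rV_deriv j F i : {poly R} * nat :=
  if i == j then (bump1_deriv (a i) (b i) c (F i).1 (F i).2, (F i).2.+2) else F i.

Lemma is_derive_bump_rV F x j :
  is_derive x (delta_mx ord0 j) (bump_rV F) (bump_rV (bump_rV_deriv j F) x).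
Proof.
pose C := \prod_(i | i != j) bump1 (a i) (b i) c (F i).1 (F i).2 (x ord0 i).
pose f := bump1 (a j) (b j) c (F j).1 (F j).2.
have fE h : bump_rV F (h *: delta_mx ord0 j + x) = f (h *: 1 + x ord0 j) * C.
  rewrite /bump_rV (bigD1 j)//= !mxE !eqxx mulr1; congr (f _ * _).
    by rewrite /GRing.scale /= mulr1.
  apply: eq_bigr => i ij; congr bump1.
  by rewrite !mxE eqxx (negbTE ij) mulr0 add0r.
have f0 : bump_rV F x = f (x ord0 j) * C by rewrite /bump_rV (bigD1 j).
have dE : bump_rV (bump_rV_deriv j F) x =
    C * bump1 (a j) (b j) c (bump1_deriv (a j) (b j) c (F j).1 (F j).2) (F j).2.+2 (x ord0 j).
  rewrite /bump_rV (bigD1 j)//= {1 2}/bump_rV_deriv eqxx mulrC; congr (_ * _).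
  by apply: eq_bigr => i ij; rewrite /bump_rV_deriv (negbTE ij).
have df := is_derive_bump1 (a j) (b j) c_gt0 (F j).1 (F j).2 (x ord0 j).
have qE : (fun h => h^-1 *: (bump_rV F (h *: delta_mx ord0 j + x) - bump_rV F x)) =
    (fun h => C *: (h^-1 *: (f (h *: 1 + x ord0 j) - f (x ord0 j)))).
  apply/funext => h; rewrite fE f0 -mulrBl /GRing.scale /=; ring.
have cv : (h^-1 *: (bump_rV F (h *: delta_mx ord0 j + x) - bump_rV F x)) @[h --> 0^']
    --> bump_rV (bump_rV_deriv j F) x.
  rewrite qE dE; apply: cvgZr.
  rewrite -(@derive_val _ _ _ _ _ _ _ df).
  exact: (@ex_derive _ _ _ _ _ _ _ df).
by apply: DeriveDef; [apply/cvg_ex; eexists; exact: cv|exact: cvg_lim].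
Qed.

Lemma pderivs_bump_rV s F : exists F', pderivs s (bump_rV F) = bump_rV F'.
Proof.
elim: s => [|j s [F' /= ->]]; first by exists F.
exists (bump_rV_deriv j F'); apply/funext => x.
exact: (@derive_val _ _ _ _ _ _ _ (is_derive_bump_rV F' x j)).
Qed.

Lemma continuous_bump_rV F : continuous (bump_rV F).
Proof.
rewrite /bump_rV; elim: (index_enum 'I_n) => [|i s IH] x.
  rewrite (_ : (fun _ => _) = cst 1); first exact: cst_continuous.
  by apply/funext => y; rewrite big_nil.
rewrite (_ : (fun _ => _) = (bump1 (a i) (b i) c (F i).1 (F i).2 \o (fun y : 'rV[R]_n => y ord0 i))
   \* (fun y => \prod_(i <- s) bump1 (a i) (b i) c (F i).1 (F i).2 (y ord0 i))); last first.
  by apply/funext => y; rewrite big_cons.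
apply: continuousM; last exact: IH.
by apply: continuous_comp; [exact: coord_continuous|exact: continuous_bump1].
Qed.

Lemma smooth_bump_rV F : smooth (bump_rV F).
Proof.
move=> s; have [F' ->] := pderivs_bump_rV s F; split; first exact: continuous_bump_rV.
by move=> j x; exact: (@ex_derive _ _ _ _ _ _ _ (is_derive_bump_rV F' x j)).
Qed.

Lemma bump_rV_le F : exists2 M, 0 <= M & forall x, `|bump_rV F x| <= M.
Proof.
have M i : exists M, 0 <= M /\ forall t, `|bump1 (a i) (b i) c (F i).1 (F i).2 t| <= M.
  by have [M M0 MP] := bump1_le (a i) (b i) c_gt0 (F i).1 (F i).2; exists M.
exists (\prod_i projT1 (cid (M i))) => [|x].
  by apply: prodr_ge0 => i _; case: cid => ? [].
rewrite normr_prod; apply: ler_prod => i _; rewrite normr_ge0 /=.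
by case: cid => ? []/= _; exact.
Qed.

Lemma bump_rV0 F x : ~~ [forall i, a i < x ord0 i < b i] -> bump_rV F x = 0.
Proof.
rewrite negb_forall => /existsP[i xi].
by rewrite /bump_rV (bigD1 i)//= /bump1 (negbTE xi) mul0r.
Qed.

Lemma closure_supp_bump_rV F :
  closure [set x | toC (bump_rV F) x != 0] `<=` [set x | forall i, a i <= x ord0 i <= b i].
Proof.
apply: subset_trans (@closed_box a b); apply: closure_subset => x /=; apply: contraPP => /existsNP[i xi].
apply/negP; rewrite negbK /toC bump_rV0//; apply/negP => /forallP /(_ i)/andP[? ?].
by apply: xi; rewrite !ltW.
Qed.

Lemma test_function_bump_rV F : test_function (toC (bump_rV F)).
Proof.
split; first by apply: csmooth_toC; exact: smooth_bump_rV.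
apply: (@subclosed_compact _ _ [set x : 'rV[R]_n | forall i, a i <= x ord0 i <= b i]).
- exact: closed_closure.
- exact: compact_box.
- exact: closure_supp_bump_rV.
Qed.

(** The Schwartz norms need a bound uniform in the list of directions. As [pderivs] is a [foldr],
    the last direction acts first; removing it replaces F by one of the n families
    [bump_rV_deriv i F], and the n bounds of the induction hypothesis are added. *)
Lemma bump_rV_derivs_le N F : exists2 M, 0 <= M &
  forall s x, (size s <= N)%N -> `|pderivs s (bump_rV F) x| <= M.
Proof.
elim: N F => [|N IH] F; have [M0 M00 M0P] := bump_rV_le F.
  by exists M0 => // s x; rewrite leqn0 size_eq0 => /eqP ->; exact: M0P.
have M i : exists M, 0 <= M /\ forall s x, (size s <= N)%N ->
    `|pderivs s (bump_rV (bump_rV_deriv i F)) x| <= M.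
  by have [M ? ?] := IH (bump_rV_deriv i F); exists M.
have S0 j : 0 <= projT1 (cid (M j)) by case: cid => ? [].
exists (M0 + \sum_i projT1 (cid (M i))).
  by rewrite addr_ge0// sumr_ge0.
move=> s x; case/lastP : s => [_|s i].
  by rewrite (le_trans (M0P _))// lerDl sumr_ge0.
rewrite size_rcons ltnS => sN.
rewrite -cats1 /pderivs foldr_cat /=.
rewrite (_ : pderiv i _ = bump_rV (bump_rV_deriv i F)); last first.
  apply/funext => y; exact: (@derive_val _ _ _ _ _ _ _ (is_derive_bump_rV F y i)).
have -> : foldr pderiv (bump_rV (bump_rV_deriv i F)) s = pderivs s (bump_rV (bump_rV_deriv i F)) by [].
rewrite (le_trans ((projT2 (cid (M i))).2 s x sN))//.
rewrite (bigD1 i)//= addrCA lerDl; apply: addr_ge0 => //; apply: sumr_ge0 => j _; exact: S0.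
Qed.

Lemma schwartz_bump_rV F : schwartz (toC (bump_rV F)).
Proof.
split; first by apply: csmooth_toC; exact: smooth_bump_rV.
move=> N; have [M M0 MP] := bump_rV_derivs_le N F.
pose L := \sum_i (`|a i| + `|b i|).
have L0 : 0 <= L by rewrite sumr_ge0// => i _; rewrite addr_ge0.
apply: (@le_lt_trans _ _ ((1 + L) ^+ N * M)%:E); last exact: ltry.
apply: ge_ereal_sup => _ [[s x] sN <-].
rewrite lee_fin [(s, x).1]/= [(s, x).2]/= cpderivs_toC cabs_toC.
have {}sN : (size s <= N)%N by [].
have [F' F'E] := pderivs_bump_rV s F.
have [/forallP xab|xab] := boolP [forall i, a i < x ord0 i < b i]; last first.
  by rewrite F'E bump_rV0// normr0 mulr0 mulr_ge0// exprn_ge0// addr_ge0.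
apply: ler_pM; [by rewrite exprn_ge0// addr_ge0|by []| |exact: MP].
apply: lerXn2r; rewrite ?nnegrE ?addr_ge0// lerD2l.
  have [->|x0] := eqVneq x 0; first by rewrite normr0.
  have /mx_norm_neq0[oi] : mx_norm x != 0 by apply: contra_neq x0 => /mx_norm_eq0.
  case: oi => o i; rewrite ord1 /= => xE; rewrite [leLHS]xE /L (bigD1 i)//= -[leLHS]addr0 lerD//.
    have := xab i => /andP[a1 b1]; have := ler_norm (b i); have := ler_norm (- a i).
    have := normr_ge0 (a i); have := normr_ge0 (b i); rewrite normrN ler_norml; lra.
  by rewrite sumr_ge0// => j _; rewrite addr_ge0.
Qed.

End bump_rV.

(** * Monotone class arguments *)

Lemma sum_indic_trivIset {T : Type} {R : realType} (F : (set T)^nat) N x :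
  trivIset setT F -> \sum_(k <- iota 0 N) \1_(F k) x = \1_(\bigcup_(k < N) F k) x :> R.
Proof.
move=> tF; elim: N => [|N IH].
  by rewrite big_nil indicE bigcup_mkord big_ord0 in_set0.
rewrite -addn1 iotaD big_cat/= IH big_seq1 add0n addn1.
rewrite [in RHS]bigcup_mkord big_ord_recr/= -bigcup_mkord !indicE in_setU.
case: (boolP (x \in F N)) => [/set_mem xN|_]; last by rewrite orbF addr0.
rewrite memNset ?add0r// => -[k /= kN Fk].
have := tF k N Logic.I Logic.I; have := ltn_eqF kN.
by move=> /eqP kN' /(_ (ex_intro _ x (conj Fk xN))).
Qed.

Lemma cvg_sum_indic {T : Type} {R : realType} (F : (set T)^nat) x : trivIset setT F ->
  \sum_(k <- iota 0 N) \1_(F k) x @[N --> \oo] --> (\1_(\bigcup_k F k) x : R).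
Proof.
move=> tF; under eq_fun do rewrite sum_indic_trivIset//.
have [[k _ Fk]|nF] := pselect ((\bigcup_k F k) x); apply: cvg_near_cst.
  exists k.+1 => // N /= kN; rewrite !indicE.
  have -> : x \in \bigcup_(k < N) F k by apply/mem_set; exists k.
  by have -> : x \in \bigcup_k F k by apply/mem_set; exists k.
apply: nearW => N; rewrite !indicE (memNset nF) memNset// => -[k _ Fk].
by apply: nF; exists k.
Qed.

Import HBNNSimple.

Section monotone_class.
Context {R : realType} {n : nat}.
Implicit Types (x : 'rV[R]_n) (a b : 'I_n -> R).

Definition box a b : set 'rV[R]_n := [set x | forall i, a i < x ord0 i < b i].

(** The constant c = 1 / (k + 1) tends to 0, so these functions, with values in [0, 1], converge
    pointwise to the indicator of the open box. *)
Definition bump a b (k : nat) : 'rV[R]_n -> R :=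
  bump_rV a b k.+1%:R^-1 (fun=> (1, 0%N)).

Lemma bump_ge0_le1 a b k x : 0 <= bump a b k x <= 1.
Proof.
suff H i : 0 <= bump1 (a i) (b i) k.+1%:R^-1 1 0 (x ord0 i) <= 1.
  rewrite /bump /bump_rV; apply/andP; split.
    by apply: prodr_ge0 => i _; have /andP[] := H i.
  by apply: prodr_ile1 => i _.
rewrite /bump1 hornerC mul1r expr0 mul1r; case: ifPn => [/andP[ax xb]|_]; last by rewrite lexx ler01.
rewrite expR_ge0 /= -expR0 ler_expR mulNr oppr_le0 mulr_ge0 ?invr_ge0//.
by rewrite !hornerE mulr_ge0// subr_ge0 ltW.
Qed.

Lemma bump_out a b k x : ~ box a b x -> bump a b k x = 0.
Proof. by move=> xab; apply: bump_rV0; apply/negP => /forallP. Qed.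

Lemma cvg_bigprod (I : Type) (s : seq I) (u : I -> nat -> R) (l : I -> R) :
  (forall i, u i k @[k --> \oo] --> l i) ->
  \prod_(i <- s) u i k @[k --> \oo] --> \prod_(i <- s) l i.
Proof.
move=> ul; elim: s => [|i s IH].
  rewrite big_nil (_ : (fun _ => _) = fun=> 1); first exact: cvg_cst.
  by apply/funext => k; rewrite big_nil.
rewrite big_cons (_ : (fun k => _) = (fun k => u i k * \prod_(i <- s) u i k)).
  by apply: cvgM.
by apply/funext => k; rewrite big_cons.
Qed.

Lemma bump_cvg a b x : bump a b k x @[k --> \oo] --> (\1_(box a b) x : R).
Proof.
have -> : \1_(box a b) x = \prod_(i < n) (a i < x ord0 i < b i)%R%:R :> R.
  rewrite indicE; have [/forallP xab|] := boolP [forall i, a i < x ord0 i < b i].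
    by rewrite mem_set// big1// => i _; rewrite xab.
  rewrite negb_forall => /existsP[i xi].
  rewrite (bigD1 i)//= (negbTE xi) mul0r memNset// => /(_ i).
  exact/negP.
apply: cvg_bigprod => i.
rewrite /= /bump1; have [xab|xab] := boolP (a i < x ord0 i < b i); last exact: cvg_cst.
set d := _.[_]^-1.
rewrite (_ : (fun k => _) = (fun k : nat => expR (- (k.+1%:R^-1 * d)))); last first.
  by apply/funext => k; rewrite hornerC expr0 !mul1r mulNr.
rewrite [X in _ --> X](_ : 1%:R = expR (- (0 * d))); last by rewrite mul0r oppr0 expR0.
apply: continuous_cvg; first exact: continuous_expR.
apply: cvgN; apply: cvgMl; exact: cvg_harmonic.
Qed.

Lemma measurable_bump a b k : measurable_fun setT (bump a b k).
Proof. by apply: continuous_measurable_rV; exact: continuous_bump_rV. Qed.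

Lemma measurable_box a b : measurable (box a b).
Proof.
rewrite (_ : box a b = \bigcap_(i in [set: 'I_n]) (coord_rV i @^-1` `]a i, b i[%classic)).
  apply: fin_bigcap_measurable => // i _.
  by rewrite -[X in measurable X]setTI; apply: measurable_coord_rV.
apply/seteqP; split => [x xab i _|x xab i] /=; first by rewrite in_itv/=; exact: xab.
by have := xab i Logic.I; rewrite /= in_itv.
Qed.

(** An exhaustion of the space by open cubes. The half side is a power of 2 so that each lies in a
    dyadic cube centred at 0, see [bigcube]. *)
Definition ocube (m : nat) : set 'rV[R]_n := box (fun=> - 2 ^+ m) (fun=> 2 ^+ m).

Definition orthants : set (set 'rV[R]_n) :=
  [set E | exists a, E = [set x : 'rV[R]_n | forall i, a i < x ord0 i]].

(** A half-space {y < x_i} is the union over N of the orthants whose other bounds are -N. Orthants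
    are stable under intersection, and cut by [ocube m] they are boxes, on which bumps are
    available. *)
Lemma measurable_rVE : @measurable _ 'rV[R]_n = <<s orthants >>.
Proof.
apply/seteqP; split; last first.
  apply: smallest_sub; first exact: sigma_algebra_measurable.
  move=> _ [a ->].
  rewrite (_ : [set _ | _] = \bigcap_(i in [set: 'I_n]) (coord_rV i @^-1` `]a i, +oo[%classic)).
    apply: fin_bigcap_measurable => // i _.
    by rewrite -[X in measurable X]setTI; apply: measurable_coord_rV.
  apply/seteqP; split => [x xab i _|x xab i] /=; first by rewrite in_itv/= andbT; exact: xab.
  by have := xab i Logic.I; rewrite /= in_itv/= andbT.
apply: smallest_sub; first exact: smallest_sigma_algebra.
move=> E; rewrite -bigcup_seq => -[i _ [B mB <-]].
suff : measurable_fun (setT : set (g_sigma_algebraType orthants)) (coord_rV i).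
  by move=> /(_ measurableT _ mB).
apply: (measurability _ (RGenOInfty.measurableE R)) => _ [_ [y ->] <-].
rewrite setTI (_ : _ @^-1` _ = \bigcup_(N : nat)
    [set x : 'rV[R]_n | forall j, (if j == i then y else - N%:R) < x ord0 j]).
  apply: bigcupT_measurable => N; apply: sub_sigma_algebra.
  by exists (fun j => if j == i then y else - N%:R).
apply/seteqP; split => [x|x [N _ /(_ i)]]; rewrite /= in_itv/= andbT; last by rewrite eqxx.
move=> yx; exists (Num.trunc (\sum_j `|x ord0 j|)).+1 => // j.
case: eqP => [->//|_]; rewrite ltrNl.
apply: (@le_lt_trans _ _ (\sum_j `|x ord0 j|)); last exact: truncnS_gt.
rewrite (bigD1 j)//= (le_trans (ler_norm _))// normrN lerDl.
by apply: sumr_ge0.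
Qed.

Lemma setI_closed_orthants : setI_closed orthants.
Proof.
move=> _ _ [a ->] [b ->]; exists (fun i => Num.max (a i) (b i)).
apply/seteqP; split => [x [/= xa xb] i|x /= xab].
  by rewrite gt_max xa xb.
by split => i; have := xab i; rewrite gt_max => /andP[].
Qed.

Lemma bump_le_indic a b k E : box a b `<=` E ->
  forall x, `|bump a b k x| <= 1 * (\1_E x : R).
Proof.
move=> abE x; rewrite mul1r.
have [xab|xab] := pselect (box a b x); last by rewrite bump_out// normr0 indicE.
have /andP[b0 b1] := bump_ge0_le1 a b k x.
by rewrite ger0_norm// indicE mem_set//; exact: abE.
Qed.

Lemma bump_in_ocube m a b k : (forall i : 'I_n, - 2 ^+ m <= a i /\ b i <= 2 ^+ m) ->
  forall x, `|bump a b k x| <= 1 * (\1_(ocube m) x : R).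
Proof.
move=> abm; apply: bump_le_indic => x xab i.
have /andP[ax xb] := xab i; have [am bm] := abm i.
by rewrite (le_lt_trans am)//= (lt_le_trans xb).
Qed.

(** * Classes of functions stable under linear combinations and bounded limits on a cube *)

Section closed_class.
Variables (m : nat) (H : set ('rV[R]_n -> R)).
Hypothesis H_lin : forall c f g, H f -> H g -> H (fun x => c * f x + g x).
Hypothesis H_lim : forall (f_ : nat -> 'rV[R]_n -> R) (f : 'rV[R]_n -> R) (K : R),
  (forall k, H (f_ k)) -> (forall k, measurable_fun setT (f_ k)) ->
  (forall k x, `|f_ k x| <= K * \1_(ocube m) x) ->
  (forall x, f_ k x @[k --> \oo] --> f x) -> H f.

Let H_sum (I : Type) (s : seq I) (c : I -> R) (f : I -> 'rV[R]_n -> R) :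
  H (fun=> 0) -> (forall i, H (f i)) -> H (fun x => \sum_(i <- s) c i * f i x).
Proof.
move=> H0 Hf; elim: s => [|i s IH].
  by rewrite (_ : (fun _ => _) = (fun=> 0))//; apply/funext => x; rewrite big_nil.
rewrite (_ : (fun x => _) = fun x => c i * f i x + \sum_(i <- s) c i * f i x); first exact: H_lin.
by apply/funext => x; rewrite big_cons.
Qed.

Section indicators.
Hypothesis H_indic : forall E, measurable E -> H \1_(E `&` ocube m).

Let H0 : H (fun=> 0).
Proof.
by have := H_indic measurable0; rewrite set0I indic0.
Qed.

Let H_ge0 (f : 'rV[R]_n -> R) (K : R) : measurable_fun setT f -> (forall x, 0 <= f x <= K * \1_(ocube m) x) -> H f.
Proof.
move=> mf f0K.
have f0 x : [set: 'rV[R]_n] x -> (0 <= (EFin \o f) x)%E.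
  by move=> _; rewrite lee_fin; have /andP[] := f0K x.
have mEf : measurable_fun setT (EFin \o f) by exact/measurable_EFinP.
pose g := nnsfun_approx measurableT mEf.
have gcvg x : g k x @[k --> \oo] --> f x.
  have := @cvg_nnsfun_approx _ _ _ _ measurableT _ mEf f0 x Logic.I.
  exact: fine_cvg.
have gf k x : g k x <= f x.
  have gnd : nondecreasing_seq (fun k => g k x).
    by move=> i j ij; exact/lefP/(nd_nnsfun_approx measurableT mEf).
  have := nondecreasing_cvgn_le gnd (cvgP _ (gcvg x)) k.
  by rewrite (cvg_lim _ (gcvg x)).
apply: (@H_lim (fun k => g k) _ K).
- move=> k.
  (* Since 0 <= g k <= f and f vanishes outside the cube, the level sets of nonzero values lie in
     the cube; intersecting them with it changes nothing and brings the indicators into the form of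
     [H_indic]. *)
  have gE : (g k : _ -> R) = (fun x => \sum_(y <- fset_set (range (g k)))
      y * \1_((g k @^-1` [set y]) `&` ocube m) x).
    apply/funext => x; rewrite {1}fimfunE fsbig_finite//=.
    apply: eq_bigr => y _.
    have [->|y0] := eqVneq y 0; first by rewrite !mul0r.
    congr (_ * _); rewrite !indicE in_setI.
    have [/set_mem/= gy|//] := boolP (x \in _).
    rewrite mem_set//; apply: contrapT => xm.
    have := gf k x; have /andP[_ ] := f0K x; rewrite indicE memNset// mulr0 => fx gx.
    have y0' : 0 <= g k x by [].
    rewrite gy in y0'.
    have : y <= 0 by rewrite -gy (le_trans gx).
    by move=> yn; move: y0; rewrite eq_le yn y0'.
  rewrite gE; apply: H_sum H0 _ => y; apply: H_indic.
  exact: measurable_sfunP.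
- by move=> k.
- move=> k x; rewrite ger0_norm//; have /andP[_] := f0K x; exact/le_trans/gf.
- exact: gcvg.
Qed.

Theorem indic_monotone_class (f : 'rV[R]_n -> R) (K : R) : measurable_fun setT f ->
  (forall x, `|f x| <= K * \1_(ocube m) x) -> H f.
Proof.
move=> mf fK.
have -> : f = fun x => -1 * (fun x => Num.max (- f x) 0) x + (fun x => Num.max (f x) 0) x.
  apply/funext => x; rewrite mulN1r /=; case: (leP 0 (f x)) => fx.
    by rewrite max_r ?oppr_le0// oppr0 add0r.
  by rewrite max_l ?oppr_ge0 1?ltW// opprK addr0.
apply: H_lin; apply: (@H_ge0 _ K).
- by apply: measurable_maxr => //; apply: measurable_funN.
- move=> x; rewrite le_max lexx orbT /= ge_max.
  have h := fK x; rewrite (le_trans _ h) ?(le_trans (normr_ge0 _) h)//.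
  by rewrite -normrN ler_norm.
- exact: measurable_maxr.
- move=> x; rewrite le_max lexx orbT /= ge_max.
  have h := fK x; rewrite (le_trans _ h) ?(le_trans (normr_ge0 _) h)//.
  by rewrite ler_norm.
Qed.

End indicators.

Section bumps.
Hypothesis H_bump : forall a b k,
  (forall i, - 2 ^+ m <= a i /\ b i <= 2 ^+ m) -> H (bump a b k).

Let H0 : H (fun=> 0).
Proof.
have h : H (bump (fun=> - 2 ^+ m) (fun=> 2 ^+ m) 0) by exact: H_bump.
rewrite (_ : (fun=> 0) = fun x => -1 * bump (fun=> - 2 ^+ m) (fun=> 2 ^+ m) 0 x +
  bump (fun=> - 2 ^+ m) (fun=> 2 ^+ m) 0 x); first exact: H_lin.
by apply/funext => x; rewrite mulN1r addNr.
Qed.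

Let H_box a b : (forall i, - 2 ^+ m <= a i /\ b i <= 2 ^+ m) -> H \1_(box a b).
Proof.
move=> abm; apply: (@H_lim (bump a b) _ 1).
- by move=> k; exact: H_bump.
- by move=> k; exact: measurable_bump.
- by move=> k x; exact: bump_in_ocube.
- by move=> x; exact: bump_cvg.
Qed.

(** Dynkin's pi-lambda theorem relative to the cube: complements are taken inside [ocube m], and a
    disjoint union is the limit of partial sums, all bounded by the indicator of the cube. *)
Let H_indic E : measurable E -> H \1_(E `&` ocube m).
Proof.
rewrite measurable_rVE => sE; have mE := sE; rewrite -measurable_rVE in mE; move: sE {mE}.
apply: (@dynkin_induction _ _ _ (fun E => H \1_(E `&` ocube m)) measurable_rVE setI_closed_orthants).
- by rewrite setTI; apply: H_box.
- move=> _ [a ->].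
  rewrite (_ : _ `&` _ = box (fun i => Num.max (a i) (- 2 ^+ m)) (fun=> 2 ^+ m)).
    by apply: H_box => i; rewrite le_max lexx orbT.
  apply/seteqP; split => [x [/= xa xm] i|x xab].
    by have /= /andP[x1 x2] := xm i; rewrite /= gt_max (xa i) /=; apply/andP.
  by split => i; have /= := xab i; rewrite gt_max => /andP[/andP[? ?] ?] //; apply/andP.
- move=> S mS HS.
  rewrite (_ : \1_(~` S `&` ocube m) = fun x => -1 * \1_(S `&` ocube m) x + \1_(ocube m) x).
    by apply: H_lin => //; exact: H_box.
  apply/funext => x; rewrite !indicE !in_setI in_setC.
  by case: (x \in S); case: (x \in ocube m); rewrite /=; ring.
- move=> F mF tF HF.
  have tF' : trivIset setT (fun k => F k `&` ocube m) by exact: trivIset_setIr.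
  have mF' k : measurable (F k `&` ocube m) by apply: measurableI => //; exact: measurable_box.
  apply: (@H_lim (fun N x => \sum_(k <- iota 0 N) 1 * \1_(F k `&` ocube m) x) _ 1).
  + by move=> N; exact: H_sum H0 _.
  + by move=> N; apply: measurable_sum => k; apply: measurable_funM => //; exact: measurable_indic.
  + move=> N x; under eq_bigr do rewrite mul1r.
    rewrite sum_indic_trivIset// ger0_norm// mul1r !indicE ler_nat.
    case: (boolP (x \in \bigcup_(k < N) _)) => // /set_mem[k _ [_ xm]].
    by rewrite mem_set.
  + move=> x; under eq_fun do under eq_bigr do rewrite mul1r.
    by rewrite setI_bigcupl; exact: cvg_sum_indic.
Qed.

(** The substitute for regularisation by convolution: a property with the two closure rules has to
    be checked on bumps only, first for boxes, then for measurable sets, then for bounded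
    functions. *)
Theorem bump_monotone_class (f : 'rV[R]_n -> R) (K : R) : measurable_fun setT f ->
  (forall x, `|f x| <= K * \1_(ocube m) x) -> H f.
Proof. by apply: indic_monotone_class => E mE; exact: H_indic. Qed.

End bumps.

End closed_class.

End monotone_class.

(** * Locally integrable functions *)

Lemma cvg_norm_le {R : realType} (u : nat -> R) (l c : R) :
  u k @[k --> \oo] --> l -> (forall k, `|u k| <= c) -> `|l| <= c.
Proof.
move=> ul uc; have cv : `|u k| @[k --> \oo] --> `|l| by exact: cvg_norm.
by rewrite -(cvg_lim _ cv)//; apply: limr_le; [exact: cvgP cv|apply: nearW].
Qed.

Section measurable_functions.
Context d (T : measurableType d) (R : realType).
Implicit Types f : T -> R.

Lemma measurable_sublevel f (c : R) : measurable_fun setT f -> measurable [set x | f x <= c].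
Proof.
move=> mf; rewrite (_ : [set _ | _] = f @^-1` `]-oo, c]); last first.
  by apply/seteqP; split => x /=; rewrite in_itv.
by rewrite -[X in measurable X]setTI; exact: mf.
Qed.

(** At the zeros of f the sign is -1 instead of 0, so that its modulus is 1 everywhere. *)
Lemma measurable_sign f : measurable_fun setT f -> exists sg : T -> R,
  [/\ measurable_fun setT sg, forall x, f x * sg x = `|f x| & forall x, `|sg x| = 1].
Proof.
move=> mf; exists (fun x => 1 - 2 * \1_[set x | f x <= 0] x); split.
- apply: measurable_funB => //; apply: measurable_funM => //.
  exact/measurable_indic/measurable_sublevel.
- move=> x; rewrite indicE; have [x0|x0] := leP (f x) 0.
    by rewrite ler0_norm// mem_set//=; ring.
  rewrite gtr0_norm// memNset/=; first by ring.
  by apply/negP; rewrite -ltNge.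
- move=> x; rewrite indicE; case: (_ \in _); last by rewrite mulr0 subr0 normr1.
  by rewrite -[RHS](@normrN1 R); congr `|_|; rewrite mulr1; ring.
Qed.

End measurable_functions.

Section real_integrals.
Context d (T : measurableType d) (R : realType) (mu : {measure set T -> \bar R}).
Implicit Types (f g h : T -> R).

Definition ri f := mu.-integrable setT (EFin \o f).

Lemma ri_meas f : ri f -> measurable_fun setT f.
Proof. by move=> /(measurable_int mu)/measurable_EFinP. Qed.

Lemma ri_le f g : measurable_fun setT f -> (forall x, `|f x| <= g x) -> ri g -> ri f.
Proof.
move=> mf fg; apply: le_integrable => //; first exact/measurable_EFinP.
by move=> x _ /=; rewrite lee_fin (le_trans (fg x))// ler_norm.
Qed.

Lemma ri_norm f : ri f -> ri (fun x => `|f x|).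
Proof. by move=> /integrable_abse; rewrite /ri; congr (mu.-integrable _ _). Qed.

Lemma ri_lin (c : R) f g : ri f -> ri g -> ri (fun x => c * f x + g x).
Proof. by move=> rf rg; exact: (integrableD measurableT (integrableZl measurableT c rf) rg). Qed.

Lemma ri_D f g : ri f -> ri g -> ri (fun x => f x + g x).
Proof. by move=> rf rg; exact: (integrableD measurableT rf rg). Qed.

Lemma ri_Z (c : R) f : ri f -> ri (fun x => c * f x).
Proof. by move=> rf; exact: (integrableZl measurableT c rf). Qed.

Lemma ri_B f g : ri f -> ri g -> ri (fun x => f x - g x).
Proof. by move=> rf rg; exact: (integrableB measurableT rf rg). Qed.

Lemma rint_lin (c : R) f g : ri f -> ri g ->
  \int[mu]_x (c * f x + g x) = c * \int[mu]_x f x + \int[mu]_x g x.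
Proof. by move=> rf rg; rewrite RintegralD ?RintegralZl//; exact: ri_Z. Qed.

Lemma rint_ae f g : measurable_fun setT f -> measurable_fun setT g ->
  {ae mu, forall x, f x = g x} -> \int[mu]_x f x = \int[mu]_x g x.
Proof.
move=> mf mg fg; rewrite /Rintegral; congr fine; apply: ae_eq_integral => //.
- exact/measurable_EFinP.
- exact/measurable_EFinP.
- by apply: filterS fg => x fgx _ /=; rewrite fgx.
Qed.

Lemma ri_ae f g : measurable_fun setT g -> {ae mu, forall x, f x = g x} -> ri f -> ri g.
Proof.
move=> mg fg rf; apply/integrableP; split; first exact/measurable_EFinP.
have /integrableP[_] := rf; apply: le_lt_trans.
rewrite le_eqVlt; apply/orP; left; apply/eqP; apply: ge0_ae_eq_integral => //.
- by apply/measurable_EFinP; apply: measurableT_comp.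
- by apply/measurable_EFinP; apply: measurableT_comp => //; exact: ri_meas.
- by apply: filterS fg => x fgx _ /=; rewrite fgx.
Qed.

Lemma rdct (f_ : nat -> T -> R) f g : (forall k, measurable_fun setT (f_ k)) ->
  (forall x, f_ k x @[k --> \oo] --> f x) -> (forall k x, `|f_ k x| <= g x) -> ri g ->
  ri f /\ \int[mu]_x f_ k x @[k --> \oo] --> \int[mu]_x f x.
Proof.
move=> mf_ ff fg rg.
have mf : measurable_fun setT f by apply: measurable_fun_cvg; [exact: mf_|move=> x _; exact: ff].
have [|||||rf _ cv] := @dominated_convergence _ _ _ mu setT measurableT
    (fun k => EFin \o f_ k) (EFin \o f) (EFin \o g).
- by move=> k; exact/measurable_EFinP.
- exact/measurable_EFinP.
- apply: aeW => x _; apply: cvg_EFin; last exact: ff.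
  by apply: nearW.
- exact: rg.
- by apply: aeW => x k _ /=; rewrite lee_fin.
split => //; apply: fine_cvg; rewrite fineK//.
exact: integrable_fin_num.
Qed.

Lemma ri_ge0 f : measurable_fun setT f -> (forall x, 0 <= f x) ->
  (\int[mu]_x (f x)%:E < +oo)%E -> ri f.
Proof.
move=> mf f0 fi; apply/integrableP; split; first exact/measurable_EFinP.
by under eq_integral do rewrite /= ger0_norm//.
Qed.

Lemma ri_EFin f : ri f -> (\int[mu]_x (f x)%:E)%E = (\int[mu]_x f x)%:E.
Proof. by move=> rf; rewrite /Rintegral fineK//; exact: integrable_fin_num. Qed.

Lemma rint_ge0_ae0 f : ri f -> (forall x, 0 <= f x) -> \int[mu]_x f x = 0 ->
  {ae mu, forall x, f x = 0}.
Proof.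
move=> rf f0 i0.
have : (\int[mu]_x `|(EFin \o f) x|)%E = 0%E.
  by under eq_integral do rewrite /= ger0_norm//; rewrite ri_EFin// i0.
move=> /(ae_eq_integral_abs mu measurableT (measurable_int _ rf)).
by apply: filterS => x /(_ Logic.I)[].
Qed.

Lemma rint_le f g : ri f -> ri g -> (forall x, f x <= g x) ->
  \int[mu]_x f x <= \int[mu]_x g x.
Proof. by move=> rf rg fg; apply: le_Rintegral => // x _; exact: fg. Qed.

End real_integrals.

Section powers.
Context {R : realType}.

(** From |x + y| <= 2 max(|x|, |y|). *)
Lemma powR_normD_le (q x y : R) : 0 <= q ->
  `|x + y| `^ q <= 2 `^ q * (`|x| `^ q + `|y| `^ q).
Proof.
move=> q0; wlog xy : x y / `|x| <= `|y|.
  move=> h; have [/h//|/ltW/h] := leP `|x| `|y|.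
  by rewrite addrC [X in _ <= _ * X]addrC.
apply: (@le_trans _ _ ((2 * `|y|) `^ q)).
  by apply: ge0_ler_powR; rewrite ?nnegrE// (le_trans (ler_normD _ _))//; lra.
by rewrite powRM// ler_wpM2l ?powR_ge0// lerDr powR_ge0.
Qed.

End powers.

(** * A locally integrable function is determined by its integrals against bumps *)

Section bump_density.
Context {R : realType} {n : nat}.
Local Notation mu := (@lebesgue_rV R n).
Implicit Types (f g : 'rV[R]_n -> R) (m : nat).

Lemma measurable_ocube m : measurable (@ocube R n m).
Proof. exact: measurable_box. Qed.

Lemma measurable_indic_ocube m : measurable_fun setT (\1_(ocube m) : 'rV[R]_n -> R).
Proof. by apply: measurable_indic; exact: measurable_ocube. Qed.

Lemma ocube_near (x : 'rV[R]_n) : \forall m \near \oo, ocube m x.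
Proof.
exists (Num.trunc (\sum_j `|x ord0 j|)).+1 => // m /= mN i.
rewrite -ltr_norml; apply: (@le_lt_trans _ _ (\sum_j `|x ord0 j|)).
  by rewrite (bigD1 i)//= lerDl sumr_ge0.
apply: (lt_le_trans (truncnS_gt _)); rewrite -natrX ler_nat.
by rewrite (leq_trans mN)// ltnW// ltn_expl.
Qed.

Lemma mem_ocube (x : 'rV[R]_n) : exists m, ocube m x.
Proof. by have [m _ h] := ocube_near x; exists m; apply: h => /=. Qed.

(** Local integrability through global integrals of truncated functions. For measurable f it agrees
    with [loc_integrable], by [loc_integrable_ri] and [ri_loc_integrable]. *)
Definition loc_ri f := forall m, ri mu (fun x => f x * \1_(ocube m) x).

Lemma loc_ri_bounded m f g (K : R) : loc_ri f -> measurable_fun setT f ->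
  measurable_fun setT g -> (forall x, `|g x| <= K * \1_(ocube m) x) -> ri mu (fun x => f x * g x).
Proof.
move=> lf mf mg gK.
apply: (@ri_le _ _ _ _ _ (fun x => K * `|f x * \1_(ocube m) x|)).
- exact: measurable_funM.
- move=> x; rewrite !normrM mulrCA ler_wpM2l//.
  by rewrite (ger0_norm (_ : 0 <= \1_(ocube m) x))// indicE.
- by apply: ri_Z; apply: ri_norm; exact: lf.
Qed.

Lemma loc_ri_dct m A (f_ : nat -> 'rV[R]_n -> R) f (K : R) : measurable_fun setT A -> loc_ri A ->
  (forall k, measurable_fun setT (f_ k)) -> (forall k x, `|f_ k x| <= K * \1_(ocube m) x) ->
  (forall x, f_ k x @[k --> \oo] --> f x) ->
  ri mu (fun x => A x * f x) /\
  \int[mu]_x (A x * f_ k x) @[k --> \oo] --> \int[mu]_x (A x * f x).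
Proof.
move=> mA lA mf_ fK ff; apply: (rdct (g := fun x => K * `|A x * \1_(ocube m) x|)).
- by move=> k; exact: measurable_funM.
- by move=> x; apply: cvgMr; exact: ff.
- move=> k x; rewrite !normrM mulrCA ler_wpM2l//.
  by rewrite (ger0_norm (_ : 0 <= \1_(ocube m) x))// indicE.
- by apply: ri_Z; apply: ri_norm; exact: lA.
Qed.

Lemma rint0_of_bump (A : 'rV[R]_n -> R) : measurable_fun setT A -> loc_ri A ->
  (forall a b k, \int[mu]_x (A x * bump a b k x) = 0) ->
  forall m f K, measurable_fun setT f -> (forall x, `|f x| <= K * \1_(ocube m) x) ->
  \int[mu]_x (A x * f x) = 0.
Proof.
move=> mA lA A0 m f K mf fK.
suff [] : [set f | ri mu (fun x => A x * f x) /\ \int[mu]_x (A x * f x) = 0] f by [].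
apply: (bump_monotone_class _ _ _ mf fK) => {f K mf fK}; last 1 first.
- move=> a b k abm; split => //=.
  apply: (loc_ri_bounded lA mA); first exact: measurable_bump.
  exact: bump_in_ocube.
- move=> c f g [rf f0] [rg g0]; split.
    rewrite (_ : (fun x => _) = (fun x => c * (A x * f x) + A x * g x)); first exact: ri_lin.
    by apply/funext => x; ring.
  under eq_Rintegral => x _ do rewrite mulrDr mulrCA.
  by rewrite rint_lin// f0 g0 mulr0 addr0.
- move=> f_ f K Hf mf_ fK ff.
  have [rf cv] := loc_ri_dct mA lA mf_ fK ff.
  split => //.
  rewrite -(cvg_lim _ cv)//; apply: cvg_lim => //.
  rewrite (_ : (fun k => _) = fun=> 0); first exact: cvg_cst.
  by apply/funext => k; have [] := Hf k.
Qed.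

(** The du Bois-Reymond lemma: by [rint0_of_bump] the integral of A against sgn(A) on each cube
    vanishes, that is, the integral of |A| there. *)
Theorem ae0_of_bump (A : 'rV[R]_n -> R) : measurable_fun setT A -> loc_ri A ->
  (forall a b k, \int[mu]_x (A x * bump a b k x) = 0) -> {ae mu, forall x, A x = 0}.
Proof.
move=> mA lA A0.
have h m : {ae mu, forall x, ocube m x -> A x = 0}.
  have [sgA [msgA sgAE sgA1]] := measurable_sign mA.
  pose f x := sgA x * \1_(ocube m) x.
  have fE x : A x * f x = `|A x| * \1_(ocube m) x by rewrite /f mulrA sgAE.
  have mf : measurable_fun setT f.
    by apply: measurable_funM => //; exact: measurable_indic_ocube.
  have fK x : `|f x| <= 1 * \1_(ocube m) x.
    by rewrite /f normrM sgA1 ger0_norm// indicE.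
  have := rint0_of_bump mA lA A0 mf fK.
  rewrite (_ : (fun x => A x * f x) = (fun x => `|A x| * \1_(ocube m) x)); last exact/funext.
  move=> /rint_ge0_ae0 h.
  have {h} : {ae mu, forall x, `|A x| * \1_(ocube m) x = 0}.
    apply: h; last by move=> x; rewrite mulr_ge0// indicE.
    apply: ri_le (ri_norm (lA m)).
      apply: measurable_funM; first exact: measurableT_comp.
      exact: measurable_indic_ocube.
    by move=> x; rewrite !normrM normr_id.
  apply: filterS => x + xm; rewrite indicE mem_set// mulr1.
  by move/eqP; rewrite normr_eq0 => /eqP.
apply: filterS (ae_foralln h) => x hx; have [m xm] := mem_ocube x; exact: hx.
Qed.

End bump_density.

(** * Density of smooth functions in weighted L_q *)

Lemma lte_mulZD {R : realType} (C c e e' : R) (A B : \bar R) : 0 < C -> 0 <= c ->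
  (0 <= A)%E -> (A < e%:E)%E -> (B < e'%:E)%E ->
  (C%:E * (c%:E * A + B) < (C * (c * e + e'))%:E)%E.
Proof.
move=> C0 c0; case: A => [A| |]//; rewrite lee_fin lte_fin => A0 Ae.
case: B => [B| |]//; first rewrite lte_fin => Be.
  by rewrite -[ltLHS]/((C * (c * A + B))%:E) lte_fin ltr_pM2l// ler_ltD// ler_wpM2l// ltW.
by move=> _; rewrite -EFinM addeNy mulr_infty gtr0_sg// mul1e ltNyr.
Qed.

Lemma lte_mulD {R : realType} (C e e' : R) (A B : \bar R) : 0 < C ->
  (0 <= A)%E -> (A < e%:E)%E -> (B < e'%:E)%E -> (C%:E * (A + B) < (C * (e + e'))%:E)%E.
Proof.
move=> C0 A0 Ae Be; rewrite -[A]mul1e -[e]mul1r; exact: lte_mulZD.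
Qed.

Section Lq_density.
Context {R : realType} {n : nat}.
Local Notation mu := (@lebesgue_rV R n).
Implicit Types (f g : 'rV[R]_n -> R) (m : nat).
Variables (q : R) (v : 'rV[R]_n -> R).
Hypothesis q_gt0 : 0 < q.
Hypothesis mv : measurable_fun setT v.
Hypothesis v_ge0 : forall x, 0 <= v x.
Hypothesis lv : loc_ri v.

(** The q-th power of the norm of L_q(v). Approximation only asks for smallness, so the root is left
    out and [qintD] replaces the triangle inequality. *)
Definition qint f : \bar R := (\int[mu]_x (`|f x| `^ q * v x)%:E)%E.

Lemma measurable_qint_fun f : measurable_fun setT f ->
  measurable_fun setT (fun x => `|f x| `^ q * v x).
Proof.
move=> mf; apply: measurable_funM => //.
apply: (@measurableT_comp _ _ _ _ _ _ (fun y : R => y `^ q)); first exact: measurable_powR.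
exact: measurableT_comp.
Qed.

Lemma qint_fun_ge0 f x : 0 <= `|f x| `^ q * v x.
Proof. by rewrite mulr_ge0// powR_ge0. Qed.

Lemma qint_ge0 f : (0 <= qint f)%E.
Proof. by apply: integral_ge0 => x _; rewrite lee_fin qint_fun_ge0. Qed.

Lemma qint_le f g : measurable_fun setT f -> measurable_fun setT g ->
  (forall x, `|f x| <= `|g x|) -> (qint f <= qint g)%E.
Proof.
move=> mf mg fg; apply: ge0_le_integral => //.
- by move=> x _; rewrite lee_fin qint_fun_ge0.
- by apply/measurable_EFinP; exact: measurable_qint_fun.
- by apply/measurable_EFinP; exact: measurable_qint_fun.
- by move=> x _; rewrite lee_fin ler_wpM2r// ge0_ler_powR ?nnegrE ?(ltW q_gt0).
Qed.

Lemma qintD f g : measurable_fun setT f -> measurable_fun setT g ->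
  (qint (fun x => f x + g x)%R <= (2 `^ q)%:E * (qint f + qint g))%E.
Proof.
move=> mf mg; rewrite -ge0_integralD//; last first.
- by apply/measurable_EFinP; exact: measurable_qint_fun.
- by move=> x _; rewrite lee_fin qint_fun_ge0.
- by apply/measurable_EFinP; exact: measurable_qint_fun.
- by move=> x _; rewrite lee_fin qint_fun_ge0.
rewrite -ge0_integralZl_EFin ?powR_ge0//; last first.
- apply/measurable_EFinP; apply: measurable_funD; exact: measurable_qint_fun.
- by move=> x _; rewrite lee_fin addr_ge0// qint_fun_ge0.
apply: ge0_le_integral => //.
- by move=> x _; rewrite lee_fin; apply: (qint_fun_ge0 (fun x => f x + g x)).
- by apply/measurable_EFinP; apply: (@measurable_qint_fun (fun x => f x + g x)); exact: measurable_funD.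
- apply/measurable_EFinP; apply: measurable_funM => //.
  by apply: measurable_funD; exact: measurable_qint_fun.
- move=> x _; rewrite -EFinD -EFinM lee_fin -mulrDl mulrA ler_wpM2r//.
  exact/powR_normD_le/ltW.
Qed.

Lemma qintZ (c : R) f : measurable_fun setT f ->
  qint (fun x => c * f x) = ((`|c| `^ q)%:E * qint f)%E.
Proof.
move=> mf; rewrite /qint -ge0_integralZl_EFin ?powR_ge0//.
- by apply: eq_integral => x _; rewrite -EFinM normrM powRM// mulrA.
- by move=> x _; rewrite lee_fin qint_fun_ge0.
- by apply/measurable_EFinP; exact: measurable_qint_fun.
Qed.

Lemma powR_cvg0_seq (u : nat -> R) : u k @[k --> \oo] --> (0 : R) ->
  `|u k| `^ q @[k --> \oo] --> (0 : R).
Proof.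
move=> u0; apply/cvgr0Pnorm_lt => e e0.
have e1 : 0 < e `^ q^-1 by exact: powR_gt0.
move/cvgr0Pnorm_lt : u0 => /(_ _ e1); apply: filterS => k uk.
rewrite ger0_norm ?powR_ge0//.
have : `|u k| `^ q < (e `^ q^-1) `^ q by apply: gt0_ltr_powR => //; rewrite nnegrE ?powR_ge0.
by rewrite -powRrM mulVf ?gt_eqF// powRr1 ?ltW.
Qed.

Lemma qint_cvg0 (e : R) (f_ : nat -> 'rV[R]_n -> R) (h : 'rV[R]_n -> R) :
  (forall k, measurable_fun setT (f_ k)) -> (forall x, f_ k x @[k --> \oo] --> (0 : R)) ->
  (forall k x, `|f_ k x| `^ q * v x <= h x) -> ri mu h ->
  0 < e -> exists k, (qint (f_ k) < e%:E)%E.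
Proof.
move=> mf_ f0 fh rh e0.
have [||||_ cv] := @rdct _ _ _ mu (fun k x => `|f_ k x| `^ q * v x) (fun=> 0) h.
- by move=> k; exact: measurable_qint_fun.
- by move=> x; rewrite -(mul0r (v x)); apply: cvgMl; exact: powR_cvg0_seq.
- by move=> k x; rewrite ger0_norm// qint_fun_ge0.
- exact: rh.
rewrite Rintegral_cst// mul0r in cv.
move/cvgr0Pnorm_lt : cv => /(_ _ e0)[k _ /(_ k (leqnn k)) /= ke].
have rk : ri mu (fun x => `|f_ k x| `^ q * v x).
  apply: ri_le rh; first exact: measurable_qint_fun.
  by move=> x; rewrite ger0_norm// qint_fun_ge0.
by exists k; rewrite /qint (ri_EFin rk) lte_fin; exact: le_lt_trans (ler_norm _) ke.
Qed.

Lemma qint_fun_dist_le m (K a b : R) x : `|a| <= K * \1_(ocube m) x -> `|b| <= K * \1_(ocube m) x ->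
  `|a - b| `^ q * v x <= (2 * `|K|) `^ q * (v x * \1_(ocube m) x).
Proof.
rewrite indicE; case: (x \in _); rewrite ?mulr1 ?mulr0 => a1 b1.
  apply: ler_wpM2r => //; apply: ge0_ler_powR; rewrite ?nnegrE ?(ltW q_gt0) ?mulr_ge0//.
  by rewrite (le_trans (ler_normB _ _))//; have := ler_norm K; lra.
move: a1 b1; rewrite !normr_le0 => /eqP -> /eqP ->.
by rewrite subrr normr0 powR0 ?gt_eqF// mul0r.
Qed.

Lemma ri_qint_bounded m (K : R) f : measurable_fun setT f ->
  (forall x, `|f x| <= K * \1_(ocube m) x) -> ri mu (fun x => `|f x| `^ q * v x).
Proof.
move=> mf fK.
apply: (@ri_le _ _ _ _ _ (fun x => (2 * `|K|) `^ q * (v x * \1_(ocube m) x))).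
- exact: measurable_qint_fun.
- move=> x; rewrite (ger0_norm (qint_fun_ge0 _ _)) -[f x]subr0.
  apply: qint_fun_dist_le; [exact: fK|rewrite normr0; exact: le_trans (fK x)].
- by apply: ri_Z; exact: lv.
Qed.

(** The approximants vanish outside the same cube as f, so that the error can later serve as one
    atom on a fixed cube. Measurability is included because [qintD] asks for it. *)
Definition smooth_approx m f := measurable_fun setT f /\
  forall e : R, 0 < e -> exists g, [/\ smooth g, forall x, ~ ocube m x -> g x = 0 &
    (qint (fun x => f x - g x)%R < e%:E)%E].

Lemma smooth_measurable f : smooth f -> measurable_fun setT f.
Proof. by move=> /(_ [::])[cf _]; exact: continuous_measurable_rV. Qed.

Lemma smooth_approx_lim m f : measurable_fun setT f ->
  (forall e : R, 0 < e -> exists2 g, smooth_approx m g & (qint (fun x => f x - g x)%R < e%:E)%E) ->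
  smooth_approx m f.
Proof.
move=> mf fg; split => // e e0.
pose e' := e / (2 `^ q * 2).
have q2 : 0 < 2 `^ q :> R by exact: powR_gt0.
have e'0 : 0 < e' by rewrite divr_gt0// mulr_gt0.
have [g [mg gb] fge] := fg _ e'0; have [b [sb b0 be]] := gb _ e'0.
exists b; split => //.
have mb := smooth_measurable sb.
rewrite (_ : (fun x => _) = (fun x => (f x - g x) + (g x - b x))); last first.
  by apply/funext => x; rewrite addrA subrK.
apply: (le_lt_trans (qintD _ _)); [exact: measurable_funB|exact: measurable_funB|].
rewrite (_ : e = 2 `^ q * (e' + e')); last by rewrite /e'; field; rewrite gt_eqF.
by apply: lte_mulD => //; exact: qint_ge0.
Qed.

Lemma smooth_approx_bounded m f (K : R) : measurable_fun setT f ->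
  (forall x, `|f x| <= K * \1_(ocube m) x) -> smooth_approx m f.
Proof.
move=> mf fK; apply: (bump_monotone_class _ _ _ mf fK) => {f K mf fK}; last 1 first.
- move=> a b k abm; split; first exact: measurable_bump.
  move=> e e0; exists (bump a b k); split.
  + by apply: smooth_bump_rV; rewrite invr_gt0.
  + move=> x xm; have := bump_in_ocube k abm x.
    by rewrite indicE memNset// mulr0 normr_le0 => /eqP.
  + rewrite /qint integral0_eq// => x _.
    by rewrite subrr normr0 powR0 ?gt_eqF// mul0r.
- move=> c f g [mf af] [mg ag]; split.
    by apply: measurable_funD => //; exact: measurable_funM.
  move=> e e0; pose C := 2 `^ q * (`|c| `^ q + 1).
  have C0 : 0 < C by rewrite mulr_gt0 ?powR_gt0// ltr_wpDl// powR_ge0.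
  have eC : 0 < e / C by rewrite divr_gt0.
  have [b [sb b0 be]] := af _ eC; have [b' [sb' b'0 b'e]] := ag _ eC.
  have mb := smooth_measurable sb; have mb' := smooth_measurable sb'.
  exists (fun x => c * b x + 1 * b' x); split.
  + exact: smooth_lin.
  + by move=> x xm; rewrite b0// b'0// !mulr0 addr0.
  + rewrite (_ : (fun x => _) = (fun x => c * (f x - b x) + (g x - b' x))); last first.
      by apply/funext => x; ring.
    have mfb : measurable_fun setT (fun x => f x - b x) by exact: measurable_funB.
    apply: (le_lt_trans (qintD _ _)); [exact: measurable_funM|exact: measurable_funB|].
    rewrite qintZ//.
    rewrite (_ : e = 2 `^ q * (`|c| `^ q * (e / C) + e / C)); last first.
      rewrite /C; field; rewrite ?gt_eqF// ?powR_gt0// ltr_wpDl// powR_ge0.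
    apply: lte_mulZD; [|exact: powR_ge0|exact: qint_ge0|exact: be|exact: b'e].
    exact: powR_gt0.
- move=> f_ f K Hf mf_ fK ff.
  have mf : measurable_fun setT f by apply: measurable_fun_cvg; [exact: mf_|move=> x _; exact: ff].
  apply: smooth_approx_lim => // e e0.
  have fK' x : `|f x| <= K * \1_(ocube m) x.
    by apply: cvg_norm_le (ff x) _ => k; exact: fK.
  have [|||||k ke] := @qint_cvg0 e (fun k x => f x - f_ k x)
      (fun x => (2 * `|K|) `^ q * (v x * \1_(ocube m) x)).
  + by move=> k; exact: measurable_funB.
  + by move=> x; rewrite -(subrr (f x)); apply: cvgB; [exact: cvg_cst|exact: ff].
  + by move=> k x; exact: qint_fun_dist_le.
  + by apply: ri_Z; exact: lv.
  + exact: e0.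
  by exists (f_ k).
Qed.

(** Truncation at height k reduces to bounded functions; the errors are dominated by |f|^q v, which
    is integrable by assumption. *)
Theorem smooth_approx_Lq m f : measurable_fun setT f ->
  (forall x, ~ ocube m x -> f x = 0) -> (qint f < +oo)%E -> smooth_approx m f.
Proof.
move=> mf f0 qf; apply: smooth_approx_lim => // e e0.
pose f_ (k : nat) x := f x * \1_[set x | `|f x| <= k%:R] x.
have mf_ k : measurable_fun setT (f_ k).
  apply: measurable_funM => //; apply: measurable_indic.
  by apply: measurable_sublevel; exact: measurableT_comp.
have [|||||k ke] := @qint_cvg0 e (fun k x => f x - f_ k x) (fun x => `|f x| `^ q * v x).
- by move=> k; exact: measurable_funB.
- move=> x; apply: cvg_near_cst; exists (Num.trunc `|f x|).+1 => // k /= kf.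
  rewrite /f_ indicE mem_set ?mulr1 ?subrr//=.
  by apply/ltW/(lt_le_trans (truncnS_gt _)); rewrite ler_nat.
- move=> k x; apply: ler_wpM2r => //; apply: ge0_ler_powR; rewrite ?nnegrE ?(ltW q_gt0)//.
  by rewrite /f_ indicE; case: (_ \in _); rewrite ?mulr1 ?mulr0 ?subrr ?subr0 ?normr0.
- by apply: ri_ge0 => //; [exact: measurable_qint_fun|move=> x; exact: qint_fun_ge0].
- exact: e0.
exists (f_ k) => //; apply: (@smooth_approx_bounded _ _ k%:R) => // x.
rewrite /f_ normrM [leRHS]mulrC; have [xm|xm] := pselect (ocube m x); last by rewrite f0// normr0 mul0r mulr_ge0// indicE.
rewrite [in leRHS]indicE mem_set// mul1r indicE.
have [/set_mem/= fk|_] := boolP (x \in _); last by rewrite normr0 mulr0.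
by rewrite normr1 mulr1.
Qed.

End Lq_density.

(** * Dyadic cubes and weights *)

Section cabs_theory.
Context {R : realType}.
Implicit Types z : R[i].

Lemma cabsE z : cabs z = Num.sqrt (complex.Re z ^+ 2 + complex.Im z ^+ 2).
Proof. by case: z. Qed.

Lemma cabs0 : cabs (0 : R[i]) = 0.
Proof. exact: Normc.normc0. Qed.

Lemma cabsM z1 z2 : cabs (z1 * z2) = cabs z1 * cabs z2.
Proof. exact: Normc.normcM. Qed.

Lemma cabsD z1 z2 : cabs (z1 + z2) <= cabs z1 + cabs z2.
Proof. exact: le_normcD. Qed.

Lemma cabs_eq0 z : cabs z = 0 -> z = 0.
Proof. exact: Normc.eq0_normc. Qed.

Lemma Re_le_cabs z : `|complex.Re z| <= cabs z.
Proof. by rewrite cabsE -sqrtr_sqr ler_sqrt ?addr_ge0 ?sqr_ge0// lerDl sqr_ge0. Qed.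

Lemma Im_le_cabs z : `|complex.Im z| <= cabs z.
Proof. by rewrite cabsE -sqrtr_sqr ler_sqrt ?addr_ge0 ?sqr_ge0// lerDr sqr_ge0. Qed.

Lemma cabs_le_ReIm z : cabs z <= `|complex.Re z| + `|complex.Im z|.
Proof.
rewrite cabsE -[leRHS]ger0_norm ?addr_ge0// -sqrtr_sqr ler_sqrt ?sqr_ge0//.
rewrite sqrrD !real_normK ?num_real// -addrA [_ *+ 2 + _]addrC addrA lerDl.
by rewrite mulrn_wge0// mulr_ge0.
Qed.

Lemma measurable_cabs d (T : measurableType d) (f : T -> R[i]) :
  measurable_fun setT (fun x => complex.Re (f x)) ->
  measurable_fun setT (fun x => complex.Im (f x)) ->
  measurable_fun setT (fun x => cabs (f x)).
Proof.
move=> mr mi; rewrite (_ : (fun x => _) = (fun y => Num.sqrt y) \o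
    (fun x => complex.Re (f x) ^+ 2 + complex.Im (f x) ^+ 2)); last first.
  by apply/funext => x /=; rewrite cabsE.
apply: measurableT_comp; first by apply: continuous_measurable_fun; exact: sqrt_continuous.
by apply: measurable_funD; exact: measurable_funX.
Qed.

End cabs_theory.

Section dcube.
Context {R : realType} {n : nat}.
Local Notation mu := (@lebesgue_rV R n).
Implicit Types (k : int * 'rV[int]_n) (x : 'rV[R]_n) (m : nat).

Definition side k : R := 2 ^ (- k.1).

Lemma side_gt0 k : 0 < side k.
Proof. by rewrite exprz_gt0. Qed.

Definition dlo k (i : 'I_n) : R := side k * ((k.2 ord0 i)%:~R - 1).
Definition dhi k (i : 'I_n) : R := side k * ((k.2 ord0 i)%:~R + 1).

Lemma dcubeE k : dcube k = [set x : 'rV[R]_n | forall i, dlo k i <= x ord0 i <= dhi k i].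
Proof.
have sk := side_gt0 k.
apply/seteqP; split => [_ [y y1 <-] i|x xk].
  rewrite !mxE /dlo /dhi -/(side k) !ler_pM2l//.
  by have /andP[y1l y1r] := y1 i; apply/andP; split; lra.
exists ((side k)^-1 *: x - map_mx intr k.2); last first.
  by rewrite addrC subrK scalerA divff ?gt_eqF// scale1r.
move=> i; rewrite !mxE; have /andP[] := xk i.
rewrite -[x ord0 i](mulVKf (lt0r_neq0 sk)) /dlo /dhi !ler_pM2l// mulKf ?gt_eqF//.
by move=> x1 x2; apply/andP; split; lra.
Qed.

Lemma dcube_cube k : dcube k = cube (\row_i dlo k i) (2 * side k) :> set 'rV[R]_n.
Proof.
rewrite dcubeE; apply/seteqP; split => x h i; have := h i; rewrite mxE (_ : _ + 2 * _ = dhi k i)//.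
- by rewrite /dlo /dhi; ring.
- by rewrite /dlo /dhi; ring.
Qed.

Lemma closed_dcube k : closed (dcube k : set 'rV[R]_n).
Proof. by rewrite dcubeE; exact: closed_box. Qed.

Lemma measurable_dcube k : measurable (dcube k : set 'rV[R]_n).
Proof. by apply: closed_measurable_rV; exact: closed_dcube. Qed.

Lemma bounded_ocube (a b : 'I_n -> R) :
  exists m, [set x : 'rV[R]_n | forall i, a i <= x ord0 i <= b i] `<=` ocube m.
Proof.
have [m mab] : exists m : nat, \sum_i (`|a i| + `|b i|) < 2 ^+ m :> R.
  exists (Num.trunc (\sum_i (`|a i| + `|b i|))).+1.
  apply: (lt_le_trans (truncnS_gt _)); rewrite -natrX ler_nat.
  by rewrite ltnW// ltn_expl.
exists m => x xab i; have /andP[ax xb] := xab i.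
have : `|a i| + `|b i| < 2 ^+ m.
  by apply: le_lt_trans mab; rewrite [leRHS](bigD1 i)//= lerDl sumr_ge0// => j _; rewrite addr_ge0.
have := ler_norm (b i); have := ler_norm (- a i); rewrite normrN.
have := normr_ge0 (b i); have := normr_ge0 (a i).
by move=> *; apply/andP; split; lra.
Qed.

Lemma dcube_ocube k : exists m, dcube k `<=` @ocube R n m.
Proof. by rewrite dcubeE; exact: bounded_ocube. Qed.

Lemma compact_ocube (A : set 'rV[R]_n) : compact A -> exists m, A `<=` ocube m.
Proof.
move=> /compact_bounded[M [_ /(_ (M + 1)%R)]]; rewrite ltrDl ltr01 => /(_ isT) AM.
have [m h] := bounded_ocube (fun=> - (M + 1)) (fun=> M + 1).
exists m => x Ax; apply: h => i; rewrite -ler_norml.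
apply: le_trans (AM _ Ax).
rewrite [leRHS]mx_normrE; exact: (le_bigmax _ (fun ij => `|x ij.1 ij.2|) (ord0, i)).
Qed.

(** The choice J = -m, M = 0 gives the closed cube with the same faces as [ocube m]. *)
Definition bigcube m : int * 'rV[int]_n := (- m%:Z, 0).

Lemma ocube_bigcube m : @ocube R n m `<=` dcube (bigcube m).
Proof.
rewrite dcubeE => x xm i; have /andP[x1 x2] := xm i.
by rewrite /dlo /dhi /side /= opprK !mxE sub0r add0r mulr1 mulrN1 !ltW.
Qed.

Lemma ocubeS m m' : (m <= m')%N -> @ocube R n m `<=` ocube m'.
Proof.
move=> mm' x xm i; have /andP[x1 x2] := xm i.
have h : 2 ^+ m <= 2 ^+ m' :> R by rewrite ler_weXn2l// ler1n.
by apply/andP; split; [apply: le_lt_trans x1; rewrite lerN2|exact: lt_le_trans h].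
Qed.

Lemma mu_cube (a : 'rV[R]_n) (l : R) : 0 < l -> mu (cube a l) = (l ^+ n)%:E.
Proof.
have prodE N : (\prod_(i < N) l%:E = (l ^+ N)%:E)%E.
  by elim: N => [|N IH]; rewrite ?big_ord0 ?expr0// big_ord_recr/= IH -EFinM exprSr.
move=> l0; rewrite (_ : cube a l = [set x | forall i, `[a ord0 i, a ord0 i + l]%classic (coord_rV i x)]).
  rewrite (@lebesgue_rV_prod R n (fun i => `[a ord0 i, a ord0 i + l]%classic))//.
  rewrite (eq_bigr (fun=> l%:E)) ?prodE//.
  move=> i _; rewrite lebesgue_measure_itv/= lte_fin ltrDl l0 -EFinB.
  by congr EFin; ring.
by apply/seteqP; split => x h i; have := h i; rewrite /= in_itv.
Qed.

Lemma bump_bounded (a b : 'I_n -> R) j :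
  exists m, forall x, `|bump a b j x| <= 1 * (\1_(ocube m) x : R).
Proof.
have [m h] := bounded_ocube a b; exists m; apply: bump_le_indic => x xab.
by apply: h => i; have /andP[? ?] := xab i; rewrite !ltW.
Qed.

Lemma common_ocube (X : seq (int * 'rV[int]_n)) :
  exists m, forall k, k \in X -> dcube k `<=` @ocube R n m.
Proof.
elim: X => [|k X [m mX]]; first by exists 0%N.
have [m' km'] := dcube_ocube k.
exists (maxn m m') => j; rewrite inE => /orP[/eqP ->|/mX jm].
  by apply: subset_trans km' _; apply: ocubeS; exact: leq_maxr.
by apply: subset_trans jm _; apply: ocubeS; exact: leq_maxl.
Qed.

End dcube.

(** If a <= b, use t^e <= a^e and then a^(e - s) <= b^(e - s). If b < a, use a^(-s) <= b^(-s) and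
    t^e <= b^e. The bound is free of a, hence uniform over the cubes when a = w(Q). *)
Lemma powR_min_le {R : realType} (s e t a b : R) : 0 < a -> 0 <= t -> t <= a -> t <= b ->
  0 < s -> s <= e -> a `^ (- s) * t `^ e <= b `^ (e - s).
Proof.
move=> a0 t0 ta tb s0 se.
have e0 : 0 < e by rewrite (lt_le_trans s0).
have es : 0 <= e - s by rewrite subr_ge0.
have eE c : 0 < c -> c `^ (- s) * c `^ e = c `^ (e - s).
  by move=> c0; rewrite -powRD 1?addrC//; apply/implyP => _; rewrite gt_eqF.
have [ab|ba] := leP a b.
  apply: (@le_trans _ _ (a `^ (- s) * a `^ e)).
    by apply: ler_wpM2l; [exact: powR_ge0|apply: ge0_ler_powR; rewrite ?nnegrE// ltW].
  by rewrite eE//; apply: ge0_ler_powR; rewrite ?nnegrE// ?ltW// (lt_le_trans a0).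
have [b0|b0] := ltP 0 b; last first.
  have -> : t = 0 by apply/eqP; rewrite eq_le t0 (le_trans tb).
  by rewrite powR0 ?mulr0 ?powR_ge0// gt_eqF.
rewrite -(eE b)//; apply: ler_pM; [exact: powR_ge0|exact: powR_ge0| |].
  rewrite !powRN lef_pV2 ?posrE ?powR_gt0//.
  by apply: ge0_ler_powR; rewrite ?nnegrE ltW.
by apply: ge0_ler_powR; rewrite ?nnegrE// ltW.
Qed.

Section positive_on_dcube.
Context {R : realType} {n : nat}.
Local Notation mu := (@lebesgue_rV R n).
Implicit Types (k : int * 'rV[int]_n) (u : 'rV[R]_n -> R).

Lemma indic_ge0 (A : set 'rV[R]_n) x : 0 <= \1_A x :> R.
Proof. by rewrite indicE. Qed.

Lemma indic_le1 (A : set 'rV[R]_n) x : \1_A x <= 1 :> R.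
Proof. by rewrite indicE; case: (_ \in _). Qed.

Lemma indic_sub (A B : set 'rV[R]_n) x : A `<=` B -> \1_A x <= \1_B x :> R.
Proof.
move=> AB; rewrite !indicE; case: (boolP (x \in A)) => [/set_mem/AB Bx|_]; last by case: (_ \in _).
by rewrite mem_set.
Qed.

Lemma ri_dcube k u : measurable_fun setT u -> loc_ri u -> ri mu (fun x => u x * \1_(dcube k) x).
Proof.
move=> mu_ lu; have [m km] := dcube_ocube (R := R) k.
apply: (@ri_le _ _ _ _ _ (fun x => `|u x * \1_(ocube m) x|)); last exact: ri_norm (lu m).
  by apply: measurable_funM => //; apply: measurable_indic; exact: measurable_dcube.
move=> x; rewrite !normrM ler_wpM2l// !ger0_norm ?indic_ge0//; exact: indic_sub.
Qed.

(** A zero integral would make u vanish almost everywhere on a cube of positive measure. Positivity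
    of w(Q) is what lets the powers w(Q)^s and w(Q)^(-s) cancel. *)
Lemma Rintegral_dcube_gt0 k u : (forall x, 0 < u x) -> ri mu (fun x => u x * \1_(dcube k) x) ->
  0 < \int[mu]_x (u x * \1_(dcube k) x).
Proof.
move=> u0 ru.
have h x : 0 <= u x * \1_(dcube k) x by rewrite mulr_ge0 ?indic_ge0// ltW.
rewrite lt_neqAle Rintegral_ge0 ?andbT; last by move=> x _; exact: h.
apply/eqP => /esym /(rint_ge0_ae0 ru h) [N [mN N0 hN]].
have : (mu (dcube k) <= mu N)%E.
  apply: le_measure; rewrite ?inE//; first exact: measurable_dcube.
  move=> x kx; apply: hN => /=; rewrite indicE mem_set// mulr1.
  by apply/eqP; rewrite gt_eqF.
by rewrite N0 dcube_cube mu_cube ?mulr_gt0 ?side_gt0// lee_fin leNgt exprn_gt0// mulr_gt0// side_gt0.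
Qed.

End positive_on_dcube.

(** * Weights, and the pairing of atoms with Morrey functions *)

Section weights.
Context {R : realType} {n : nat}.
Local Notation mu := (@lebesgue_rV R n).
Implicit Types (k : int * 'rV[int]_n) (x : 'rV[R]_n) (m : nat) (f g : 'rV[R]_n -> R).
Variables (p s : R) (w : 'rV[R]_n -> R).
Local Notation q := (conjugate p).

(* Equal to [w ^ (1 - q)]; written as it arises from the factor [w ^ (- 1 / p)]
   of the atoms in [HL_cost]. *)
Definition dual_weight x : R := (w x `^ (- p^-1)) `^ q.

(** The form in which the A_p condition enters the duality argument; [is_weight_Ap] provides it. *)
Record is_weight : Prop := IsWeight {
  weight_measurable : measurable_fun setT w ;
  weight_gt0 : forall x, 0 < w x ;
  weight_loc : loc_ri w ;
  dual_weight_loc : loc_ri dual_weight }.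

Hypothesis p_gt1 : 1 < p.
Hypothesis ww : is_weight.
Hypothesis s_gt0 : 0 < s.
Hypothesis s_lt : s < p^-1.

Let mw := weight_measurable ww.
Let w0 := weight_gt0 ww.
Let lw := weight_loc ww.

Lemma p_gt0 : 0 < p. Proof. by rewrite (lt_trans ltr01). Qed.

Lemma q_gt0 : 0 < q. Proof. by rewrite divr_gt0 ?subr_gt0// p_gt0. Qed.

Lemma conjugateK : conjugate q = p.
Proof. by rewrite /conjugate; field; apply/andP; split; rewrite ?gt_eqF// ?subr_gt0//; lra. Qed.

Lemma conjugate_sum : q^-1 + p^-1 = 1.
Proof. by rewrite /conjugate; field; rewrite ?gt_eqF ?subr_gt0 ?p_gt0. Qed.

Lemma dual_weight_gt0 x : 0 < dual_weight x.
Proof. by rewrite !powR_gt0. Qed.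

Lemma measurable_powR_fun (f : 'rV[R]_n -> R) (e : R) : measurable_fun setT f ->
  measurable_fun setT (fun x => f x `^ e).
Proof.
by move=> mf; apply: (@measurableT_comp _ _ _ _ _ _ (fun y : R => y `^ e)); first exact: measurable_powR.
Qed.

Lemma measurable_dual_weight : measurable_fun setT dual_weight.
Proof. by do 2!apply: measurable_powR_fun. Qed.

Definition wcube k : R := \int[mu]_x (w x * \1_(dcube k) x).

Lemma ri_weight_dcube k : ri mu (fun x => w x * \1_(dcube k) x).
Proof. exact: ri_dcube. Qed.

Lemma integral_indic_dcube k (f : 'rV[R]_n -> R) :
  (\int[mu]_(x in dcube k) (f x)%:E = \int[mu]_x (f x * \1_(dcube k) x)%:E)%E.
Proof.
rewrite integral_mkcond; apply: eq_integral => x _.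
by rewrite (epatch_indic (fun x => (f x)%:E)).
Qed.

Lemma wmeas_dcube k : wmeas w (dcube k) = (wcube k)%:E.
Proof. by rewrite /wmeas integral_indic_dcube (ri_EFin (ri_weight_dcube k)). Qed.

Lemma wcube_gt0 k : 0 < wcube k.
Proof. exact: Rintegral_dcube_gt0 w0 (ri_weight_dcube k). Qed.

(** One term of [HL_cost], with the factor w^(-1/p) moved into the weight of the integral and the
    exponent of w(Q) written as s. [HL_costE] makes the connection. *)
Definition atom_cost k (f : 'rV[R]_n -> R) : \bar R :=
  ((wcube k `^ s)%:E * (qint q dual_weight f) `^ q^-1)%E.

Definition morrey_term k (f : 'rV[R]_n -> R) : \bar R :=
  ((wcube k `^ (- s))%:E * (\int[mu]_x (`|f x| `^ p * w x * \1_(dcube k) x)%:E) `^ p^-1)%E.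

(** Hoelder's inequality for the factors f w^(-1/p) and g w^(1/p) 1_Q; the indicator may be inserted
    because f vanishes almost everywhere off the cube. *)
Lemma weighted_hoelder k f g : measurable_fun setT f -> measurable_fun setT g ->
  {ae mu, forall x, ~ dcube k x -> f x = 0} ->
  (\int[mu]_x (`|f x| * `|g x|)%:E <= (qint q dual_weight f) `^ q^-1 *
    (\int[mu]_x (`|g x| `^ p * w x * \1_(dcube k) x)%:E) `^ p^-1)%E.
Proof.
move=> mf mg f0.
pose F x := `|f x| * w x `^ (- p^-1).
pose G x := `|g x| * w x `^ p^-1 * \1_(dcube k) x.
have mk : measurable_fun setT (\1_(dcube k) : 'rV[R]_n -> R).
  by apply: measurable_indic; exact: measurable_dcube.
have mnf : measurable_fun setT (fun x => `|f x|) by exact: measurableT_comp.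
have mng : measurable_fun setT (fun x => `|g x|) by exact: measurableT_comp.
have mF : measurable_fun setT F by apply: measurable_funM => //; exact: measurable_powR_fun.
have mG : measurable_fun setT G.
  by apply: measurable_funM => //; apply: measurable_funM => //; exact: measurable_powR_fun.
have := hoelder mu mF mG q_gt0 p_gt0 conjugate_sum.
rewrite Lnorm1 !Lnorm.unlock /=.
have FG x : F x * G x = `|f x| * `|g x| * \1_(dcube k) x.
  rewrite /F /G powRN; field; by rewrite gt_eqF// powR_gt0.
have -> : (\int[mu]_x `|(F x * G x)%:E| = \int[mu]_x (`|f x| * `|g x|)%:E)%E.
  apply: ge0_ae_eq_integral => //.
  - by apply/measurable_EFinP; apply: measurableT_comp => //; exact: measurable_funM.
  - by apply/measurable_EFinP; exact: measurable_funM.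
  - apply: filterS f0 => x h _; rewrite FG /= ger0_norm ?mulr_ge0 ?indic_ge0//.
    rewrite indicE; have [xk|xk] := pselect (dcube k x); first by rewrite mem_set// mulr1.
    by rewrite h// normr0 !mul0r.
move=> /le_trans; apply; rewrite le_eqVlt; apply/orP; left; apply/eqP.
congr (_ `^ _ * _ `^ _)%E; apply: eq_integral => x _.
  rewrite /= /F ger0_norm ?mulr_ge0 ?powR_ge0//.
  by rewrite powRM ?powR_ge0.
rewrite /= /G ger0_norm ?mulr_ge0 ?powR_ge0 ?indic_ge0//.
rewrite !powRM ?mulr_ge0 ?powR_ge0 ?indic_ge0// -[_ `^ p^-1 `^ p]powRrM mulVf ?gt_eqF ?p_gt0//.
rewrite powRr1 ?(ltW (w0 x))// indicE; case: (_ \in _); first by rewrite powR1.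
by rewrite powR0// gt_eqF// p_gt0.
Qed.

Lemma pair_bound k f g : measurable_fun setT f -> measurable_fun setT g ->
  {ae mu, forall x, ~ dcube k x -> f x = 0} ->
  (\int[mu]_x (`|f x| * `|g x|)%:E <= atom_cost k f * morrey_term k g)%E.
Proof.
move=> mf mg f0; rewrite /atom_cost /morrey_term muleACA -EFinM -powRD; last first.
  by apply/implyP => _; rewrite gt_eqF// wcube_gt0.
by rewrite subrr powRr0 mul1e; exact: weighted_hoelder.
Qed.

Definition wocube m : R := \int[mu]_x (w x * \1_(ocube m) x).

(** Let t be the w-measure of the intersection of Q with [ocube m]. The integral over Q is at most
    |K|^p t, and t is at most both w(Q) and w(ocube m), so [powR_min_le] with e = 1/p bounds small
    and large cubes alike. *)
Lemma morrey_term_bounded m g (K : R) : measurable_fun setT g ->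
  (forall x, `|g x| <= K * \1_(ocube m) x) ->
  forall k, (morrey_term k g <= (`|K| * wocube m `^ (p^-1 - s))%:E)%E.
Proof.
move=> mg gK k.
have mo := @measurable_indic_ocube R n m.
have mk : measurable_fun setT (\1_(dcube k) : 'rV[R]_n -> R).
  by apply: measurable_indic; exact: measurable_dcube.
have mng : measurable_fun setT (fun x => `|g x|) by exact: measurableT_comp.
pose T x := w x * \1_(ocube m) x * \1_(dcube k) x.
have T0 x : 0 <= T x by rewrite !mulr_ge0 ?indic_ge0// ltW.
have mT : measurable_fun setT T by do 2!apply: measurable_funM => //.
have To x : T x <= w x * \1_(ocube m) x.
  by rewrite ler_piMr ?indic_le1// mulr_ge0 ?indic_ge0// ltW.
have Tk x : T x <= w x * \1_(dcube k) x.
  by rewrite /T ler_wpM2r ?indic_ge0// ler_piMr ?indic_le1// ltW.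
have rT : ri mu T by apply: ri_le (lw m) => // x; rewrite ger0_norm.
pose t := \int[mu]_x T x.
have t0 : 0 <= t by apply: Rintegral_ge0.
have to : t <= wocube m by apply: rint_le => //; exact: lw.
have tk : t <= wcube k by apply: rint_le => //; exact: ri_weight_dcube.
have Wk := wcube_gt0 k.
have p0 := p_gt0.
have I1 : (\int[mu]_x (`|g x| `^ p * w x * \1_(dcube k) x)%:E <= (`|K| `^ p * t)%:E)%E.
  rewrite EFinM -ri_EFin// -ge0_integralZl_EFin ?powR_ge0//; last 2 first.
  - by move=> x _; rewrite lee_fin.
  - exact/measurable_EFinP.
  apply: ge0_le_integral => //.
  - by move=> x _; rewrite lee_fin !mulr_ge0 ?powR_ge0 ?indic_ge0// ltW.
  - apply/measurable_EFinP; apply: measurable_funM => //; apply: measurable_funM => //.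
    exact: measurable_powR_fun.
  - by apply/measurable_EFinP; exact: measurable_funM.
  - move=> x _; rewrite -EFinM lee_fin /T mulrA ler_wpM2r ?indic_ge0//.
    rewrite [w x * _]mulrC mulrA ler_wpM2r ?(ltW (w0 x))//.
    have := gK x; rewrite indicE; case: (_ \in _); rewrite ?mulr1 ?mulr0 => gK'.
      apply: ge0_ler_powR; rewrite ?nnegrE ?(ltW p0)//.
      by rewrite (le_trans gK')// ler_norm.
    by move: gK'; rewrite normr_le0 => /eqP ->; rewrite normr0 powR0 ?gt_eqF.
have : ((\int[mu]_x (`|g x| `^ p * w x * \1_(dcube k) x)%:E) `^ p^-1 <= (`|K| * t `^ p^-1)%:E)%E.
  apply: (@le_trans _ _ ((`|K| `^ p * t)%:E `^ p^-1)%E).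
    apply: gt0_ler_poweR; rewrite ?invr_ge0 ?(ltW p0)// in_itv/= ?leey ?andbT.
      by apply: integral_ge0 => x _; rewrite lee_fin !mulr_ge0 ?powR_ge0 ?indic_ge0// ltW.
    by rewrite lee_fin mulr_ge0 ?powR_ge0.
  by rewrite poweR_EFin powRM ?powR_ge0// -powRrM mulfV ?gt_eqF// powRr1.
move=> h; apply: (@le_trans _ _ ((wcube k `^ (- s))%:E * (`|K| * t `^ p^-1)%:E)%E).
  by apply: lee_wpmul2l => //; rewrite lee_fin powR_ge0.
rewrite -EFinM lee_fin mulrCA ler_wpM2l//.
by apply: powR_min_le => //; exact: ltW.
Qed.

End weights.

(** * Complex integrals and series of atoms *)

Section cintegrable.
Context {R : realType} {n : nat}.
Local Notation mu := (@lebesgue_rV R n).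
Implicit Types f g : 'rV[R]_n -> R[i].

Definition cri f := ri mu (fun x => complex.Re (f x)) /\ ri mu (fun x => complex.Im (f x)).

Lemma ReM (z1 z2 : R[i]) : complex.Re (z1 * z2) =
  complex.Re z1 * complex.Re z2 - complex.Im z1 * complex.Im z2.
Proof. by case: z1 => a b; case: z2. Qed.

Lemma ImM (z1 z2 : R[i]) : complex.Im (z1 * z2) =
  complex.Re z1 * complex.Im z2 + complex.Im z1 * complex.Re z2.
Proof. by case: z1 => a b; case: z2. Qed.

Lemma ReD (z1 z2 : R[i]) : complex.Re (z1 + z2) = complex.Re z1 + complex.Re z2.
Proof. by case: z1 => a b; case: z2. Qed.

Lemma ImD (z1 z2 : R[i]) : complex.Im (z1 + z2) = complex.Im z1 + complex.Im z2.
Proof. by case: z1 => a b; case: z2. Qed.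

Lemma Re_realM (z : R[i]) (c : R) : complex.Re (z * c%:C%C) = complex.Re z * c.
Proof. by rewrite ReM /= mulr0 subr0. Qed.

Lemma Im_realM (z : R[i]) (c : R) : complex.Im (z * c%:C%C) = complex.Im z * c.
Proof. by rewrite ImM /= mulr0 add0r. Qed.

Lemma measurable_cfunM f g : measurable_cfun f -> measurable_cfun g ->
  measurable_cfun (fun x => f x * g x).
Proof.
move=> [rf jf] [rg jg]; split.
  by under eq_fun do rewrite ReM; apply: measurable_funB; exact: measurable_funM.
by under eq_fun do rewrite ImM; apply: measurable_funD; exact: measurable_funM.
Qed.

Lemma measurable_cfunD f g : measurable_cfun f -> measurable_cfun g ->
  measurable_cfun (fun x => f x + g x).
Proof.
move=> [rf jf] [rg jg]; split.
  under eq_fun do rewrite ReD; exact: measurable_funD.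
under eq_fun do rewrite ImD; exact: measurable_funD.
Qed.

Lemma measurable_cfun_cst (z : R[i]) : measurable_cfun (fun _ : 'rV[R]_n => z).
Proof. by split; exact: measurable_cst. Qed.

Lemma measurable_toC (u : 'rV[R]_n -> R) : measurable_fun setT u -> measurable_cfun (toC u).
Proof. by move=> mu_; split. Qed.

Lemma measurable_cfun_cabs f : measurable_cfun f -> measurable_fun setT (fun x => cabs (f x)).
Proof. by move=> [rf jf]; exact: measurable_cabs. Qed.

Lemma cri_le f (h : 'rV[R]_n -> R) : measurable_cfun f -> (forall x, cabs (f x) <= h x) ->
  ri mu h -> cri f.
Proof.
move=> [mr mi] fh rh; split; apply: ri_le rh => // x.
  by rewrite (le_trans (Re_le_cabs _)).
by rewrite (le_trans (Im_le_cabs _)).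
Qed.

Lemma criZD (z : R[i]) f g : cri f -> cri g -> cri (fun x => z * f x + g x).
Proof.
move=> [rf jf] [rg jg]; split.
  rewrite (_ : (fun x => _) = (fun x => complex.Re z * complex.Re (f x) +
      (- complex.Im z * complex.Im (f x) + complex.Re (g x)))); last first.
    by apply/funext => x; rewrite ReD ReM; ring.
  by do 2!apply: ri_lin => //.
rewrite (_ : (fun x => _) = (fun x => complex.Re z * complex.Im (f x) +
    (complex.Im z * complex.Re (f x) + complex.Im (g x)))); last first.
  by apply/funext => x; rewrite ImD ImM; ring.
by do 2!apply: ri_lin => //.
Qed.

Lemma cintegralZD (z : R[i]) f g : cri f -> cri g ->
  cintegral (fun x => z * f x + g x) = z * cintegral f + cintegral g.
Proof.
move=> [rf jf] [rg jg]; rewrite /cintegral.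
have -> : \int[mu]_x complex.Re (z * f x + g x) = complex.Re z * \int[mu]_x complex.Re (f x) +
      (- complex.Im z * \int[mu]_x complex.Im (f x) + \int[mu]_x complex.Re (g x)).
  rewrite -rint_lin// -rint_lin//; last exact: ri_lin.
  by apply: eq_Rintegral => x _; rewrite ReD ReM; ring.
have -> : \int[mu]_x complex.Im (z * f x + g x) = complex.Re z * \int[mu]_x complex.Im (f x) +
      (complex.Im z * \int[mu]_x complex.Re (f x) + \int[mu]_x complex.Im (g x)).
  rewrite -rint_lin// -rint_lin//; last exact: ri_lin.
  by apply: eq_Rintegral => x _; rewrite ImD ImM; ring.
by case: z => a b; apply/eqP; rewrite eq_complex /=; apply/andP; split; apply/eqP; ring.
Qed.

Lemma cintegral0 : cintegral (fun _ : 'rV[R]_n => 0 : R[i]) = 0.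
Proof. by rewrite /cintegral !Rintegral_cst// !mul0r. Qed.

Lemma cri0 : cri (fun _ : 'rV[R]_n => 0 : R[i]).
Proof. by split; exact: integrable0. Qed.

Lemma cintegralD f g : cri f -> cri g ->
  cintegral (fun x => f x + g x) = cintegral f + cintegral g.
Proof.
move=> rf rg; rewrite -[cintegral f]mul1r -cintegralZD//.
by congr cintegral; apply/funext => x; rewrite mul1r.
Qed.

Lemma cintegral_ae f g : measurable_cfun f -> measurable_cfun g ->
  {ae mu, forall x, f x = g x} -> cintegral f = cintegral g.
Proof.
move=> [rf jf] [rg jg] fg; rewrite /cintegral; congr Complex; apply: rint_ae => //.
- by apply: filterS fg => x ->.
- by apply: filterS fg => x ->.
Qed.

Lemma cri_ae f g : measurable_cfun g -> {ae mu, forall x, f x = g x} -> cri f -> cri g.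
Proof.
move=> [rg jg] fg [rf jf]; split.
- by apply: ri_ae rf => //; apply: filterS fg => x ->.
- by apply: ri_ae jf => //; apply: filterS fg => x ->.
Qed.

(** The complex integral is defined by its two real components; bounding each by the integral of h
    gives the factor 2. *)
Lemma cintegral_le f (h : 'rV[R]_n -> R) : measurable_cfun f ->
  (forall x, cabs (f x) <= h x) -> ri mu h -> cabs (cintegral f) <= 2 * \int[mu]_x h x.
Proof.
move=> mf fh rh; have [rf jf] := cri_le mf fh rh.
have h1 (u : 'rV[R]_n -> R) : ri mu u -> (forall x, `|u x| <= h x) ->
    `|\int[mu]_x u x| <= \int[mu]_x h x.
  move=> ru uh; apply: (le_trans (le_normr_Rintegral _ _)) => //.
  by apply: rint_le => //; exact: ri_norm.
rewrite (le_trans (cabs_le_ReIm _))//= mulr_natl mulr2n lerD// h1// => x.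
  by rewrite (le_trans (Re_le_cabs _)).
by rewrite (le_trans (Im_le_cabs _)).
Qed.

Definition loc_cri f := forall m, cri (fun x => f x * toC \1_(ocube m) x).

Lemma loc_criP f : loc_cri f <->
  loc_ri (fun x => complex.Re (f x)) /\ loc_ri (fun x => complex.Im (f x)).
Proof.
have Er m : (fun x => complex.Re (f x * toC \1_(ocube m) x)) =
    (fun x => complex.Re (f x) * \1_(ocube m) x) by apply/funext => x; exact: Re_realM.
have Ei m : (fun x => complex.Im (f x * toC \1_(ocube m) x)) =
    (fun x => complex.Im (f x) * \1_(ocube m) x) by apply/funext => x; exact: Im_realM.
split=> [lf|[lr li] m].
  by split=> m; have [] := lf m; rewrite Er Ei.
by split; rewrite ?Er ?Ei; [exact: lr|exact: li].
Qed.

Theorem cae_eq_of_bump f g : measurable_cfun f -> measurable_cfun g ->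
  loc_cri f -> loc_cri g ->
  (forall a b k, cintegral (fun x => f x * toC (bump a b k) x) =
                 cintegral (fun x => g x * toC (bump a b k) x)) ->
  {ae mu, forall x, f x = g x}.
Proof.
move=> [rf jf] [rg jg] /loc_criP[lrf ljf] /loc_criP[lrg ljg] fg.
have H (u v : 'rV[R]_n -> R) : measurable_fun setT u -> measurable_fun setT v ->
    loc_ri u -> loc_ri v ->
    (forall a b k, \int[mu]_x (u x * bump a b k x) = \int[mu]_x (v x * bump a b k x)) ->
    {ae mu, forall x, u x = v x}.
  move=> mu_ mv lu lv uv.
  have : {ae mu, forall x, u x - v x = 0}.
    apply: ae0_of_bump.
    - exact: measurable_funB.
    - move=> m; under eq_fun do rewrite mulrBl; exact: ri_B.
    - move=> a b k.
      have [m abm] := bump_bounded a b k.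
      have ru := loc_ri_bounded lu mu_ (measurable_bump a b k) abm.
      have rv := loc_ri_bounded lv mv (measurable_bump a b k) abm.
      rewrite (_ : (fun x => _) = (fun x => -1 * (v x * bump a b k x) + u x * bump a b k x)).
        by rewrite rint_lin// uv mulN1r addNr.
      by apply/funext => x; ring.
  by apply: filterS => x /eqP; rewrite subr_eq0 => /eqP.
have ReE (u : 'rV[R]_n -> R[i]) (t : 'rV[R]_n -> R) :
    \int[mu]_x complex.Re (u x * toC t x) = \int[mu]_x (complex.Re (u x) * t x).
  by apply: eq_Rintegral => x _; exact: Re_realM.
have ImE (u : 'rV[R]_n -> R[i]) (t : 'rV[R]_n -> R) :
    \int[mu]_x complex.Im (u x * toC t x) = \int[mu]_x (complex.Im (u x) * t x).
  by apply: eq_Rintegral => x _; exact: Im_realM.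
have h1 := H _ _ rf rg lrf lrg; have h2 := H _ _ jf jg ljf ljg.
have {}h1 : {ae mu, forall x, complex.Re (f x) = complex.Re (g x)}.
  by apply: h1 => a b k; have := congr1 (@complex.Re R) (fg a b k); rewrite /cintegral /= !ReE.
have {}h2 : {ae mu, forall x, complex.Im (f x) = complex.Im (g x)}.
  by apply: h2 => a b k; have := congr1 (@complex.Im R) (fg a b k); rewrite /cintegral /= !ImE.
by apply: filterS2 h1 h2 => x; case: (f x) => a b; case: (g x) => c d /= -> ->.
Qed.

Lemma measurable_cfun_sum (I : Type) (X : seq I) (a : I -> 'rV[R]_n -> R[i]) :
  (forall k, measurable_cfun (a k)) -> measurable_cfun (fun x => \sum_(k <- X) a k x).
Proof.
move=> ma; elim: X => [|k X IH].
  under eq_fun do rewrite big_nil; exact: measurable_cfun_cst.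
under eq_fun do rewrite big_cons; exact: measurable_cfunD.
Qed.

Lemma cintegral_sum (I : Type) (X : seq I) (a : I -> 'rV[R]_n -> R[i]) :
  (forall k, cri (a k)) -> cri (fun x => \sum_(k <- X) a k x) /\
  cintegral (fun x => \sum_(k <- X) a k x) = \sum_(k <- X) cintegral (a k).
Proof.
move=> ra; elim: X => [|k X [rX IH]].
  have -> : (fun x => \sum_(k <- [::]) a k x) = fun=> 0 by apply/funext => x; rewrite big_nil.
  by rewrite big_nil; split; [exact: cri0|exact: cintegral0].
have E : (fun x => \sum_(k <- k :: X) a k x) = (fun x => 1 * a k x + \sum_(k <- X) a k x).
  by apply/funext => x; rewrite big_cons mul1r.
rewrite E big_cons; split; first exact: criZD.
by rewrite cintegralZD// IH mul1r.
Qed.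

End cintegrable.

Section rint_sum.
Context d (T : measurableType d) (R : realType) (mu : {measure set T -> \bar R}).

Lemma rint_sum (I : Type) (s : seq I) (f : I -> T -> R) : (forall i, ri mu (f i)) ->
  ri mu (fun x => \sum_(i <- s) f i x) /\
  \int[mu]_x (\sum_(i <- s) f i x) = \sum_(i <- s) \int[mu]_x f i x.
Proof.
move=> rf; elim: s => [|i s [rs IH]].
  rewrite big_nil (_ : (fun _ => _) = (fun=> 0)); last by apply/funext => x; rewrite big_nil.
  by rewrite Rintegral_cst// mul0r; split => //; exact: integrable0.
rewrite big_cons (_ : (fun _ => _) = (fun x => f i x + \sum_(i <- s) f i x)); last first.
  by apply/funext => x; rewrite big_cons.
by split; [exact: ri_D|rewrite -IH; exact: (RintegralD measurableT (rf i) rs)].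
Qed.

End rint_sum.

(** * Series of functions that converge absolutely in local L_1 *)

Section atom_series.
Context {R : realType} {n : nat}.
Local Notation mu := (@lebesgue_rV R n).
Variable b : nat -> 'rV[R]_n -> R[i].
Hypothesis mb : forall j, measurable_cfun (b j).

(** Only finite partial sums are bounded, which is what a finite cost yields directly; monotone
    convergence carries B over to the full series. *)
Definition summable_against (g : 'rV[R]_n -> R) (B : R) :=
  forall N, (\sum_(0 <= j < N) \int[mu]_x (cabs (b j x) * g x)%:E <= B%:E)%E.

Hypothesis b_loc : forall m, exists B, summable_against \1_(ocube m) B.

Let S x : \bar R := (\sum_(0 <= j <oo) (cabs (b j x))%:E)%E.

Let S_ge0 x : (0 <= S x)%E.
Proof. by apply: nneseries_ge0 => j _ _; rewrite lee_fin cabs_ge0. Qed.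

Let mS : measurable_fun setT S.
Proof.
apply: ge0_emeasurable_sum => [j x _ _|j _]; first by rewrite lee_fin cabs_ge0.
by apply/measurable_EFinP; exact: measurable_cfun_cabs.
Qed.

Let integral_sum_le (g : 'rV[R]_n -> R) B : measurable_fun setT g -> (forall x, 0 <= g x) ->
  summable_against g B ->
  (\int[mu]_x (\sum_(0 <= j <oo) (cabs (b j x) * g x)%:E) <= B%:E)%E.
Proof.
move=> mg g0 gB; rewrite integral_nneseries//.
- apply: lime_le; last by apply: nearW => N; exact: gB.
  apply: is_cvg_nneseries => j _ _; apply: integral_ge0 => x _.
  by rewrite lee_fin mulr_ge0// cabs_ge0.
- move=> j; apply/measurable_EFinP; apply: measurable_funM => //.
  exact: measurable_cfun_cabs.
- by move=> j x _; rewrite lee_fin mulr_ge0// cabs_ge0.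
Qed.

Let S_fin : {ae mu, forall x, S x \is a fin_num}.
Proof.
have h m : {ae mu, forall x, ocube m x -> S x \is a fin_num}.
  have [B mB] := b_loc m.
  have m1 := @measurable_indic_ocube R n m.
  have i0 (x : 'rV[R]_n) : 0 <= \1_(ocube m) x :> R by exact: indic_ge0.
  have Bm := integral_sum_le m1 i0 mB.
  pose f x : \bar R := (\sum_(0 <= j <oo) (cabs (b j x) * \1_(ocube m) x)%:E)%E.
  have f0 x : (0 <= f x)%E.
    by apply: nneseries_ge0 => j _ _; rewrite lee_fin mulr_ge0// cabs_ge0.
  have /(integrable_ae measurableT) : mu.-integrable setT f.
    apply/integrableP; split.
      apply: ge0_emeasurable_sum => [j x _ _|j _]; first by rewrite lee_fin mulr_ge0// cabs_ge0.
      apply/measurable_EFinP; apply: measurable_funM => //; exact: measurable_cfun_cabs.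
    under eq_integral do rewrite gee0_abs//.
    exact: le_lt_trans Bm (ltry _).
  apply: filterS => x /(_ Logic.I) + xm.
  by rewrite /f /S; under eq_eseriesr do rewrite indicE mem_set// mulr1.
by apply: filterS (ae_foralln h) => x hx; have [m xm] := mem_ocube x; exact: hx.
Qed.

(** The set where the series converges absolutely, of full measure by [S_fin]. The terms are cut off
    to G, so that the sum exists at every point and is a measurable limit. *)
Let G := [set x | S x \is a fin_num].

Let mG : measurable G.
Proof. by have := emeasurable_fin_num measurableT mS; rewrite setTI. Qed.

Let c j x : R[i] := b j x * toC \1_G x.

Let mc j : measurable_cfun (c j).
Proof. by apply: measurable_cfunM => //; apply: measurable_toC; exact: measurable_indic. Qed.

Let t x : R := fine (S x) * \1_G x.

Let t_ge0 x : 0 <= t x.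
Proof. by rewrite mulr_ge0 ?indic_ge0// fine_ge0. Qed.

Let mt : measurable_fun setT t.
Proof. by apply: measurable_funM; [exact: measurableT_comp|exact: measurable_indic]. Qed.

Let cabs_c j x : cabs (c j x) = cabs (b j x) * \1_G x.
Proof. by rewrite cabsM cabs_toC ger0_norm// indic_ge0. Qed.

Let sum_c_le N x : \sum_(0 <= j < N) cabs (c j x) <= t x.
Proof.
under eq_bigr do rewrite cabs_c; rewrite -big_distrl/= /t indicE.
have [/set_mem xG|_] := boolP (x \in G); last by rewrite !mulr0.
rewrite !mulr1 -lee_fin fineK// -sumEFin.
by apply: nneseries_lim_ge => j _ _; rewrite lee_fin cabs_ge0.
Qed.

Let c_cvg (f : nat -> R) x : (forall j, `|f j| <= cabs (c j x)) -> cvgn (series f).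
Proof.
move=> fc; apply: normed_cvg; apply: nondecreasing_is_cvgn.
  apply: nondecreasing_series => j _ _; exact: normr_ge0.
exists (t x) => _ [N _ <-]; apply: le_trans (sum_c_le N x).
by rewrite /series/= ler_sum.
Qed.

Definition series_sum x : R[i] :=
  Complex (limn (series (fun j => complex.Re (c j x)))) (limn (series (fun j => complex.Im (c j x)))).

Let Re_cvg x : series (fun j => complex.Re (c j x)) @ \oo --> complex.Re (series_sum x).
Proof. by apply: (c_cvg (x := x)) => j; exact: Re_le_cabs. Qed.

Let Im_cvg x : series (fun j => complex.Im (c j x)) @ \oo --> complex.Im (series_sum x).
Proof. by apply: (c_cvg (x := x)) => j; exact: Im_le_cabs. Qed.

Lemma measurable_series_sum : measurable_cfun series_sum.
Proof.
have lim_mfun (u : nat -> 'rV[R]_n -> R) (l : 'rV[R]_n -> R) : (forall j, measurable_fun setT (u j)) ->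
    (forall x, series (u ^~ x) @ \oo --> l x) -> measurable_fun setT l.
  move=> mu_ ul; apply: (measurable_fun_cvg (h := fun N x => series (u ^~ x) N)).
    by move=> N; exact: measurable_sum.
  by move=> x _; exact: ul.
by split; [apply: lim_mfun Re_cvg|apply: lim_mfun Im_cvg] => j; have [] := mc j.
Qed.

(** The function t |g|, with t the sum of the moduli on G, has integral at most B and dominates all
    partial sums. Dominated convergence then integrates the series term by term. *)
Theorem series_sumP (g : 'rV[R]_n -> R[i]) B : measurable_cfun g ->
  summable_against (fun x => cabs (g x)) B ->
  [/\ cri (fun x => series_sum x * g x),
      cabs (cintegral (fun x => series_sum x * g x)) <= 2 * B,
      (\sum_(0 <= j < N) complex.Re (cintegral (fun x => b j x * g x))) @[N --> \oo] -->
        complex.Re (cintegral (fun x => series_sum x * g x)) &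
      (\sum_(0 <= j < N) complex.Im (cintegral (fun x => b j x * g x))) @[N --> \oo] -->
        complex.Im (cintegral (fun x => series_sum x * g x))].
Proof.
move=> mg gB.
pose T x := t x * cabs (g x).
have mcg : measurable_fun setT (fun x => cabs (g x)) by exact: measurable_cfun_cabs.
have mT : measurable_fun setT T by exact: measurable_funM.
have T0 x : 0 <= T x by rewrite mulr_ge0// cabs_ge0.
have TB : (\int[mu]_x (T x)%:E <= B%:E)%E.
  apply: le_trans (integral_sum_le mcg (fun x => cabs_ge0 _) gB).
  apply: ge0_le_integral => //.
  - by move=> x _; rewrite lee_fin.
  - exact/measurable_EFinP.
  - apply: ge0_emeasurable_sum => [j x _ _|j _]; first by rewrite lee_fin mulr_ge0// cabs_ge0.
    by apply/measurable_EFinP; apply: measurable_funM => //; exact: measurable_cfun_cabs.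
  - move=> x _; rewrite /T /t indicE.
    have [/set_mem xG|_] := boolP (x \in G); last first.
      by rewrite mulr0 mul0r; apply: nneseries_ge0 => j _ _; rewrite lee_fin mulr_ge0// cabs_ge0.
    rewrite mulr1 mulrC EFinM fineK// /S -nneseriesZl.
      by apply: lee_nneseries => [j _|j _]; rewrite -EFinM ?lee_fin ?mulr_ge0 ?cabs_ge0// mulrC.
    by move=> j _; rewrite lee_fin cabs_ge0.
have rT : ri mu T by apply: ri_ge0 => //; exact: le_lt_trans TB (ltry _).
have Tle : \int[mu]_x T x <= B by rewrite -lee_fin -ri_EFin.
have mAg : measurable_cfun (fun x => series_sum x * g x).
  by apply: measurable_cfunM => //; exact: measurable_series_sum.
have mcjg j : measurable_cfun (fun x => c j x * g x) by exact: measurable_cfunM.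
(* Here [re] stands for the real or the imaginary part, to which the same argument applies. *)
have key (re : R[i] -> R) : (forall z, `|re z| <= cabs z) ->
    (forall x, \sum_(0 <= j < N) re (c j x * g x) @[N --> \oo] --> re (series_sum x * g x)) ->
    (forall j, measurable_fun setT (fun x => re (c j x * g x))) ->
    [/\ ri mu (fun x => re (series_sum x * g x)),
      `|\int[mu]_x re (series_sum x * g x)| <= B &
      (\sum_(0 <= j < N) \int[mu]_x re (c j x * g x)) @[N --> \oo] -->
        \int[mu]_x re (series_sum x * g x)].
  move=> rec cv mre.
  have le1 j x : `|re (c j x * g x)| <= T x.
    rewrite (le_trans (rec _))// cabsM ler_wpM2r ?cabs_ge0//.
    apply: le_trans (sum_c_le j.+1 x); rewrite big_nat_recr//= lerDr.
    by apply: sumr_ge0 => i _; exact: cabs_ge0.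
  have rj j : ri mu (fun x => re (c j x * g x)) by exact: ri_le rT.
  have leN N x : `|\sum_(0 <= j < N) re (c j x * g x)| <= T x.
    rewrite (le_trans (ler_norm_sum _ _ _))//.
    apply: (@le_trans _ _ ((\sum_(0 <= j < N) cabs (c j x)) * cabs (g x))).
      by rewrite big_distrl/= ler_sum// => j _; rewrite -cabsM.
    by rewrite ler_wpM2r ?cabs_ge0.
  have sumE N := rint_sum (index_iota 0 N) rj.
  have [||||rA cvA] := @rdct _ _ _ mu (fun N x => \sum_(0 <= j < N) re (c j x * g x))
    (fun x => re (series_sum x * g x)) T.
  - by move=> N; apply: ri_meas; exact: (sumE N).1.
  - exact: cv.
  - exact: leN.
  - exact: rT.
  split => //.
    apply: (le_trans (le_normr_Rintegral _ _)) => //; apply: le_trans Tle.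
    apply: rint_le => //; first exact: ri_norm.
    move=> x.
    exact: cvg_norm_le (cv x) _.
  rewrite (_ : (fun N => _) = (fun N => \int[mu]_x \sum_(0 <= j < N) re (c j x * g x)))//.
  by apply/funext => N; rewrite (sumE N).2.
(* The cut-off to G only changes the terms on a null set. *)
have bc j : cintegral (fun x => b j x * g x) = cintegral (fun x => c j x * g x).
  apply: cintegral_ae => //; first exact: measurable_cfunM.
  apply: filterS S_fin => x xG; rewrite /c /toC indicE mem_set//.
  by rewrite (_ : 1%:R%:C%C = 1)// mulr1.
have [|||rr rB rcv] := key (@complex.Re R).
- exact: Re_le_cabs.
- move=> x; rewrite ReM (_ : (fun N => _) = fun N =>
    series (fun j => complex.Re (c j x)) N * complex.Re (g x) -
    series (fun j => complex.Im (c j x)) N * complex.Im (g x)).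
    by apply: cvgB; apply: cvgMl; [exact: Re_cvg|exact: Im_cvg].
  apply/funext => N; rewrite /series/= !big_distrl/= -sumrB.
  by apply: eq_bigr => j _; rewrite ReM.
- by move=> j; have [] := mcjg j.
have [|||jr jB jcv] := key (@complex.Im R).
- exact: Im_le_cabs.
- move=> x; rewrite ImM (_ : (fun N => _) = fun N =>
    series (fun j => complex.Re (c j x)) N * complex.Im (g x) +
    series (fun j => complex.Im (c j x)) N * complex.Re (g x)).
    by apply: cvgD; apply: cvgMl; [exact: Re_cvg|exact: Im_cvg].
  apply/funext => N; rewrite /series/= !big_distrl/= -big_split/=.
  by apply: eq_bigr => j _; rewrite ImM.
- by move=> j; have [] := mcjg j.
split.
- by split.
- by rewrite (le_trans (cabs_le_ReIm _))//= mulr_natl mulr2n lerD.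
- by under eq_fun do under eq_bigr do rewrite bc.
- by under eq_fun do under eq_bigr do rewrite bc.
Qed.

Lemma loc_cri_series_sum : loc_cri series_sum.
Proof.
move=> m; have [B mB] := b_loc m.
have m1 := @measurable_indic_ocube R n m.
suff /(series_sumP (measurable_toC m1))[] : summable_against (fun x => cabs (toC \1_(ocube m) x)) B by [].
move=> N; apply: le_trans (mB N); rewrite le_eqVlt; apply/orP; left; apply/eqP.
apply: eq_bigr => j _; apply: eq_integral => x _.
by rewrite cabs_toC ger0_norm// indic_ge0.
Qed.

End atom_series.

(** * Regular functionals *)

Section regular_functionals.
Context {R : realType} {n : nat}.
Local Notation mu := (@lebesgue_rV R n).
Implicit Types (f g : 'rV[R]_n -> R[i]).

Lemma csmooth_measurable f : csmooth f -> measurable_cfun f.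
Proof. by move=> [sr si]; split; [exact: smooth_measurable sr|exact: smooth_measurable si]. Qed.

Lemma schwartzP (phi : schwartz_space R n) : schwartz phi.
Proof. by case: phi => phi /= /asboolP. Qed.

Lemma schwartz_measurable (phi : schwartz_space R n) : measurable_cfun phi.
Proof. by have [sphi _] := schwartzP phi; exact: csmooth_measurable. Qed.

Lemma schwartz_bound (phi : schwartz_space R n) :
  exists B : R, [/\ 0 <= B, schwartz_norm 0 phi = B%:E & forall x, cabs (phi x) <= B].
Proof.
have [_ /(_ 0%N) fin] := schwartzP phi.
have le x : ((cabs (phi x))%:E <= schwartz_norm 0 phi)%E.
  apply: ereal_sup_ubound; exists ([::], x) => //=.
  by rewrite expr0 mul1r /cpderivs /=; case: (phi x).
have ge0 : (0 <= schwartz_norm 0 phi)%E by apply: le_trans (le 0); rewrite lee_fin cabs_ge0.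
have fn : schwartz_norm 0 phi \is a fin_num by rewrite ge0_fin_numE.
exists (fine (schwartz_norm 0 phi)); rewrite fineK//; split => //; first exact: fine_ge0.
by move=> x; rewrite -lee_fin fineK.
Qed.

Lemma test_function_bounded f : test_function f ->
  measurable_cfun f /\ exists m K, forall x, cabs (f x) <= K * \1_(ocube m) x.
Proof.
move=> [sf cf]; split; first exact: csmooth_measurable.
have [m fm] := compact_ocube cf.
have bnd (u : 'rV[R]_n -> R) : smooth u -> exists K, 0 <= K /\
    forall x, closure [set x | f x != 0] x -> `|u x| <= K.
  move=> /(_ [::])[cu _].
  have : compact (u @` closure [set x | f x != 0]).
    by apply: continuous_compact => //; exact: continuous_subspaceT.
  move=> /compact_bounded[M [_ MP]]; exists (`|M| + 1); split; first by rewrite addr_ge0.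
  move=> x xf; apply: (MP (`|M| + 1)); first by rewrite (le_lt_trans (ler_norm M))// ltrDl.
  by exists x.
have [Kr [Kr0 KrP]] := bnd _ sf.1; have [Ki [Ki0 KiP]] := bnd _ sf.2.
exists m, (Kr + Ki) => x.
have [fx0|fx0] := eqVneq (f x) 0; first by rewrite fx0 cabs0 mulr_ge0 ?addr_ge0 ?indic_ge0.
have xf : closure [set x | f x != 0] x by exact: subset_closure.
rewrite indicE mem_set ?mulr1; last exact: fm.
by rewrite (le_trans (cabs_le_ReIm _))// lerD ?KrP ?KiP.
Qed.

Definition hreg f (phi : schwartz_space R n) : R[i] := cintegral (fun x => f x * phi x).

Lemma ri_ocube m : ri mu (\1_(ocube m) : 'rV[R]_n -> R).
Proof.
have m1 := @measurable_indic_ocube R n m.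
apply: ri_ge0 => //.
rewrite integral_indic//; last exact: measurable_ocube.
rewrite setIT; apply: (@le_lt_trans _ _ (mu (dcube (bigcube m)))).
  by apply: le_measure; rewrite ?inE; [exact: measurable_ocube|exact: measurable_dcube|exact: ocube_bigcube].
by rewrite dcube_cube mu_cube ?ltry// mulr_gt0// side_gt0.
Qed.

Definition bounded_on m (K : R) f := measurable_cfun f /\ forall x, cabs (f x) <= K * \1_(ocube m) x.

Lemma bounded_on_cri m K f g (B : R) : bounded_on m K f -> measurable_cfun g ->
  (forall x, cabs (g x) <= B) -> cri (fun x => f x * g x) /\
  cabs (cintegral (fun x => f x * g x)) <= 2 * (K * fine (mu (ocube m)) * B).
Proof.
move=> [mf fK] mg gB.
have mfg := measurable_cfunM mf mg.
have le x : cabs (f x * g x) <= K * B * \1_(ocube m) x.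
  by rewrite cabsM mulrAC ler_pM ?cabs_ge0.
have rh : ri mu (fun x => K * B * \1_(ocube m) x) by apply: ri_Z; exact: ri_ocube.
split; first exact: cri_le rh.
apply: le_trans (cintegral_le mfg le rh) _; rewrite ler_wpM2l//.
rewrite RintegralZl//; last exact: ri_ocube.
rewrite mulrAC le_eqVlt; apply/orP; left; apply/eqP; congr (_ * _).
by rewrite /Rintegral integral_indic ?setIT//; exact: measurable_ocube.
Qed.

Lemma schwartz_linE (c : R[i]) (u v : schwartz_space R n) x : (c *: u + v) x = c * u x + v x.
Proof. by []. Qed.

Lemma hreg_tempered m K f : bounded_on m K f -> tempered (hreg f).
Proof.
move=> bf; have crf (phi : schwartz_space R n) : cri (fun x => f x * phi x).
  have [B [_ _ phiB]] := schwartz_bound phi.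
  by have [] := bounded_on_cri bf (schwartz_measurable phi) phiB.
split.
  move=> c u v; rewrite /hreg -[c *: cintegral _]/(c * cintegral _) -cintegralZD//.
  by congr cintegral; apply/funext => x; rewrite schwartz_linE mulrDr mulrCA.
exists (2 * (K * fine (mu (ocube m)))), 0%N => phi.
have [B [_ -> phiB]] := schwartz_bound phi.
have [_] := bounded_on_cri bf (schwartz_measurable phi) phiB.
by rewrite -EFinM lee_fin !mulrA.
Qed.

(** The Schwartz norms increase with the order, so both functionals are controlled by the norm of
    the larger order. Absolute values of the constants appear because their signs are unknown. *)
Lemma tempered_lin (c : R[i]) (T1 T2 : schwartz_space R n -> R[i]) :
  tempered T1 -> tempered T2 -> tempered (c *: T1 + T2).
Proof.
move=> [l1 [C1 [N1 b1]]] [l2 [C2 [N2 b2]]]; split.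
  move=> z u v; rewrite -[(_ + _) _]/(c * T1 _ + T2 _) l1 l2.
  rewrite -[RHS]/(z * (c * T1 u + T2 u) + (c * T1 v + T2 v)).
  by rewrite -[z *: T1 u]/(z * T1 u) -[z *: T2 u]/(z * T2 u); ring.
have mono N N' (phi : schwartz_space R n) : (N <= N')%N -> (schwartz_norm N phi <= schwartz_norm N' phi)%E.
  move=> NN'; apply: ge_ereal_sup => _ [[s x] sN <-].
  have {}sN : (size s <= N)%N by [].
  apply: (@le_trans _ _ ((1 + `|x|) ^+ N' * cabs (cpderivs s phi x))%:E).
    by rewrite lee_fin ler_wpM2r ?cabs_ge0// ler_weXn2l// lerDl.
  by apply: ereal_sup_ubound; exists (s, x) => //=; exact: leq_trans NN'.
exists (cabs c * `|C1| + `|C2|), (maxn N1 N2) => phi.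
have [_ /(_ (maxn N1 N2)) fin] := schwartzP phi.
have n0 N : (0 <= schwartz_norm N phi)%E.
  apply: (@le_trans _ _ (((1 + `|0 : 'rV[R]_n|) ^+ N * cabs (cpderivs [::] phi 0))%:E)).
    by rewrite lee_fin mulr_ge0 ?cabs_ge0// exprn_ge0// addr_ge0.
  by apply: ereal_sup_ubound; exists ([::], 0).
have fn : schwartz_norm (maxn N1 N2) phi \is a fin_num by rewrite ge0_fin_numE.
have le (C : R) N (z : R[i]) : (N <= maxn N1 N2)%N -> ((cabs z)%:E <= C%:E * schwartz_norm N phi)%E ->
    cabs z <= `|C| * fine (schwartz_norm (maxn N1 N2) phi).
  move=> NN h; rewrite -lee_fin EFinM fineK//; apply: (le_trans h).
  apply: (@le_trans _ _ (`|C|%:E * schwartz_norm N phi)%E).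
    by apply: lee_wpmul2r; [exact: n0|rewrite lee_fin ler_norm].
  by apply: lee_wpmul2l; [rewrite lee_fin|exact: mono].
rewrite -[(_ + _) _]/(c * T1 _ + T2 _) -[X in (_ <= _ * X)%E]fineK// -EFinM lee_fin.
apply: (le_trans (cabsD _ _)); rewrite mulrDl lerD//.
  rewrite cabsM -mulrA ler_wpM2l ?cabs_ge0//; apply: le (b1 phi); exact: leq_maxl.
by apply: le (b2 phi); exact: leq_maxr.
Qed.

Lemma test_functionC m (b1 b2 : 'rV[R]_n -> R) : smooth b1 -> smooth b2 ->
  (forall x, ~ ocube m x -> b1 x = 0) -> (forall x, ~ ocube m x -> b2 x = 0) ->
  test_function (fun x => Complex (b1 x) (b2 x)).
Proof.
move=> sb1 sb2 b10 b20; split; first exact: (conj sb1 sb2).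
apply: (@subclosed_compact _ _ [set x : 'rV[R]_n | forall i, - 2 ^+ m <= x ord0 i <= 2 ^+ m]).
- exact: closed_closure.
- exact: compact_box.
- apply: subset_trans (@closed_box R n (fun=> - 2 ^+ m) (fun=> 2 ^+ m)).
  apply: closure_subset => x /=; apply: contraPP => xm.
  apply/negP; rewrite negbK.
  have xm' : ~ ocube m x by move=> h; apply: xm => i; have /andP[? ?] := h i; rewrite !ltW.
  by rewrite b10// b20.
Qed.

Lemma regularE h f : regular h f -> h = hreg f.
Proof. by move=> hf; apply/funext => phi; rewrite hf. Qed.

End regular_functionals.

Section enumeration.
Context {I : countType}.

(** The indices with code below N. Not every number is a code, so a family over I becomes a sequence
    with the value 0 at the remaining numbers. *)
Definition enum_upto (N : nat) : seq I := pmap choice.pickle_inv (iota 0 N).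

Lemma enum_upto_uniq N : uniq (enum_upto N).
Proof. by apply: (pmap_uniq choice.pickle_invK); exact: iota_uniq. Qed.

Lemma mem_enum_upto N k : (k \in enum_upto N) = (choice.pickle k < N)%N.
Proof.
rewrite mem_pmap; apply/mapP/idP => [[j + /esym jk]|kN].
  rewrite mem_iota add0n => /andP[_ jN].
  by have := @choice.pickle_invK I j; rewrite jk /= => ->.
by exists (choice.pickle k); rewrite ?mem_iota// choice.pickleK_inv.
Qed.

Lemma sum_enum_upto (V : nmodType) (f : I -> V) N :
  \sum_(k <- enum_upto N) f k =
  \sum_(0 <= j < N) (if choice.pickle_inv j is Some k then f k else 0).
Proof.
rewrite /enum_upto /index_iota subn0; elim: (iota 0 N) => [|j s IH]; first by rewrite !big_nil.
by rewrite big_cons /= -IH; case: choice.pickle_inv => [k|] /=; rewrite ?big_cons// add0r.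
Qed.

Lemma sum_enum_upto_esum {R : realType} (f : I -> \bar R) N : (forall k, 0 <= f k)%E ->
  (\sum_(k <- enum_upto N) f k <= \esum_(k in setT) f k)%E.
Proof.
move=> f0; apply: esum_ge; exists [set` enum_upto N].
  by split => //; exact: finite_seq.
by rewrite -fsbig_seq// enum_upto_uniq.
Qed.

(** The sets [enum_upto N] are cofinal among the finite sets: N only has to exceed the codes of all
    elements of A0. *)
Lemma unordered_sum_cvg {R : realType} (c : I -> R[i]) (l : R[i]) : unordered_sum c l ->
  (\sum_(k <- enum_upto N) complex.Re (c k)) @[N --> \oo] --> complex.Re l /\
  (\sum_(k <- enum_upto N) complex.Im (c k)) @[N --> \oo] --> complex.Im l.
Proof.
move=> cl.
have key e : 0 < e -> \forall N \near \oo, cabs (\sum_(k <- enum_upto N) c k - l) < e.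
  move=> /cl[A0 A0P].
  pose N0 := (\max_(k <- A0) (choice.pickle k).+1)%N.
  exists N0 => // N /= N0N.
  have := A0P [fset k in enum_upto N]%fset.
  rewrite (_ : \sum_(k <- [fset k in enum_upto N]%fset) c k = \sum_(k <- enum_upto N) c k).
    apply; apply/fsubsetP => k kA0; rewrite !inE mem_enum_upto.
    by apply: leq_trans N0N; rewrite /N0 (big_rem _ kA0)/= leq_maxl.
  apply: perm_big; apply: uniq_perm; rewrite ?fset_uniq ?enum_upto_uniq//.
  by move=> k; rewrite !inE.
have ReS N : complex.Re (\sum_(k <- enum_upto N) c k) = \sum_(k <- enum_upto N) complex.Re (c k).
  exact: (big_morph (@complex.Re R) (@ReD R) erefl).
have ImS N : complex.Im (\sum_(k <- enum_upto N) c k) = \sum_(k <- enum_upto N) complex.Im (c k).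
  exact: (big_morph (@complex.Im R) (@ImD R) erefl).
split; apply/cvgrPdist_lt => e /key; apply: filterS => N; rewrite distrC -?ReS -?ImS.
  move: (\sum_(_ <- _) _) => z; apply: le_lt_trans; rewrite -[leLHS]/(`|complex.Re z - complex.Re l|).
  by apply: le_trans (Re_le_cabs _); case: z l {cl key} => ? ? [].
move: (\sum_(_ <- _) _) => z; apply: le_lt_trans.
by apply: le_trans (Im_le_cabs _); case: z l {cl key} => ? ? [].
Qed.

End enumeration.

Section finite_tail.
Context {R : realType} {I : choiceType}.

(** X is a finite set whose sum comes within e of the supremum that defines the total; finiteness of
    the total allows subtraction. *)
Lemma esum_tail (f : I -> \bar R) (C e : R) : (forall k, 0 <= f k)%E ->
  (\esum_(k in setT) f k <= C%:E)%E -> 0 < e ->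
  exists2 X : set I, finite_set X & (\esum_(k in ~` X) f k < e%:E)%E.
Proof.
move=> f0 fC e0.
have fn : (\esum_(k in setT) f k)%E \is a fin_num.
  by rewrite ge0_fin_numE ?(le_lt_trans fC) ?ltry//; exact: esum_ge0.
have [_ [X [fX _] <-] Xe] := ub_ereal_sup_adherent e0 fn.
exists X => //.
have := esumID X setT f (fun k _ => f0 k); rewrite !setTI => E.
have XE : (\esum_(k in X) f k = \sum_(k \in X) f k)%E by rewrite esum_fset.
have fX' : (\sum_(k \in X) f k)%E \is a fin_num.
  rewrite -XE ge0_fin_numE; last exact: esum_ge0.
  rewrite (le_lt_trans _ (ltry C))// (le_trans _ fC)// E leeDl//; exact: esum_ge0.
move: Xe; rewrite -/(esum _ _) E XE lteBlDr//.
by rewrite lteD2lE.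
Qed.

End finite_tail.

Lemma lt_le_addEFin {R : realType} (x y : \bar R) (a b : R) :
  (x < a%:E)%E -> (y <= b%:E)%E -> (x + y < (a + b)%:E)%E.
Proof.
case: x => [x| |]//; case: y => [y| |]//.
  by rewrite lte_fin lee_fin => xa yb; rewrite -EFinD lte_fin ltr_leD.
all: by move=> _ _; exact: ltNyr.
Qed.

Lemma ge0_le_poweR {R : realType} (x y : \bar R) (e : R) : 0 <= e ->
  (0 <= x)%E -> (x <= y)%E -> (x `^ e <= y `^ e)%E.
Proof.
move=> e0 x0 xy; apply: gt0_ler_poweR => //; rewrite in_itv/= leey andbT//.
exact: le_trans xy.
Qed.

(** * Riesz representation and extremal functions *)

Section radon_nikodym_real.
Context d (T : measurableType d) (R : realType) (mu : {sigma_finite_measure set T -> \bar R}).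
Variable nu : set T -> R.
Hypothesis nu0 : nu set0 = 0.
Hypothesis nu_additive : semi_sigma_additive (fun A => (nu A)%:E).
Hypothesis nu_mu : forall A, measurable A -> mu A = 0%E -> nu A = 0.

Let enu (A : set T) : \bar R := (nu A)%:E.

Let enu0 : enu set0 = 0%E. Proof. by rewrite /enu nu0. Qed.

Let enu_fin A : measurable A -> enu A \is a fin_num. Proof. by []. Qed.

Let enu_additive : semi_sigma_additive enu. Proof. exact: nu_additive. Qed.

HB.instance Definition _ := isCharge.Build d T R enu enu0 enu_fin enu_additive.

Lemma radon_nikodym_real : exists u : T -> R, ri mu u /\
  forall A, measurable A -> nu A = \int[mu]_x (u x * \1_A x).
Proof.
have dom : enu `<< mu.
  by apply/null_content_dominatesP => A mA A0; rewrite /enu nu_mu.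
have fn x := Radon_Nikodym_fin_num x dom.
pose u x := fine (Radon_Nikodym enu mu x).
have uE : EFin \o u = Radon_Nikodym enu mu by apply/funext => x /=; rewrite fineK.
exists u; split; first by rewrite /ri uE; exact: Radon_Nikodym_integrable.
move=> A mA; have := Radon_Nikodym_integral dom mA; rewrite -uE => nuA.
rewrite -[LHS]/(fine (enu A)) nuA integral_mkcond; congr fine.
by apply: eq_integral => x _; rewrite epatch_indic.
Qed.

End radon_nikodym_real.

Section annuli.
Context {R : realType} {n : nat}.

(* The functional is only locally bounded, so the Radon-Nikodym theorem is
   applied on each annulus. *)
Definition annulus j : set 'rV[R]_n := if j is j'.+1 then ocube j `\` ocube j' else ocube 0.

Lemma measurable_annulus j : measurable (annulus j).
Proof.
by case: j => [|j]; [exact: measurable_ocube|apply: measurableD; exact: measurable_ocube].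
Qed.

Lemma annulus_sub j : annulus j `<=` ocube j.
Proof. by case: j => [//|j] x []. Qed.

Lemma sum_annulus m x : \sum_(0 <= j < m.+1) \1_(annulus j) x = \1_(ocube m) x :> R.
Proof.
elim: m => [|m IH]; first by rewrite big_nat1.
rewrite big_nat_recr//= IH !indicE in_setD.
have [/set_mem xm|xm] := boolP (x \in ocube m).
  by rewrite mem_set ?andbF ?addr0//; exact: (ocubeS (leqnSn m)).
by rewrite andbT add0r.
Qed.

Lemma annulus_out m j (x : 'rV[R]_n) : ocube m x -> (m < j)%N -> \1_(annulus j) x = 0 :> R.
Proof.
move=> xm; case: j => // j; rewrite ltnS => mj.
by rewrite indicE memNset// => -[_]; apply; exact: (ocubeS mj).
Qed.

End annuli.

(** * Integral representation of functionals bounded on each cube *)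

Section riesz.
Context {R : realType} {n : nat}.
Local Notation mu := (@lebesgue_rV R n).
Variables (q : R) (v : 'rV[R]_n -> R).
Hypothesis q_gt0 : 0 < q.
Hypothesis mv : measurable_fun setT v.
Hypothesis v_ge0 : forall x, 0 <= v x.
Hypothesis lv : loc_ri v.

Definition rbounded_on m (K : R) (f : 'rV[R]_n -> R) :=
  measurable_fun setT f /\ forall x, `|f x| <= K * \1_(ocube m) x.

Lemma rbounded_on_lin m K K' (c : R) f f' : rbounded_on m K f -> rbounded_on m K' f' ->
  rbounded_on m (`|c| * K + K') (fun x => c * f x + f' x).
Proof.
move=> [mf fK] [mf' f'K]; split.
  by apply: measurable_funD => //; exact: measurable_funM.
move=> x; rewrite (le_trans (ler_normD _ _))// mulrDl lerD// normrM -mulrA.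
by rewrite ler_wpM2l.
Qed.

Lemma rbounded_on_indic m A : measurable A -> A `<=` ocube m -> rbounded_on m 1 \1_A.
Proof.
move=> mA Am; split; first exact: measurable_indic.
by move=> x; rewrite mul1r ger0_norm ?indic_ge0//; exact: indic_sub.
Qed.

Variable L : ('rV[R]_n -> R) -> R.
Hypothesis L_lin : forall m K K' c f f', rbounded_on m K f -> rbounded_on m K' f' ->
  L (fun x => c * f x + f' x) = c * L f + L f'.
Hypothesis L_bound : forall m, exists2 C, 0 <= C & forall K f, rbounded_on m K f ->
  `|L f| <= C * (\int[mu]_x (`|f x| `^ q * v x)) `^ q^-1.

Let L0 : L (fun=> 0) = 0.
Proof.
have r0 : rbounded_on 0 0 (fun=> 0) by split => // x; rewrite normr0 mul0r.
have := L_lin (-1) r0 r0; rewrite (_ : (fun _ => _) = fun=> 0) => [->|].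
  by rewrite mulN1r addNr.
by apply/funext => x; rewrite mulr0 addr0.
Qed.

Let L_sum m K (s : seq nat) (f : nat -> 'rV[R]_n -> R) : (forall i, i \in s -> rbounded_on m K (f i)) ->
  (exists K', rbounded_on m K' (fun x => \sum_(i <- s) f i x)) /\
  L (fun x => \sum_(i <- s) f i x) = \sum_(i <- s) L (f i).
Proof.
elim: s => [|i s IH] rf.
  rewrite (_ : (fun _ => _) = fun=> 0) ?big_nil; last by apply/funext => x; rewrite big_nil.
  by split => //; exists 0; split => // x; rewrite normr0 mul0r.
have [|[K' rK'] IH'] := IH; first by move=> j js; apply: rf; rewrite inE js orbT.
have ri_ := rf i (mem_head i s).
have E : (fun x => \sum_(i <- i :: s) f i x) = (fun x => 1 * f i x + \sum_(i <- s) f i x).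
  by apply/funext => x; rewrite big_cons mul1r.
rewrite E big_cons (L_lin 1 ri_ rK') IH' mul1r; split => //.
by exists (`|1| * K + K'); exact: rbounded_on_lin.
Qed.

(** Bounded pointwise convergence on a fixed cube implies convergence in L_q(v), as v is locally
    integrable, and [L_bound] makes L continuous there. *)
Let L_cvg m K (f_ : nat -> 'rV[R]_n -> R) f : (forall k, rbounded_on m K (f_ k)) ->
  (forall x, f_ k x @[k --> \oo] --> f x) ->
  rbounded_on m K f /\ L (f_ k) @[k --> \oo] --> L f.
Proof.
move=> rf ff.
have rbf : rbounded_on m K f.
  split; first by apply: measurable_fun_cvg; [move=> k; exact: (rf k).1|move=> x _; exact: ff].
  by move=> x; apply: cvg_norm_le (ff x) _ => k; exact: (rf k).2.
split => //; have [C C0 LC] := L_bound m.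
pose J k := \int[mu]_x (`|-1 * f_ k x + f x| `^ q * v x).
have [||||_ cvJ] := @rdct _ _ _ mu (fun k x => `|-1 * f_ k x + f x| `^ q * v x) (fun=> 0)
    (fun x => (2 * `|K|) `^ q * (v x * \1_(ocube m) x)).
- by move=> k; apply: (measurable_qint_fun q mv); exact: (rbounded_on_lin (-1) (rf k) rbf).1.
- move=> x; rewrite -(mul0r (v x)); apply: cvgMl; apply: (powR_cvg0_seq q_gt0).
  rewrite -[X in _ --> X](_ : -1 * f x + f x = 0); last by rewrite mulN1r addNr.
  by apply: cvgD; [apply: cvgMr; exact: ff|exact: cvg_cst].
- move=> k x; rewrite ger0_norm; last by rewrite mulr_ge0 ?powR_ge0.
  rewrite mulN1r addrC; apply: qint_fun_dist_le => //; [exact: rbf.2|exact: (rf k).2].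
- by apply: ri_Z; exact: lv.
rewrite Rintegral_cst// mul0r -/J in cvJ.
have J0 k : 0 <= J k by apply: Rintegral_ge0 => x _; rewrite mulr_ge0 ?powR_ge0.
have cv : C * `|J k| `^ q^-1 @[k --> \oo] --> (0 : R).
  by rewrite -(mulr0 C); apply: cvgMr; apply: powR_cvg0_seq => //; rewrite invr_gt0.
apply/cvgrPdist_lt => e e0; move/cvgr0Pnorm_lt : cv => /(_ _ e0); apply: filterS => k.
apply: le_lt_trans; rewrite (ger0_norm (J0 k)) [leRHS]ger0_norm ?mulr_ge0 ?powR_ge0//.
have -> : L f - L (f_ k) = L (fun x => -1 * f_ k x + f x).
  by rewrite (L_lin (-1) (rf k) rbf) mulN1r addrC.
exact: (LC _ _ (rbounded_on_lin (-1) (rf k) rbf)).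
Qed.

(** The set function L(1_E) on the annulus is countably additive by [L_cvg] applied to partial sums,
    and it vanishes on null sets by [L_bound]. *)
Let annulus_density j : exists u, ri mu u /\ forall E, measurable E ->
  L \1_(E `&` annulus j) = \int[mu]_x (u x * \1_(E `&` annulus j) x).
Proof.
have mA := @measurable_annulus R n j.
have sub E : E `&` annulus j `<=` ocube j by move=> x [_]; exact: annulus_sub.
have rE E : measurable E -> rbounded_on j 1 (\1_(E `&` annulus j) : 'rV[R]_n -> R).
  by move=> mE; apply: rbounded_on_indic; [exact: measurableI|exact: sub].
have [|||u [ru uP]] := @radon_nikodym_real _ _ _ mu (fun E => L \1_(E `&` annulus j)).
- by rewrite set0I indic0; exact: L0.
- move=> F mF tF mUF.
  have tF' : trivIset setT (fun k => F k `&` annulus j) by exact: trivIset_setIr.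
  have [||_ cv] := @L_cvg j 1 (fun N x => \sum_(k <- iota 0 N) \1_(F k `&` annulus j) x)
      (\1_((\bigcup_k F k) `&` annulus j)).
  + move=> N; rewrite (_ : (fun x => _) = \1_((\bigcup_(k < N) F k) `&` annulus j)).
      by apply: rE; exact: bigcup_measurable.
    by apply/funext => x; rewrite sum_indic_trivIset// setI_bigcupl.
  + by move=> x; rewrite setI_bigcupl; exact: cvg_sum_indic.
  rewrite (_ : (fun N => _) = EFin \o (fun N => L (fun x => \sum_(k <- iota 0 N) \1_(F k `&` annulus j) x))).
    by apply: cvg_EFin; [exact: nearW|exact: cv].
  apply/funext => N /=; have [_ ->] := @L_sum j 1 (iota 0 N) (fun k => \1_(F k `&` annulus j)) (fun k _ => rE _ (mF k)).
  by rewrite sumEFin /index_iota subn0.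
- move=> A mA' A0; have [C C0 LC] := L_bound j.
  apply/eqP; rewrite -normr_eq0 eq_le normr_ge0 andbT.
  apply: le_trans (LC _ _ (rE A mA')) _.
  rewrite (_ : \int[mu]_x _ = 0); first by rewrite powR0 ?mulr0// gt_eqF// invr_gt0.
  have <- : \int[mu]_x (cst 0 x) = 0 :> R by rewrite Rintegral_cst// mul0r.
  apply: rint_ae.
  + by apply: (measurable_qint_fun q mv); exact: (rE A mA').1.
  + exact: measurable_cst.
  + exists A; split => // x /= xA; apply: contrapT => nA; apply: xA.
    by rewrite indicE memNset ?normr0 ?powR0 ?gt_eqF// ?mul0r// => -[].
exists u; split => // E mE.
by have := uP _ (measurableI _ _ mE mA); rewrite -setIA setIid.
Qed.

(** The densities of the annuli are glued into U, a locally finite sum. The formula holds for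
    indicators by construction and extends by [indic_monotone_class], both sides being continuous
    under bounded limits. *)
Theorem riesz_representation : exists U : 'rV[R]_n -> R, [/\ measurable_fun setT U, loc_ri U &
  forall m K f, rbounded_on m K f -> L f = \int[mu]_x (U x * f x)].
Proof.
pose u j := projT1 (cid (annulus_density j)).
have ru j : ri mu (u j) by rewrite /u; case: cid => ? [].
have uP j E : measurable E -> L \1_(E `&` annulus j) = \int[mu]_x (u j x * \1_(E `&` annulus j) x).
  by rewrite /u; case: cid => ? [] /= _; exact.
have mu_ j : measurable_fun setT (u j) by exact: ri_meas (ru j).
have m1 j : measurable_fun setT (\1_(annulus j) : 'rV[R]_n -> R).
  by apply: measurable_indic; exact: measurable_annulus.
pose U_ N x := \sum_(0 <= j < N) u j x * \1_(annulus j) x.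
(* The annuli 0 to m fill [ocube m], so the partial sums are constant there from index m + 1 on. *)
have U_cst m x N : ocube m x -> (m < N)%N -> U_ N x = U_ m.+1 x.
  move=> xm mN; rewrite /U_ (@big_cat_nat _ _ _ m.+1)//=.
  rewrite [in X in _ + X]big_nat_cond [X in _ + X]big1 ?addr0// => j /andP[/andP[mj _] _].
  by rewrite (annulus_out xm mj) mulr0.
pose U x := limn (U_ ^~ x).
have UE m x : ocube m x -> U x = U_ m.+1 x.
  move=> xm; apply/cvg_lim => //; apply: cvg_near_cst.
  by exists m.+1 => // N /= mN; exact: U_cst mN.
have Ucv x : U_ N x @[N --> \oo] --> U x.
  have [m xm] := mem_ocube x; rewrite (UE m x xm); apply: cvg_near_cst.
  by exists m.+1 => // N /= mN; exact: U_cst mN.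
have mU : measurable_fun setT U.
  apply: (measurable_fun_cvg (h := U_)); last by move=> x _; exact: Ucv.
  by move=> N; apply: measurable_sum => j; exact: measurable_funM.
have ruj j : ri mu (fun x => u j x * \1_(annulus j) x).
  apply: ri_le (ri_norm (ru j)); first exact: measurable_funM.
  move=> x; rewrite normrM (ger0_norm (indic_ge0 _ _)).
  by apply: ler_piMr; [exact: normr_ge0|exact: indic_le1].
have U1 m x : U x * \1_(ocube m) x = U_ m.+1 x.
  rewrite indicE; have [/set_mem xm|/negP xm] := boolP (x \in ocube m).
    by rewrite mulr1; exact: UE.
  rewrite mulr0 /U_ big_nat big1// => j /andP[_]; rewrite ltnS => jm.
  rewrite indicE memNset ?mulr0// => /annulus_sub /(ocubeS jm) xm'.
  by apply: xm; exact: mem_set.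
have lU : loc_ri U.
  move=> m; rewrite (_ : (fun x => _) = U_ m.+1); last by apply/funext => x; exact: U1.
  by have [] := rint_sum (index_iota 0 m.+1) ruj.
exists U; split => // m K f [mf fK].
(* Boundedness belongs to the class because [L_lin] is available for bounded functions on a cube
   only. *)
suff [_ [_ ->]] : [set f | measurable_fun setT f /\ (exists K, rbounded_on m K f) /\
    L f = \int[mu]_x (U x * f x)] f by [].
apply: (@indic_monotone_class _ _ m _ _ _ _ f K mf fK) => {f K mf fK}; last 1 first.
- move=> E mE.
  have rE : rbounded_on m 1 (\1_(E `&` ocube m) : 'rV[R]_n -> R).
    apply: rbounded_on_indic; last by move=> x [].
    by apply: measurableI => //; exact: measurable_ocube.
  split; first exact: rE.1.
  split; first by exists 1.
  have EE : \1_(E `&` ocube m) = (fun x => \sum_(j <- index_iota 0 m.+1) \1_(E `&` annulus j) x) :> (_ -> R).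
    apply/funext => x; rewrite indicE in_setI mulrb.
    transitivity (\1_E x * \1_(ocube m) x : R).
      by rewrite !indicE; case: (x \in E); case: (x \in ocube m); rewrite /= ?mulr1 ?mulr0.
    rewrite -sum_annulus big_distrr/=; apply: eq_bigr => j _.
    by rewrite !indicE in_setI; case: (x \in E); case: (x \in annulus j); rewrite /= ?mulr1 ?mulr0 ?mul0r.
  have mEj j : measurable (E `&` annulus j) by apply: measurableI => //; exact: measurable_annulus.
  have rEj j : ri mu (fun x => u j x * \1_(E `&` annulus j) x).
    apply: ri_le (ri_norm (ru j)).
      by apply: measurable_funM => //; exact: measurable_indic.
    move=> x; rewrite normrM (ger0_norm (indic_ge0 _ _)).
  by apply: ler_piMr; [exact: normr_ge0|exact: indic_le1].
  rewrite {1}EE; have [|_ ->] := @L_sum m 1 (index_iota 0 m.+1) (fun j => \1_(E `&` annulus j)).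
    move=> j; rewrite mem_index_iota => /andP[_]; rewrite ltnS => jm.
    by apply: rbounded_on_indic => // x [_ /annulus_sub]; exact: (ocubeS jm).
  rewrite (eq_bigr _ (fun j _ => uP j E mE)) -(rint_sum _ rEj).2.
  apply: eq_Rintegral => x _.
  transitivity (U x * \1_(ocube m) x * \1_E x); last first.
    rewrite -mulrA; congr (_ * _); rewrite !indicE in_setI.
    by case: (x \in E); case: (x \in ocube m); rewrite /= ?mulr1 ?mulr0.
  rewrite U1 /U_ big_distrl/=; apply: eq_bigr => j _; rewrite -mulrA; congr (_ * _).
  by rewrite !indicE in_setI; case: (x \in E); case: (x \in annulus j); rewrite /= ?mulr1 ?mulr0.
- move=> c f f' [mf [[K rf] Lf]] [mf' [[K' rf'] Lf']].
  have rl := rbounded_on_lin c rf rf'.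
  split; first exact: rl.1.
  split; first by exists (`|c| * K + K').
  rewrite (L_lin c rf rf') Lf Lf' -rint_lin; first by apply: eq_Rintegral => x _; ring.
    exact: (loc_ri_bounded lU mU rf.1 rf.2).
  exact: (loc_ri_bounded lU mU rf'.1 rf'.2).
- move=> f_ f K Hf mf_ fK ff.
  have rf k : rbounded_on m K (f_ k) by split.
  have [rbf cv] := L_cvg rf ff.
  split; first exact: rbf.1.
  split; first by exists K.
  have [_ cvI] := loc_ri_dct mU lU mf_ fK ff.
  rewrite -(cvg_lim _ cv)// -(cvg_lim _ cvI)//; congr (lim (_ @ \oo)).
  by apply/funext => k; have [_ [_ ->]] := Hf k.
Qed.

End riesz.

Lemma integral_nondecreasing_le d (T : measurableType d) (R : realType)
    (mu : {measure set T -> \bar R}) (h_ : nat -> T -> R) (h : T -> R) (c : R) :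
  (forall N, measurable_fun setT (h_ N)) -> (forall N x, 0 <= h_ N x) ->
  (forall x N N', (N <= N')%N -> h_ N x <= h_ N' x) ->
  (forall x, h_ N x @[N --> \oo] --> h x) ->
  (forall N, (\int[mu]_x (h_ N x)%:E <= c%:E)%E) -> (\int[mu]_x (h x)%:E <= c%:E)%E.
Proof.
move=> mh h0 nd cv hc.
have cve x : (h_ N x)%:E @[N --> \oo] --> (h x)%:E.
  by apply: cvg_EFin; [exact: nearW|exact: cv].
have mg N : measurable_fun setT (fun x => (h_ N x)%:E) by exact/measurable_EFinP.
have g0 N x : [set: T] x -> (0 <= (h_ N x)%:E)%E by move=> _; rewrite lee_fin.
have ndg x : [set: T] x -> {homo (fun N => (h_ N x)%:E) : N N' / (N <= N')%N >-> (N <= N')%E}.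
  by move=> _ N N' NN'; rewrite lee_fin; exact: nd.
have := @cvg_monotone_convergence _ _ _ mu setT measurableT _ mg g0 ndg.
have -> : (\int[mu]_x (limn (fun N => (h_ N x)%:E)) = \int[mu]_x (h x)%:E)%E.
  by apply: eq_integral => x _; apply: cvg_lim => //; exact: cve.
move=> cvI; rewrite -(cvg_lim _ cvI)//; apply: lime_le; first exact: cvgP cvI.
exact: nearW.
Qed.

Section dual_estimate.
Context {R : realType} {n : nat}.
Local Notation mu := (@lebesgue_rV R n).
Variables (p : R) (w : 'rV[R]_n -> R).
Hypothesis p_gt1 : 1 < p.
Hypothesis ww : is_weight p w.
Local Notation q := (conjugate p).
Local Notation v := (dual_weight p w).

Let p0 : 0 < p. Proof. exact: p_gt0. Qed.
Let q0 : 0 < q. Proof. exact: q_gt0. Qed.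
Let w0 := weight_gt0 ww.
Let mw := weight_measurable ww.

Let pq : q^-1 + p^-1 = 1. Proof. exact: conjugate_sum. Qed.

Let p1q : (p - 1) * q = p.
Proof. by rewrite /conjugate mulrC divfK// gt_eqF// subr_gt0. Qed.

(** By (p - 1) q = p and 1 - 1/p = 1/q. For phi = |U|^(p - 1) w sgn U it says that |phi|^q v = |U|^p
    w, which is also U phi: the equality case of Hoelder's inequality. *)
Lemma extremal_power (y t : R) : 0 <= y -> 0 < t ->
  (y `^ (p - 1) * t) `^ q * (t `^ (- p^-1)) `^ q = y `^ p * t.
Proof.
move=> y0 t0; rewrite powRM ?powR_ge0 ?(ltW t0)// -powRrM p1q -mulrA; congr (_ * _).
rewrite -powRM ?powR_ge0 ?(ltW t0)// -{1}[t]powRr1 ?(ltW t0)// -powRD; last first.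
  by apply/implyP => _; rewrite gt_eqF.
by rewrite -powRrM (_ : 1 - p^-1 = q^-1) ?mulVf ?gt_eqF// ?powRr1 ?(ltW t0)// -pq; ring.
Qed.

(** The converse of Hoelder's inequality on one cube. Truncating both U and w at height N makes the
    integral I of |U|^p w finite and the extremal function bounded; the normalised test then gives
    I^(1/p) <= D a, and N tends to infinity by monotone convergence. *)
Lemma dual_estimate (U : 'rV[R]_n -> R) k (a D : R) : measurable_fun setT U -> 0 < a -> 0 <= D ->
  (forall m K f, rbounded_on m K f -> (forall x, ~ dcube k x -> f x = 0) ->
    a * (\int[mu]_x (`|f x| `^ q * v x)) `^ q^-1 <= 1 -> `|\int[mu]_x (U x * f x)| <= D) ->
  (\int[mu]_x (`|U x| `^ p * w x * \1_(dcube k) x)%:E <= ((D * a) `^ p)%:E)%E.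
Proof.
move=> mU a0 D0 UD; have [m km] := dcube_ocube (R := R) k.
pose E (N : nat) := dcube k `&` [set x | `|U x| <= N%:R] `&` [set x | w x <= N%:R].
have mE N : measurable (E N).
  apply: measurableI; first apply: measurableI; first exact: measurable_dcube.
    by apply: measurable_sublevel; exact: measurableT_comp.
  exact: measurable_sublevel.
have mEi N : measurable_fun setT (\1_(E N) : 'rV[R]_n -> R) by exact: measurable_indic.
have mUp e : measurable_fun setT (fun x => `|U x| `^ e).
  by apply: measurable_powR_fun; exact: measurableT_comp.
have [sg [msg sgE sg1]] := measurable_sign mU.
pose h N x := `|U x| `^ p * w x * \1_(E N) x.
(* [phi N] is the extremal function of Hoelder's inequality, truncated so as to
   be bounded. *)
pose phi N x := sg x * (`|U x| `^ (p - 1) * w x) * \1_(E N) x.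
have h0 N x : 0 <= h N x.
  by rewrite mulr_ge0 ?indic_ge0// mulr_ge0 ?powR_ge0// ltW.
have mh N : measurable_fun setT (h N) by do 2!apply: measurable_funM => //.
have mphi N : measurable_fun setT (phi N) by do 2!apply: measurable_funM => //; exact: measurable_funM.
have phi_norm N x : `|phi N x| = `|U x| `^ (p - 1) * w x * \1_(E N) x.
  by rewrite !normrM sg1 mul1r (ger0_norm (indic_ge0 _ _)) (ger0_norm (powR_ge0 _ _)) (ger0_norm (ltW (w0 x))).
have phi_U N x : U x * phi N x = h N x.
  by rewrite /phi !mulrA sgE mulr_powRB1.
have phi_q N x : `|phi N x| `^ q * v x = h N x.
  rewrite phi_norm /h /dual_weight indicE; case: (_ \in _); rewrite ?mulr1 ?mulr0.
    exact: extremal_power.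
  by rewrite powR0 ?gt_eqF// mul0r.
have p10 : 0 <= p - 1 by rewrite subr_ge0 ltW.
have rphi N : rbounded_on m (N%:R `^ (p - 1) * N%:R) (phi N).
  split => // x; rewrite phi_norm indicE.
  have [/set_mem[[kx UN] wN]|_] := boolP (x \in E N); last first.
    by rewrite mulr0 mulr_ge0 ?indic_ge0// mulr_ge0 ?powR_ge0.
  rewrite indicE mem_set ?mulr1; last exact: km.
  apply: ler_pM; [exact: powR_ge0|exact: ltW| |exact: wN].
  by apply: ge0_ler_powR; rewrite ?nnegrE.
have rh N : ri mu (h N).
  rewrite -(funext (phi_q N)).
  apply: (ri_qint_bounded q0 (measurable_dual_weight ww) _ (dual_weight_loc ww) (rphi N).1 (rphi N).2).
  by move=> x; exact: powR_ge0.
have bound N : \int[mu]_x h N x <= (D * a) `^ p.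
  pose I := \int[mu]_x h N x; rewrite -/I.
  have I0 : 0 <= I by apply: Rintegral_ge0 => x _; exact: h0.
  (* The case I = 0 is set apart because I^(1/q) is inverted below. *)
  have [I1|I1] := ltP 0 I; last by apply: le_trans I1 (powR_ge0 _ _).
  have Iq : 0 < I `^ q^-1 by exact: powR_gt0.
  (* This factor gives t * phi N the norm 1 allowed by [UD], as the integral of |phi N|^q v is I. *)
  pose t := (a * I `^ q^-1)^-1.
  have t0 : 0 < t by rewrite invr_gt0 mulr_gt0.
  pose f x := t * phi N x.
  have rf : rbounded_on m (t * (N%:R `^ (p - 1) * N%:R)) f.
    split; first by apply: measurable_funM => //.
    by move=> x; rewrite normrM (gtr0_norm t0) -mulrA ler_pM2l//; exact: (rphi N).2.
  have Ef : \int[mu]_x (`|f x| `^ q * v x) = t `^ q * I.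
    rewrite -RintegralZl//; last exact: rh.
    apply: eq_Rintegral => x _; rewrite normrM (gtr0_norm t0) powRM ?(ltW t0)//.
    by rewrite -mulrA phi_q.
  have EU : \int[mu]_x (U x * f x) = t * I.
    rewrite -RintegralZl//; last exact: rh.
    by apply: eq_Rintegral => x _; rewrite mulrCA phi_U.
  have := UD _ _ _ rf; rewrite Ef EU => tID.
  have {}tID : `|t * I| <= D.
    apply: tID.
      move=> x xk; rewrite /f /phi indicE memNset ?mulr0// => -[[]].
      by move=> /xk.
    rewrite powRM ?powR_ge0// -powRrM mulfV ?gt_eqF// powRr1 ?(ltW t0)//.
    by rewrite mulrCA /t mulVf// gt_eqF// mulr_gt0.
  rewrite ger0_norm in tID; last by rewrite mulr_ge0// ltW.
  have IE : I = I `^ q^-1 * I `^ p^-1.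
    rewrite -powRD; last by rewrite pq oner_eq0.
    by rewrite pq powRr1.
  have tIE : t * I = a^-1 * I `^ p^-1.
    rewrite {1}IE /t; field; rewrite !gt_eqF//.
  have Ip : I `^ p^-1 <= D * a by rewrite -ler_pdivrMr// mulrC -tIE.
  have : (I `^ p^-1) `^ p <= (D * a) `^ p.
    by apply: ge0_ler_powR; rewrite ?nnegrE ?(ltW p0) ?powR_ge0 ?mulr_ge0// ltW.
  by rewrite -powRrM mulVf ?gt_eqF// powRr1.
apply: (@integral_nondecreasing_le _ _ _ mu h) => //.
- move=> x N N' NN'; apply: ler_wpM2l; first by rewrite mulr_ge0 ?powR_ge0// ltW.
  apply: indic_sub => y [[ky UN] wN]; have NN : N%:R <= N'%:R :> R by rewrite ler_nat.
  by split; [split => //; exact: le_trans NN|exact: le_trans NN].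
- move=> x; apply: cvg_near_cst.
  exists (maxn (Num.trunc `|U x|).+1 (Num.trunc (w x)).+1) => // N /= NN; rewrite /h; congr (_ * _).
  rewrite !indicE; congr (_%:R); congr nat_of_bool.
  apply/idP/idP => [/set_mem[[kx _] _]|/set_mem kx]; first exact: mem_set.
  apply: mem_set; split; first split => //=.
    apply: ltW; apply: lt_le_trans (truncnS_gt _) _; rewrite ler_nat.
    by apply: leq_trans NN; exact: leq_maxl.
  apply: ltW; apply: lt_le_trans (truncnS_gt _) _; rewrite ler_nat.
  by apply: leq_trans NN; exact: leq_maxr.
- by move=> N; rewrite (ri_EFin (rh N)) lee_fin.
Qed.

End dual_estimate.

Section loc_integrable.
Context {R : realType} {n : nat}.
Local Notation mu := (@lebesgue_rV R n).
Implicit Types (u : 'rV[R]_n -> R).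

Lemma compact_dcube k : compact (dcube k : set 'rV[R]_n).
Proof. by rewrite dcubeE; exact: compact_box. Qed.

Lemma loc_integrable_ri u : loc_integrable u -> loc_ri u.
Proof.
move=> [mu_ lu] m.
have := lu _ (@compact_dcube (bigcube m)).
move=> /(integrable_mkcond _ (measurable_dcube _)) ri1.
apply: (@ri_le _ _ _ _ _ (fun x => `|u x * \1_(dcube (bigcube m)) x|)).
- by apply: measurable_funM => //; exact: measurable_indic_ocube.
- move=> x; rewrite !normrM ler_wpM2l// !ger0_norm ?indic_ge0//.
  exact: indic_sub (@ocube_bigcube _ _ m).
- apply: ri_norm; rewrite /ri; move: ri1; congr integrable.
  by apply/funext => x; rewrite (epatch_indic (EFin \o u)).
Qed.

Lemma ri_loc_integrable u : measurable_fun setT u -> loc_ri u -> loc_integrable u.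
Proof.
move=> mu_ lu; split => // K cK.
have [m Km] := compact_ocube cK.
have mK := compact_measurable_rV cK.
apply/(integrable_mkcond _ mK).
have : ri mu (fun x => u x * \1_K x).
  apply: (@ri_le _ _ _ _ _ (fun x => `|u x * \1_(ocube m) x|)).
  - by apply: measurable_funM => //; exact: measurable_indic.
  - move=> x; rewrite !normrM ler_wpM2l// !ger0_norm ?indic_ge0//.
    exact: indic_sub.
  - by apply: ri_norm; exact: lu.
rewrite /ri; congr integrable.
by apply/funext => x; rewrite (epatch_indic (EFin \o u)).
Qed.

End loc_integrable.

Section ae_invariance.
Context {R : realType} {n : nat}.
Local Notation mu := (@lebesgue_rV R n).
Implicit Types (w : 'rV[R]_n -> R) (f : 'rV[R]_n -> R[i]).

Lemma wmeas_ae w w' k : measurable_fun setT w -> measurable_fun setT w' ->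
  {ae mu, forall x, w x = w' x} -> wmeas w (dcube k) = wmeas w' (dcube k).
Proof.
move=> mw mw' ww'; apply: ae_eq_integral; [exact: measurable_dcube| | |].
- by apply/measurable_EFinP; exact: measurable_funTS.
- by apply/measurable_EFinP; exact: measurable_funTS.
- by apply: filterS ww' => x -> _.
Qed.

(** Serves twice: to replace the weight by one positive everywhere, and to compare two functions
    that represent the same functional. *)
Lemma morrey_norm_ae (p r : R) w w' f f' : measurable_fun setT w -> measurable_fun setT w' ->
  measurable_cfun f -> measurable_cfun f' -> {ae mu, forall x, w x = w' x} ->
  {ae mu, forall x, f x = f' x} -> morrey_norm p r w f = morrey_norm p r w' f'.
Proof.
move=> mw mw' mf mf' ww' ff'.
have mterm u g k : measurable_fun setT u -> measurable_cfun g ->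
    measurable_fun (dcube k) (fun x => (cabs (g x) `^ p * u x)%:E).
  move=> mu_ mg; apply/measurable_EFinP; apply: measurable_funTS; apply: measurable_funM => //.
  by apply: measurable_powR_fun; exact: measurable_cfun_cabs.
have I k : wLp_norm p w (dcube k) f = wLp_norm p w' (dcube k) f'.
  rewrite /wLp_norm; congr (_ `^ _)%E.
  apply: ae_eq_integral; [exact: measurable_dcube|exact: mterm|exact: mterm|].
  by apply: filterS2 ww' ff' => x -> -> _.
have E k : (wmeas w (dcube k) `^ (- (p^-1 + r / n%:R)) * wLp_norm p w (dcube k) f =
    wmeas w' (dcube k) `^ (- (p^-1 + r / n%:R)) * wLp_norm p w' (dcube k) f')%E.
  by rewrite (wmeas_ae k mw mw' ww') I.
exact: (congr1 (fun F => ereal_sup (range F)) (funext E)).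
Qed.

End ae_invariance.

(** * Duality for weights positive everywhere *)

Section weighted_duality.
Context {R : realType} {n : nat}.
Local Notation mu := (@lebesgue_rV R n).
Local Notation cube_index := (int * 'rV[int]_n)%type.
Implicit Types (k : cube_index) (f g : 'rV[R]_n -> R[i]).
Variables (p r rho : R) (w : 'rV[R]_n -> R).
Hypothesis n_gt0 : (0 < n)%N.
Hypothesis p_gt1 : 1 < p.
Hypothesis r_gt : - (n%:R / p) < r.
Hypothesis r_lt0 : r < 0.
Hypothesis rrho : r + rho = - n%:R.
Hypothesis ww : is_weight p w.
Local Notation q := (conjugate p).
Local Notation s := (p^-1 + r / n%:R).
Local Notation rcost := (atom_cost p s w).
Local Notation cost := (fun k f => atom_cost p s w k (fun x => cabs (f x))).
Local Notation mterm := (morrey_term p s w).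
Local Notation v := (dual_weight p w).
Local Notation qi := (qint q v).
Local Notation X := (@HL R n q rho w).
Local Notation NX := (@HL_norm R n q rho w).

Let q0 : 0 < q. Proof. exact: q_gt0. Qed.
Let q1 : 1 <= q. Proof. by rewrite /conjugate ler_pdivlMr ?subr_gt0// mul1r gerBl. Qed.
Let mv : measurable_fun setT v. Proof. exact: (measurable_dual_weight ww). Qed.
Let v0 x : 0 <= v x. Proof. exact/ltW/(dual_weight_gt0 ww). Qed.
Let lv : loc_ri v. Proof. exact: dual_weight_loc ww. Qed.

Let n0 : 0 < n%:R :> R. Proof. by rewrite ltr0n. Qed.

Lemma s_gt0 : 0 < s.
Proof.
have : - n%:R / p / n%:R < r / n%:R by rewrite ltr_pM2r ?invr_gt0// mulNr.
rewrite mulrAC mulNr divff ?gt_eqF// mulN1r; lra.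
Qed.

Lemma s_lt : s < p^-1.
Proof. by rewrite gtrDl pmulr_llt0 ?invr_gt0. Qed.

(** The relation r + rho = -n makes the exponent of w(Q) for atoms opposite to the one in the Morrey
    norm. *)
Lemma cost_exponent : - (q^-1 + rho / n%:R) = s.
Proof.
have -> : rho = - n%:R - r by rewrite -rrho; ring.
have -> : q^-1 = 1 - p^-1 by rewrite -(conjugate_sum p_gt1); ring.
by field; rewrite !gt_eqF// (lt_trans ltr01).
Qed.

Lemma cost_ge0 k f : (0 <= rcost k (fun x => cabs (f x)))%E.
Proof. by rewrite mule_ge0 ?poweR_ge0// lee_fin powR_ge0. Qed.

Lemma mterm_ge0 k (f : 'rV[R]_n -> R) : (0 <= mterm k f)%E.
Proof. by rewrite mule_ge0 ?poweR_ge0// lee_fin powR_ge0. Qed.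

Lemma HL_costE a : HL_cost q rho w a = (\esum_(k in setT) rcost k (fun x => cabs (a k x)))%E.
Proof.
apply: eq_esum => k _; rewrite /atom_cost (wmeas_dcube ww) cost_exponent poweR_EFin.
congr (_ * _ `^ _)%E; apply: eq_integral => x _.
rewrite (conjugateK p_gt1) cabsM cabs_toC ger0_norm ?powR_ge0// mulr1.
by rewrite powRM ?powR_ge0 ?cabs_ge0// ger0_norm ?cabs_ge0// mulrC.
Qed.

Lemma morrey_normE f : morrey_norm p r w f = ereal_sup (range (fun k => mterm k (fun x => cabs (f x)))).
Proof.
congr ereal_sup; apply/seteqP.
have E k : ((wmeas w (dcube k) `^ (- (p^-1 + r / n%:R)) * wLp_norm p w (dcube k) f)%E =
    mterm k (fun x => cabs (f x)))%E.
  have I : (\int[mu]_x (cabs (f x) `^ p * w x * \1_(dcube k) x)%:E =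
      \int[mu]_x (`|cabs (f x)| `^ p * w x * \1_(dcube k) x)%:E)%E.
    by apply: eq_integral => x _; rewrite (ger0_norm (cabs_ge0 _)).
  by rewrite (wmeas_dcube ww) poweR_EFin /wLp_norm integral_indic_dcube I.
by split => _ [k _ <-]; exists k.
Qed.

Lemma morrey_term_le k f : (mterm k (fun x => cabs (f x)) <= morrey_norm p r w f)%E.
Proof. by rewrite morrey_normE; apply: ereal_sup_ubound; exists k. Qed.

Lemma schwartz_bump (a b : 'I_n -> R) j : toC (bump a b j) \in @schwartz_pred R n.
Proof. by apply/asboolP; apply: schwartz_bump_rV; rewrite invr_gt0 ltr0n. Qed.

Definition bump_schwartz (a b : 'I_n -> R) j : schwartz_space R n := SchwartzFun (schwartz_bump a b j).

(** Only bumps are tested: having bounded support, they pair with any locally integrable A, and they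
    already determine A almost everywhere. *)
Definition has_density (h : schwartz_space R n -> R[i]) (A : 'rV[R]_n -> R[i]) :=
  [/\ measurable_cfun A, loc_cri A &
      forall a b j, h (bump_schwartz a b j) = cintegral (fun x => A x * toC (bump a b j) x)].

Lemma has_density_unique h A A' : has_density h A -> has_density h A' ->
  {ae mu, forall x, A x = A' x}.
Proof.
move=> [mA lA hA] [mA' lA' hA']; apply: cae_eq_of_bump => // a b j.
by rewrite -hA hA'.
Qed.

(** Hoelder's inequality on each cube, summed over the atoms, bounds the total pairing with g by C
    M. For g the indicator of a cube this shows that the atoms sum locally in L_1; for g a Morrey
    function it is the required estimate. *)
Theorem representation_density h a C : HL_representation h a ->
  (HL_cost q rho w a <= C%:E)%E ->
  exists A, has_density h A /\
    forall g M, measurable_cfun g -> (forall k, mterm k (fun x => cabs (g x)) <= M%:E)%E ->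
      cri (fun x => A x * g x) /\ cabs (cintegral (fun x => A x * g x)) <= 2 * (C * M).
Proof.
move=> [ma sa ha] aC; rewrite HL_costE in aC.
pose b j : 'rV[R]_n -> R[i] := if choice.pickle_inv j is Some k then a k else fun=> 0.
have mb j : measurable_cfun (b j).
  by rewrite /b; case: choice.pickle_inv => [k//|]; exact: measurable_cfun_cst.
have sb (g : 'rV[R]_n -> R) M : measurable_fun setT g -> (forall x, 0 <= g x) ->
    (forall k, mterm k g <= M%:E)%E -> summable_against b g (C * M).
  move=> mg g0 gM N.
  have E : (\sum_(0 <= j < N) \int[mu]_x (cabs (b j x) * g x)%:E =
      \sum_(k <- enum_upto N) \int[mu]_x (cabs (a k x) * g x)%:E)%E.
    rewrite sum_enum_upto; apply: eq_bigr => j _; rewrite /b; case: choice.pickle_inv => // .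
    by apply: integral0_eq => x _; rewrite cabs0 mul0r.
  rewrite E.
  have M0 : (0 <= M%:E)%E := le_trans (mterm_ge0 (0, 0) g) (gM (0, 0)).
  apply: (@le_trans _ _ (\sum_(k <- enum_upto N) rcost k (fun x => cabs (a k x)) * M%:E)%E).
    apply: lee_sum => k _.
    apply: (@le_trans _ _ (rcost k (fun x => cabs (a k x)) * mterm k g)%E); last first.
      by apply: lee_wpmul2l => //; exact: cost_ge0.
    have ak0 : {ae mu, forall x, ~ dcube k x -> cabs (a k x) = 0}.
      have /(ess_support_subP _ (@closed_dcube R n k)) := sa k.
      by apply: filterS => x ax xk; rewrite ax// cabs0.
    have := pair_bound s p_gt1 ww (measurable_cfun_cabs (ma k)) mg ak0.
    apply: le_trans; rewrite le_eqVlt; apply/orP; left; apply/eqP.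
    by apply: eq_integral => x _; rewrite (ger0_norm (cabs_ge0 _)) (ger0_norm (g0 _)).
  rewrite -ge0_sume_distrl; last by move=> k _; exact: cost_ge0.
  rewrite EFinM; apply: lee_wpmul2r => //.
  apply: le_trans aC; apply: sum_enum_upto_esum => k; exact: cost_ge0.
(* Indicators of cubes have bounded Morrey terms. *)
have bloc m : exists B, summable_against b \1_(ocube m) B.
  have m1 := @measurable_indic_ocube R n m.
  exists (C * (`|1| * wocube w m `^ (p^-1 - s))); apply: sb => [//|x|]; first exact: indic_ge0.
  apply: (morrey_term_bounded p_gt1 ww s_gt0 s_lt) => // x.
  by rewrite mul1r ger0_norm// indic_ge0.
have mA := measurable_series_sum mb.
exists (series_sum b); split; last first.
  move=> g M mg gM.
  have := sb _ _ (measurable_cfun_cabs mg) (fun x => cabs_ge0 _) gM.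
  by move=> /(series_sumP mb bloc mg)[].
split => //; first exact: loc_cri_series_sum.
move=> a0 b0 j; set phi := bump_schwartz a0 b0 j.
have mphi : measurable_cfun (toC (bump a0 b0 j)) by apply: measurable_toC; exact: measurable_bump.
have [m phim] := bump_bounded a0 b0 j.
have gM k : (mterm k (fun x => cabs (toC (bump a0 b0 j) x)) <= (`|1| * wocube w m `^ (p^-1 - s))%:E)%E.
  apply: (morrey_term_bounded p_gt1 ww s_gt0 s_lt); first exact: measurable_cfun_cabs.
  by move=> x; rewrite cabs_toC normr_id.
have := sb _ _ (measurable_cfun_cabs mphi) (fun x => cabs_ge0 _) gM.
move=> /(series_sumP mb bloc mphi)[_ _ Rcv Icv].
(* The same sequence of partial sums tends to the value of h on the bump, by the representation, and
   to the integral against the sum of the atoms, by [series_sumP]; the limits agree. *)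
have [Rcv' Icv'] := unordered_sum_cvg (ha phi).
have E (re : R[i] -> R) : re 0 = 0 ->
    (fun N => \sum_(0 <= j0 < N) re (cintegral (fun x => b j0 x * toC (bump a0 b0 j) x))) =
    (fun N => \sum_(k <- enum_upto N) re (cintegral (fun x => a k x * phi x))).
  move=> re0; apply/funext => N; rewrite sum_enum_upto; apply: eq_bigr => j0 _; rewrite /b.
  case: choice.pickle_inv => [k//|].
  rewrite (_ : (fun x => _) = (fun=> 0)) ?cintegral0//.
  by apply/funext => x; rewrite mul0r.
rewrite (E (@complex.Re R))// in Rcv; rewrite (E (@complex.Im R))// in Icv.
apply/eqP; rewrite eq_complex; apply/andP; split; apply/eqP.
  by rewrite -(cvg_lim _ Rcv)// -(cvg_lim _ Rcv').
by rewrite -(cvg_lim _ Icv)// -(cvg_lim _ Icv').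
Qed.

Let qi_le := @qint_le R n q v q0 mv v0.

Lemma qint_bounded m (K : R) (f : 'rV[R]_n -> R) : measurable_fun setT f ->
  (forall x, `|f x| <= K * \1_(ocube m) x) -> (qi f < +oo)%E.
Proof.
by move=> mf fK; rewrite /qint (ri_EFin (ri_qint_bounded q0 mv v0 lv mf fK)) ltry.
Qed.

(** Since w(Q) is positive and finite, finiteness of the cost does not depend on the cube, so atoms
    can be moved to a larger one. *)
Lemma cost_lty k f : (qi (fun x => cabs (f x)) < +oo)%E <-> (cost k f < +oo)%E.
Proof.
have Ws : 0 < wcube w k `^ s by apply: powR_gt0; exact: (wcube_gt0 ww).
split=> [fq|]; first by rewrite lte_mul_pinfty ?lee_fin ?powR_ge0// poweR_lty.
rewrite /atom_cost => h; apply: (@lty_poweRy _ _ q^-1); first by rewrite gt_eqF// invr_gt0.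
move: (poweR_ge0 (qi (fun x => cabs (f x))) q^-1) h.
case: (qi (fun x => cabs (f x)) `^ q^-1)%E => [y| |]//= _; first by move=> _; exact: ltry.
by rewrite mulry gtr0_sg// mul1e.
Qed.

Lemma cost_le k f g : measurable_cfun f -> measurable_cfun g ->
  (forall x, cabs (f x) <= cabs (g x)) -> (cost k f <= cost k g)%E.
Proof.
move=> mf mg fg; apply: lee_wpmul2l; first by rewrite lee_fin powR_ge0.
apply: ge0_le_poweR; [by rewrite invr_ge0 ltW|exact: qint_ge0|].
apply: qi_le; [exact: measurable_cfun_cabs|exact: measurable_cfun_cabs|].
by move=> x; rewrite !ger0_norm ?cabs_ge0.
Qed.

(** Minkowski's inequality in L_q for the functions multiplied by w^(-1/p). *)
Lemma costD k f g : measurable_cfun f -> measurable_cfun g ->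
  (cost k (fun x => f x + g x)%R <= cost k f + cost k g)%E.
Proof.
move=> mf mg.
pose u x := w x `^ (- p^-1).
have mu_ : measurable_fun setT u by apply: measurable_powR_fun; exact: weight_measurable ww.
have cE (h : 'rV[R]_n -> R) : (qi h `^ q^-1 = 'N[mu]_q%:E[EFin \o (fun x => h x * u x)%R])%E.
  rewrite Lnorm.unlock; congr (_ `^ _)%E; apply: eq_integral => x _ /=.
  by rewrite normrM powRM// (ger0_norm (powR_ge0 _ _)).
pose F x := cabs (f x) * u x; pose H x := cabs (g x) * u x.
have mF : measurable_fun setT F by apply: measurable_funM => //; exact: measurable_cfun_cabs.
have mH : measurable_fun setT H by apply: measurable_funM => //; exact: measurable_cfun_cabs.
have := @minkowski _ _ _ mu F H q mF mH q1; rewrite -!cE => mink.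
rewrite /atom_cost -muleDr; last 2 first.
- by [].
- by rewrite ge0_adde_def// inE poweR_ge0.
apply: lee_wpmul2l; first by rewrite lee_fin powR_ge0.
apply: le_trans mink.
rewrite (_ : (F \+ H) = (fun x => (cabs (f x) + cabs (g x)) * u x)); last first.
  by apply/funext => x; rewrite /F /H mulrDl.
rewrite -cE; apply: ge0_le_poweR; [by rewrite invr_ge0 ltW|exact: qint_ge0|].
apply: qi_le.
- by apply: measurable_cfun_cabs; exact: measurable_cfunD.
- by apply: measurable_funD; exact: measurable_cfun_cabs.
- by move=> x; rewrite !ger0_norm ?addr_ge0 ?cabs_ge0// cabsD.
Qed.

Lemma cost0 k : cost k (fun=> 0) = 0%E.
Proof.
rewrite /atom_cost /qint integral0_eq; last first.
  by move=> x _; rewrite cabs0 normr0 powR0 ?gt_eqF// mul0r.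
by rewrite poweR0r ?mule0// gt_eqF// invr_gt0.
Qed.

(** As f vanishes almost everywhere off its cube, g may be cut off to a bounded set; it then has a
    finite Morrey term, and [pair_bound] applies. *)
Lemma atom_cri k f g (B : R) : measurable_cfun f -> ess_support f `<=` dcube k ->
  (cost k f < +oo)%E -> measurable_cfun g -> (forall x, cabs (g x) <= B) ->
  cri (fun x => f x * g x).
Proof.
move=> mf /(ess_support_subP _ (@closed_dcube R n k)) f0 fc mg gB.
have [m km] := dcube_ocube (R := R) k.
have m1 : measurable_cfun (toC (\1_(ocube m) : 'rV[R]_n -> R)).
  exact: measurable_toC (measurable_indic_ocube m).
pose g1 x := g x * toC \1_(ocube m) x.
have mg1 : measurable_cfun g1 by exact: measurable_cfunM.
have g1B x : cabs (g1 x) <= B * \1_(ocube m) x.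
  by rewrite cabsM cabs_toC ger0_norm ?indic_ge0// ler_wpM2r ?indic_ge0.
suff : cri (fun x => f x * g1 x).
  apply: cri_ae; first exact: measurable_cfunM.
  apply: filterS f0 => x fx; have [xm|xm] := pselect (dcube k x); last by rewrite fx// !mul0r.
  rewrite /g1 /toC indicE mem_set; last exact: km.
  by rewrite (_ : 1%:R%:C%C = 1)// mulr1.
apply: (@cri_le _ _ _ (fun x => cabs (f x) * cabs (g1 x))); first exact: measurable_cfunM.
  by move=> x; rewrite cabsM.
have mcf := measurable_cfun_cabs mf; have mcg := measurable_cfun_cabs mg1.
apply: ri_ge0; [exact: measurable_funM|by move=> x; rewrite mulr_ge0 ?cabs_ge0|].
have s0 := s_gt0; have sp := s_lt.
have g1K x : `|cabs (g1 x)| <= B * \1_(ocube m) x by rewrite ger0_norm ?cabs_ge0.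
have M := morrey_term_bounded p_gt1 ww s0 sp mcg g1K k.
have f0' : {ae mu, forall x, ~ dcube k x -> cabs (f x) = 0}.
  by apply: filterS f0 => x fx xk; rewrite fx// cabs0.
have E : (\int[mu]_x (`|cabs (f x)| * `|cabs (g1 x)|)%:E =
    \int[mu]_x (cabs (f x) * cabs (g1 x))%:E)%E.
  by apply: eq_integral => x _; rewrite !(ger0_norm (cabs_ge0 _)).
have := pair_bound s p_gt1 ww mcf mcg f0'; rewrite E.
move=> /le_lt_trans; apply; apply: (@le_lt_trans _ _ (cost k f *
    (`|B| * wocube w m `^ (p^-1 - s))%:E)%E).
  by apply: lee_wpmul2l => //; exact: cost_ge0.
rewrite muleC lte_mul_pinfty// ?lee_fin ?mulr_ge0 ?powR_ge0//.
Qed.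

Definition single_atom k f (j : cube_index) : 'rV[R]_n -> R[i] := if j == k then f else fun=> 0.

Lemma single_atom_measurable k f j : measurable_cfun f -> measurable_cfun (single_atom k f j).
Proof. by rewrite /single_atom; case: eqP => // *; exact: measurable_cfun_cst. Qed.

Lemma single_atom_support k f j : {ae mu, forall x, ~ dcube k x -> f x = 0} ->
  {ae mu, forall x, ~ dcube j x -> single_atom k f j x = 0}.
Proof. by rewrite /single_atom; case: eqP => [->//|_ _]; apply: aeW. Qed.

Lemma single_atom_cost k f : (\esum_(j in setT) cost j (single_atom k f j))%E = cost k f.
Proof.
rewrite (esumID [set k]); last by move=> *; exact: cost_ge0.
rewrite !setTI esum_set1; last exact: cost_ge0.
rewrite esum1 ?adde0; first by rewrite /single_atom eqxx.
by move=> j /= /eqP jk; rewrite /single_atom (negbTE jk) cost0.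
Qed.

Lemma hreg_representation m K k f : bounded_on m K f -> {ae mu, forall x, ~ dcube k x -> f x = 0} ->
  HL_representation (hreg f) (single_atom k f).
Proof.
move=> bf f0; split.
- by move=> j; apply: single_atom_measurable; exact: bf.1.
- move=> j; apply/(ess_support_subP _ (@closed_dcube R n j)); exact: single_atom_support.
- move=> phi e e0; exists [fset k]%fset => A kA.
  have kA' : k \in A by apply: (fsubsetP kA); rewrite inE.
  rewrite (big_fsetD1 k)//= big_seq big1 ?addr0.
    by rewrite /single_atom eqxx subrr cabs0.
  move=> j; rewrite !inE => /andP[jk _]; rewrite /single_atom (negbTE jk).
  rewrite (_ : (fun x => _) = fun=> 0) ?cintegral0//.
  by apply/funext => x; rewrite mul0r.
Qed.

Lemma hreg_HL m K f : bounded_on m K f -> HL q rho w (hreg f).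
Proof.
move=> bf; split; first exact: hreg_tempered bf.
exists (single_atom (bigcube m) f); split.
  apply: hreg_representation (bf) _; apply: aeW => x xm; apply: cabs_eq0.
  apply/eqP; rewrite eq_le cabs_ge0 andbT (le_trans (bf.2 x))//.
  by rewrite indicE memNset ?mulr0// => /ocube_bigcube.
rewrite HL_costE single_atom_cost; apply/cost_lty.
apply: qint_bounded; first exact: measurable_cfun_cabs bf.1.
by move=> x; rewrite ger0_norm ?cabs_ge0//; exact: bf.2.
Qed.

Lemma cost_sum_lty k0 (X : seq cube_index) (a : cube_index -> 'rV[R]_n -> R[i]) :
  (forall k, measurable_cfun (a k)) -> (forall k, cost k (a k) < +oo)%E ->
  (cost k0 (fun x => \sum_(k <- X) a k x)%R < +oo)%E.
Proof.
move=> ma ca; elim: X => [|k X IH].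
  apply: (@le_lt_trans _ _ (cost k0 (fun=> 0))); last by rewrite (cost0) ltry.
  apply: (cost_le); [exact: measurable_cfun_sum|exact: measurable_cfun_cst|].
  by move=> x; rewrite big_nil.
apply: (@le_lt_trans _ _ (cost k0 (fun x => a k x + \sum_(k <- X) a k x)%R)).
  apply: (cost_le); [exact: measurable_cfun_sum| |by move=> x; rewrite big_cons].
  by apply: measurable_cfunD => //; exact: measurable_cfun_sum.
have := costD k0 (ma k) (measurable_cfun_sum X ma).
move=> /le_lt_trans; apply; apply: lte_add_pinfty; last exact: IH.
have [_ h1] := cost_lty k (a k); have [h2 _] := cost_lty k0 (a k).
exact: h2 (h1 (ca k)).
Qed.

Lemma cost_small k (d : R) : 0 < d -> exists2 e, 0 < e &
  forall u : 'rV[R]_n -> R, (qi u < e%:E)%E ->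
    (((wcube w k `^ s)%:E * (qi u) `^ q^-1) <= d%:E)%E.
Proof.
move=> d0; have Ws : 0 < wcube w k `^ s by apply: powR_gt0; exact: (wcube_gt0 ww).
exists ((d / (wcube w k `^ s)) `^ q); first by rewrite powR_gt0// divr_gt0.
move=> u ue.
apply: (@le_trans _ _ ((wcube w k `^ s)%:E * (((d / (wcube w k `^ s)) `^ q)%:E `^ q^-1))%E).
  apply: lee_wpmul2l; first by rewrite lee_fin ltW.
  apply: ge0_le_poweR; [by rewrite invr_ge0 ltW|exact: qint_ge0|exact: ltW].
have dW : 0 <= d / wcube w k `^ s by apply: divr_ge0; exact: ltW.
rewrite poweR_EFin -powRrM mulfV ?gt_eqF// powRr1//.
by rewrite -EFinM mulrC divfK ?lexx//; exact: lt0r_neq0.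
Qed.

Theorem test_functions_dense h (e : R) : HL q rho w h -> 0 < e ->
  exists f, [/\ test_function f, HL q rho w (hreg f), HL q rho w (h - hreg f) &
    (HL_norm q rho w (h - hreg f)%R < e%:E)%E].
Proof.
move=> [th [a [[ma sa ha] ac]]] e0; rewrite HL_costE in ac.
have cg0 k f : (0 <= cost k f)%E by exact: cost_ge0.
have ak k : (cost k (a k) < +oo)%E.
  apply: le_lt_trans ac; apply: esum_ge; exists [set k]; first by split => //; exact: finite_set1.
  by rewrite fsbig_set1.
have ac' : (\esum_(k in setT) cost k (a k) <= (fine (\esum_(k in setT) cost k (a k)))%:E)%E.
  by rewrite fineK// ge0_fin_numE//; exact: esum_ge0.
have e2 : 0 < e / 2 by rewrite divr_gt0.
have [X fX tail] := esum_tail (fun k => cg0 k (a k)) ac' e2.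
pose sX : seq cube_index := fset_set X.
have memX k : (k \in sX) = (k \in X) by rewrite /sX in_fset_set.
have [m mX] := common_ocube (R := R) sX.
pose k0 : cube_index := bigcube m.
pose g0 x := \sum_(k <- sX) a k x.
have mg0 : measurable_cfun g0 by exact: measurable_cfun_sum.
have m1 : measurable_cfun (toC (\1_(ocube m) : 'rV[R]_n -> R)).
  exact: measurable_toC (measurable_indic_ocube m).
(* The atoms vanish off their cubes only almost everywhere. The cut-off makes g vanish off [ocube m]
   at every point, as [smooth_approx_Lq] requires, and changes it on a null set only. *)
pose g x := g0 x * toC \1_(ocube m) x.
have mg : measurable_cfun g by exact: measurable_cfunM.
have gout x : ~ ocube m x -> g x = 0.
  by move=> xm; rewrite /g /toC indicE memNset// (_ : 0%:R%:C%C = 0)// mulr0.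
have gg0 : {ae mu, forall x, g x = g0 x}.
  have h0 k : {ae mu, forall x, ~ dcube k x -> a k x = 0}.
    exact/(ess_support_subP _ (@closed_dcube R n k)).
  have : {ae mu, forall x, forall k, k \in sX -> ~ dcube k x -> a k x = 0}.
    elim: sX {mX memX g0 mg0 g mg gout} => [|k s' IH]; first exact: aeW.
    by apply: filterS2 (h0 k) IH => x h1 h2 j; rewrite inE => /orP[/eqP ->|/h2].
  apply: filterS => x hx; rewrite /g /toC indicE.
  have [/set_mem xm|/negP xm] := boolP (x \in ocube m); first by rewrite (_ : 1%:R%:C%C = 1)// mulr1.
  rewrite (_ : 0%:R%:C%C = 0)// mulr0 /g0 big_seq big1// => k kX.
  apply: hx => // /(mX _ kX) xm'; apply: xm; exact: mem_set.
have qg : (qi (fun x => cabs (g x)) < +oo)%E.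
  apply: (proj2 (cost_lty k0 g)); apply: le_lt_trans (cost_sum_lty k0 sX ma ak).
  apply: (cost_le) => // x; rewrite cabsM cabs_toC ger0_norm ?indic_ge0//.
  by rewrite ler_piMr ?cabs_ge0 ?indic_le1.
(* The tail takes e / 2, the approximations of the real and of the imaginary part e / 4 each. *)
have e4 : 0 < e / 4 by rewrite divr_gt0.
have [dl dl0 dlP] := cost_small k0 e4.
have approx (re : R[i] -> R) : (forall z, `|re z| <= cabs z) -> re 0 = 0 ->
    measurable_fun setT (fun x => re (g x)) ->
    exists b, [/\ smooth b, forall x, ~ ocube m x -> b x = 0 &
      (qi (fun x => re (g x) - b x)%R < dl%:E)%E].
  move=> rec re0 mre.
  have [|||_ h1] := @smooth_approx_Lq R n q v q0 mv v0 lv m (fun x => re (g x)).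
  - exact: mre.
  - by move=> x xm; rewrite gout.
  - apply: le_lt_trans qg; apply: qi_le => //; first exact: measurable_cfun_cabs.
    by move=> x; rewrite [leRHS]ger0_norm ?cabs_ge0.
  exact: h1.
have [b1 [sb1 b10 b1e]] := approx (@complex.Re R) (@Re_le_cabs R) erefl mg.1.
have [b2 [sb2 b20 b2e]] := approx (@complex.Im R) (@Im_le_cabs R) erefl mg.2.
pose f x := Complex (b1 x) (b2 x).
have tf : test_function f by exact: test_functionC b10 b20.
have [mf [m' [K fK]]] := test_function_bounded tf.
have bf : bounded_on m' K f by [].
pose d x := g x + -1 * f x.
have md : measurable_cfun d.
  by apply: measurable_cfunD => //; apply: measurable_cfunM => //; exact: measurable_cfun_cst.
have dout x : ~ ocube m x -> d x = 0.
  by move=> xm; rewrite /d gout// /f b10// b20// add0r mulN1r; apply/eqP; rewrite eq_complex /= oppr0 eqxx.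
have dc : (cost k0 d <= (e / 4 + e / 4)%:E)%E.
  pose u x := complex.Re (g x) - b1 x; pose u' x := complex.Im (g x) - b2 x.
  have mu1 : measurable_fun setT u.
    by apply: measurable_funB; [exact: mg.1|exact: smooth_measurable sb1].
  have mu2 : measurable_fun setT u'.
    by apply: measurable_funB; [exact: mg.2|exact: smooth_measurable sb2].
  have -> : d = (fun x => toC u x + Complex 0 (u' x)).
    apply/funext => x; rewrite /d /toC /u /u' mulN1r; case: (g x) => ga gb.
    by apply/eqP; rewrite eq_complex /=; apply/andP; split; apply/eqP; ring.
  have mu2' : measurable_cfun (fun x => Complex 0 (u' x)) by [].
  have small (t : 'rV[R]_n -> R) c : measurable_fun setT t -> measurable_cfun c ->
      (forall x, cabs (c x) = `|t x|) -> (qi t < dl%:E)%E -> (cost k0 c <= (e / 4)%:E)%E.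
    move=> mt mc ct te; apply: le_trans (dlP t te); rewrite /atom_cost.
    apply: lee_wpmul2l; first by rewrite lee_fin powR_ge0.
    apply: ge0_le_poweR; [by rewrite invr_ge0 ltW|exact: qint_ge0|].
    apply: qi_le => //; first exact: measurable_cfun_cabs.
    by move=> x; rewrite ct normr_id.
  apply: le_trans (costD k0 (measurable_toC mu1) mu2') _.
  rewrite EFinD; apply: leeD.
    by apply: (small _ _ mu1 (measurable_toC mu1) _ b1e) => x; exact: cabs_toC.
  apply: (small _ _ mu2 mu2' _ b2e) => x.
  by rewrite cabsE /= expr0n add0r sqrtr_sqr.
(* [h - hreg f] keeps the atoms outside the finite set X, of small total cost;
   those in X are merged with f into the single atom d on the large cube k0. *)
pose a' k : 'rV[R]_n -> R[i] := if k \in X then fun=> 0 else a k.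
pose d' := single_atom k0 d.
pose b k x := a' k x + d' k x.
have a'X k : X k -> a' k = fun=> 0 by move=> kX; rewrite /a' mem_set.
have a'N k : ~ X k -> a' k = a k by move=> kX; rewrite /a' memNset.
have ma' k : measurable_cfun (a' k).
  by rewrite /a'; case: ifP => // _; exact: measurable_cfun_cst.
have md' k : measurable_cfun (d' k) by exact: single_atom_measurable.
have d0 : {ae mu, forall x, ~ dcube k0 x -> d x = 0}.
  by apply: aeW => x xk; apply: dout => /ocube_bigcube.
have bc : (\esum_(k in setT) cost k (b k) < e%:E)%E.
  apply: (@le_lt_trans _ _ (\esum_(k in setT) (cost k (a' k) + cost k (d' k)))%E).
    by apply: le_esum => k _; exact: (costD k (ma' k) (md' k)).
  rewrite esumD; [|by move=> k _; exact: cg0|by move=> k _; exact: cg0].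
  have d'E : (\esum_(k in setT) cost k (d' k) = cost k0 d)%E := single_atom_cost k0 d.
  rewrite d'E.
  have -> : (\esum_(k in setT) cost k (a' k) = \esum_(k in ~` X) cost k (a k))%E.
    rewrite (esumID X); last by move=> k _; exact: cg0.
    have E1 : (\esum_(k in setT `&` X) cost k (a' k) = 0)%E.
      by apply: esum1 => k [_ kX]; rewrite (a'X k kX); exact: (cost0).
    have E2 : (\esum_(k in setT `&` ~` X) cost k (a' k) = \esum_(k in ~` X) cost k (a k))%E.
      rewrite setTI; apply: eq_esum => k kX; rewrite (a'N k kX); exact: erefl.
    rewrite E1 E2; exact: add0e.
  rewrite (_ : e = e / 2 + (e / 4 + e / 4)); last by field.
  exact: lt_le_addEFin.
have rb : HL_representation (h - hreg f) b.
  split.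
  - by move=> k; exact: measurable_cfunD.
  - move=> k; apply/(ess_support_subP _ (@closed_dcube R n k)).
    have /(ess_support_subP _ (@closed_dcube R n k)) h1 := sa k.
    apply: filterS2 h1 (single_atom_support k d0) => x h1 h2 xk.
    by rewrite /b /d' h2// /a' addr0; case: ifP => // _; exact: h1.
  - move=> phi; have mphi := schwartz_measurable phi.
    have [B [B0 _ phiB]] := schwartz_bound phi.
    have rak k : cri (fun x => a k x * phi x) by exact: (atom_cri (ma k) (sa k) (ak k) mphi phiB).
    have rd : cri (fun x => d x * phi x).
      apply: (@atom_cri k0 d (fun x => phi x) B md _ _ mphi phiB).
        exact/(ess_support_subP _ (@closed_dcube R n k0)).
      exact: le_lt_trans dc (ltry _).
    have rf : cri (fun x => f x * phi x) by have [] := bounded_on_cri bf mphi phiB.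
    (* Because d + f = g, which is the sum of the atoms in X almost everywhere. *)
    have Ig : cintegral (fun x => d x * phi x) + cintegral (fun x => f x * phi x) =
        \sum_(k <- sX) cintegral (fun x => a k x * phi x).
      rewrite -cintegralD// -(cintegral_sum sX rak).2; apply: cintegral_ae.
      - by apply: measurable_cfunD; exact: measurable_cfunM.
      - by apply: measurable_cfun_sum => k; exact: measurable_cfunM.
      - apply: filterS gg0 => x gx; rewrite -big_distrl/= -/(g0 x) -gx /d; ring.
    move=> eps eps0; have [A0 A0P] := ha phi eps eps0.
    (* All removed atoms and the added one must be counted by A. The index k0 may itself lie in X;
       its atom is then d alone. *)
    exists (A0 `|` fset_set X `|` [fset k0])%fset => A sA.
    have sA0 : (A0 `<=` A)%fset.
      by apply: fsubset_trans sA; rewrite -fsetUA fsubsetUl.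
    have sAX k : k \in sX -> k \in A.
      by move=> kX; apply: (fsubsetP sA); rewrite !inE kX orbT.
    have k0A : k0 \in A by apply: (fsubsetP sA); rewrite !inE eqxx orbT.
    have bE k : cintegral (fun x => b k x * phi x) =
       (cintegral (fun x => a k x * phi x) -
        (if k \in sX then cintegral (fun x => a k x * phi x) else 0)) +
       (if k == k0 then cintegral (fun x => d x * phi x) else 0).
      have Z : cintegral (fun x => 0 * phi x) = 0.
        by rewrite -[RHS](@cintegral0 R n); congr cintegral; apply/funext => x; rewrite mul0r.
      have rZ : cri (fun x => 0 * phi x).
        by rewrite (_ : (fun x => _) = fun=> 0); [exact: cri0|apply/funext => x; rewrite mul0r].
      have bE' : (fun x => b k x * phi x) = (fun x => a' k x * phi x + d' k x * phi x).
        by apply/funext => x; rewrite /b mulrDl.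
      have [ra Ea] : cri (fun x => a' k x * phi x) /\ cintegral (fun x => a' k x * phi x) =
          cintegral (fun x => a k x * phi x) -
          (if k \in sX then cintegral (fun x => a k x * phi x) else 0).
        rewrite memX; have [/set_mem kX|/negP kX] := boolP (k \in X).
          by rewrite (a'X k kX) Z subrr.
        by rewrite (a'N k) ?subr0//; move=> /mem_set.
      have [rd' Ed] : cri (fun x => d' k x * phi x) /\ cintegral (fun x => d' k x * phi x) =
          (if k == k0 then cintegral (fun x => d x * phi x) else 0).
        by rewrite /d' /single_atom; case: eqP => _; rewrite ?Z.
      by rewrite bE' cintegralD// Ea Ed.
    (* With [Ig] this shows that the error of b over A equals the error of a over A, so the A0 found
       for a serves. *)
    have SA : \sum_(k <- A) cintegral (fun x => b k x * phi x) =
        \sum_(k <- A) cintegral (fun x => a k x * phi x) -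
        \sum_(k <- sX) cintegral (fun x => a k x * phi x) + cintegral (fun x => d x * phi x).
      rewrite (eq_bigr _ (fun k _ => bE k)) big_split sumrB /= -!big_mkcond /=.
      congr (_ - _ + _).
        rewrite -big_filter; apply: perm_big.
        apply: uniq_perm; [by apply: filter_uniq; exact: fset_uniq|exact: fset_uniq|].
        move=> k; rewrite mem_filter; apply: andb_idr; exact: sAX.
      rewrite -big_filter (_ : [seq _ <- _ | _] = [:: k0]) ?big_seq1//.
      by apply: filter_pred1_uniq => //; exact: fset_uniq.
    have := A0P A sA0; congr (cabs _ < _).
    rewrite -[(h - hreg f) phi]/(h phi - hreg f phi).
    rewrite SA -Ig /hreg; ring.
have thf : tempered (h - hreg f).
  rewrite (_ : h - hreg f = -1 *: hreg f + h); last by rewrite scaleN1r addrC.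
  by apply: tempered_lin => //; exact: hreg_tempered bf.
have bfin : (HL_cost q rho w b < +oo)%E.
  by rewrite HL_costE (lt_trans bc)// ltry.
exists f; split => //.
- exact: (hreg_HL bf).
- by split => //; exists b.
- apply: le_lt_trans bc; rewrite -HL_costE.
  by apply: ereal_inf_lbound; exists b.
Qed.

Definition morrey_le (M : R) g := measurable_cfun g /\
  forall k, (morrey_term p s w k (fun x => cabs (g x)) <= M%:E)%E.

Lemma morrey_le_bounded m K g : bounded_on m K g -> exists M, morrey_le M g.
Proof.
move=> [mg gK]; exists (`|K| * wocube w m `^ (p^-1 - s)); split => //.
apply: (morrey_term_bounded p_gt1 ww (s_gt0) (s_lt)).
  exact: measurable_cfun_cabs.
by move=> x; rewrite ger0_norm ?cabs_ge0.
Qed.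

Lemma bounded_on_bump (a b : 'I_n -> R) j : exists m, bounded_on m 1 (toC (bump a b j)).
Proof.
have [m abm] := bump_bounded a b j; exists m; split.
  by apply: measurable_toC; exact: measurable_bump.
by move=> x; rewrite cabs_toC.
Qed.

Lemma HL_cost_ge0 a : (0 <= HL_cost q rho w a)%E.
Proof. by rewrite HL_costE; apply: esum_ge0 => k _; exact: cost_ge0. Qed.

Lemma HL_norm_ge0 h : (0 <= NX h)%E.
Proof. by apply: le_ereal_inf_tmp => _ [a _ <-]; exact: HL_cost_ge0. Qed.

Lemma HL_norm_fin h : X h -> NX h \is a fin_num.
Proof.
move=> [_ [a [ra ca]]]; rewrite ge0_fin_numE; last exact: HL_norm_ge0.
apply: le_lt_trans (ca); apply: ereal_inf_lbound; exists a; last exact: erefl.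
exact: conj ra ca.
Qed.

Lemma cri_density A A' g : measurable_cfun A -> measurable_cfun A' -> measurable_cfun g ->
  {ae mu, forall x, A x = A' x} -> cri (fun x => A x * g x) ->
  cri (fun x => A' x * g x) /\
  cintegral (fun x => A x * g x) = cintegral (fun x => A' x * g x).
Proof.
move=> mA mA' mg AA' rA.
have AA'g : {ae mu, forall x, A x * g x = A' x * g x} by apply: filterS AA' => x ->.
split; first by apply: cri_ae AA'g rA; exact: measurable_cfunM.
by apply: cintegral_ae AA'g; exact: measurable_cfunM.
Qed.

(* By [has_density_unique] the density does not depend on the representation,
   so the bound can be taken over the infimum of the costs. *)
Theorem density_pairing h : X h -> exists A, has_density h A /\
  forall g M, morrey_le M g -> cri (fun x => A x * g x) /\
    (cabs (cintegral (fun x => A x * g x)) <= 2 * (fine (NX h) * M)).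
Proof.
move=> Xh; have [th [a0 [ra0 ca0]]] := Xh.
have rep a : HL_representation h a -> (HL_cost q rho w a < +oo)%E ->
    exists A, has_density h A /\ forall g M, morrey_le M g ->
      cri (fun x => A x * g x) /\
      cabs (cintegral (fun x => A x * g x)) <= 2 * (fine (HL_cost q rho w a) * M).
  move=> ra ca.
  have c0 := HL_cost_ge0 a.
  have ca' : (HL_cost q rho w a <= (fine (HL_cost q rho w a))%:E)%E.
    by rewrite fineK// ge0_fin_numE.
  have [A [dA AP]] := representation_density ra ca'.
  by exists A; split => // g M [mg gM]; exact: AP.
have [A [dA AP]] := rep _ ra0 ca0; exists A; split => // g M gM.
have [rA _] := AP g M gM; split => //.
have M0 : 0 <= M.
  by rewrite -lee_fin; apply: le_trans (gM.2 (0, 0)); exact: mterm_ge0.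
apply/ler_addgt0Pr => e e0.
(* The excess of cost allowed for the second representation: multiplied by 2 M it stays below e, and
   M + 1 avoids division by 0. *)
have e'0 : 0 < e / (2 * (M + 1)) by rewrite divr_gt0// mulr_gt0// ltr_wpDl.
have Nfin := HL_norm_fin Xh.
have [_ [a [ra ca] <-] cae] : exists2 y, [set HL_cost q rho w a | a in [set a |
    HL_representation h a /\ (HL_cost q rho w a < +oo)%E]] y &
    (y < (fine (NX h) + e / (2 * (M + 1)))%:E)%E.
  by apply: ereal_inf_lt; rewrite EFinD fineK// lteDl// lte_fin.
have [A' [dA' A'P]] := rep _ ra ca.
have [rA' A'b] := A'P g M gM.
have [mA _ _] := dA; have [mA' _ _] := dA'.
have [_ ->] := cri_density mA mA' gM.1 (has_density_unique dA dA') rA.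
apply: (le_trans A'b).
have c0 := HL_cost_ge0 a.
have h1 : fine (HL_cost q rho w a) <= fine (NX h) + e / (2 * (M + 1)).
  by rewrite -lee_fin fineK ?ltW// ge0_fin_numE.
apply: (@le_trans _ _ (2 * ((fine (NX h) + e / (2 * (M + 1))) * M))).
  by rewrite ler_wpM2l// ler_wpM2r.
have -> : 2 * ((fine (NX h) + e / (2 * (M + 1))) * M) = 2 * (fine (NX h) * M) + e * (M / (M + 1)).
  by move: (fine _) => N; field; rewrite gt_eqF// ltr_wpDl.
rewrite lerD2l; have M1 : 0 < M + 1 by rewrite ltr_wpDl.
by rewrite ler_piMr ?(ltW e0)// ler_pdivrMr// mul1r lerDl.
Qed.

Definition density (u : X) : 'rV[R]_n -> R[i] := projT1 (cid (density_pairing (set_mem (valP u)))).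

Lemma densityP (u : X) : has_density (\val u) (density u) /\
  forall g M, morrey_le M g -> cri (fun x => density u x * g x) /\
    cabs (cintegral (fun x => density u x * g x)) <= 2 * (fine (NX (\val u)) * M).
Proof. by rewrite /density; case: cid. Qed.

Lemma has_density_lin (c : R[i]) h1 h2 A1 A2 : X h1 -> X h2 ->
  has_density h1 A1 -> has_density h2 A2 ->
  has_density (c *: h1 + h2) (fun x => c * A1 x + A2 x).
Proof.
move=> X1 X2 d1 d2; have [m1 l1 b1] := d1; have [m2 l2 b2] := d2.
have cr (h : schwartz_space R n -> R[i]) A a b j : X h -> has_density h A ->
    cri (fun x => A x * toC (bump a b j) x).
  move=> Xh dA; have [A' [dA' A'P]] := density_pairing Xh.
  have [m bm] := bounded_on_bump a b j; have [M gM] := morrey_le_bounded bm.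
  have [rA' _] := A'P _ _ gM; have [mA _ _] := dA; have [mA' _ _] := dA'.
  by have [] := cri_density mA' mA gM.1 (has_density_unique dA' dA) rA'.
split.
- apply: measurable_cfunD => //; apply: measurable_cfunM => //; exact: measurable_cfun_cst.
- move=> m; rewrite (_ : (fun x => _) = (fun x => c * (A1 x * toC \1_(ocube m) x) +
    A2 x * toC \1_(ocube m) x)); first exact: criZD.
  by apply/funext => x; rewrite mulrDl mulrA.
- move=> a b j; rewrite -[LHS]/(c * h1 _ + h2 _) b1 b2 -cintegralZD; [|exact: cr X1 d1|exact: cr X2 d2].
  by congr cintegral; apply/funext => x; rewrite mulrDl mulrA.
Qed.

Lemma has_density_hreg m K f : bounded_on m K f -> has_density (hreg f) f.
Proof.
move=> bf; split => //; first exact: bf.1.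
move=> m'; have [] := @bounded_on_cri _ _ _ _ f (toC \1_(ocube m')) 1 bf => //.
  exact: measurable_toC (measurable_indic_ocube _).
by move=> x; rewrite cabs_toC ger0_norm ?indic_ge0// indic_le1.
Qed.

Lemma morrey_leP g : morrey p r w g -> morrey_le (fine (morrey_norm p r w g)) g.
Proof.
move=> [[[mr _] [mi _]] gfin]; split; first by [].
have g0 : (0 <= morrey_norm p r w g)%E.
  by apply: le_trans (morrey_term_le (0, 0) g); exact: mterm_ge0.
by move=> k; rewrite fineK ?ge0_fin_numE//; exact: morrey_term_le.
Qed.

Definition dual_pairing g (u : X) : R[i] := cintegral (fun x => density u x * g x).

(** The densities are chosen for each u separately; linearity holds because a linear combination of
    densities is a density of the combination, and densities are unique almost everywhere. *)
Lemma dual_pairing_bounded_linear g : morrey p r w g -> bounded_linear NX (dual_pairing g).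
Proof.
move=> /morrey_leP gM; have [mg _] := gM; split.
  move=> c u u' t tE; rewrite /dual_pairing.
  have [du uP] := densityP u; have [du' u'P] := densityP u'; have [dt tP] := densityP t.
  have [ru _] := uP _ _ gM; have [ru' _] := u'P _ _ gM; have [rt _] := tP _ _ gM.
  rewrite -cintegralZD//.
  have dl := has_density_lin c (set_mem (valP u)) (set_mem (valP u')) du du'.
  rewrite -tE in dl; have [mt _ _] := dt; have [ml _ _] := dl.
  have [_ ->] := cri_density mt ml mg (has_density_unique dt dl) rt.
  by congr cintegral; apply/funext => x; rewrite mulrDl mulrA.
exists (2 * fine (morrey_norm p r w g)) => u.
have [_ /(_ _ _ gM)[_ ub]] := densityP u.
rewrite -[NX _]fineK; last by apply: HL_norm_fin; exact: set_mem (valP u).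
by rewrite -EFinM lee_fin (le_trans ub)// -mulrA [fine (NX _) * _]mulrC.
Qed.

Lemma dual_pairing_represents g : morrey p r w g -> represents (dual_pairing g) g.
Proof.
move=> /morrey_leP gM f u tf /regularE uE.
have [mf [m [K fK]]] := test_function_bounded tf.
have bf : bounded_on m K f by [].
have [du /(_ _ _ gM)[ru _]] := densityP u.
have df := has_density_hreg bf; rewrite -uE in df.
have [md _ _] := du.
rewrite /dual_pairing; have [_ ->] := cri_density md mf gM.1 (has_density_unique du df) ru.
by congr cintegral; apply/funext => x; rewrite mulrC.
Qed.

Definition mkX h (Xh : X h) : X := exist (fun h => h \in X) h (mem_set Xh).

(** Both functionals agree on test functions, so their difference at u is their difference at the
    remainder u - hreg f, whose norm is arbitrarily small by density. *)
Lemma represents_unique g (g1 g2 : X -> R[i]) : bounded_linear NX g1 -> bounded_linear NX g2 ->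
  represents g1 g -> represents g2 g -> g1 = g2.
Proof.
move=> [l1 [C1 b1]] [l2 [C2 b2]] r1 r2; apply/funext => u.
have Xu : X (\val u) := set_mem (valP u).
apply/eqP; rewrite -subr_eq0; apply/eqP/cabs_eq0/eqP; rewrite eq_le cabs_ge0 andbT.
apply/ler_addgt0Pr => e e0; rewrite add0r.
pose C := `|C1| + `|C2| + 1.
have C0 : 0 < C by rewrite ltr_wpDl// addr_ge0.
have eC : 0 < e / C by rewrite divr_gt0.
have [f [tf Xf Xd Nd]] := test_functions_dense Xu eC.
pose uf := mkX Xf; pose ud := mkX Xd.
have uE : \val u = 1 *: \val ud + \val uf by rewrite scale1r /= subrK.
have regf : regular (\val uf) f by [].
rewrite (l1 _ _ _ _ uE) (l2 _ _ _ _ uE) (r1 f uf tf regf) (r2 f uf tf regf) !mul1r.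
rewrite [X in cabs X](_ : _ = g1 ud - g2 ud); last by rewrite opprD addrACA subrr addr0.
have Nfin := HL_norm_fin Xd.
have Nn : fine (NX (\val u - hreg f)) <= e / C by rewrite -lee_fin fineK// ltW.
have N0 : 0 <= fine (NX (\val u - hreg f)) by apply: fine_ge0; exact: HL_norm_ge0.
have bnd (g' : X -> R[i]) C' : (forall u : X, ((cabs (g' u))%:E <= C'%:E * NX (\val u))%E) ->
    cabs (g' ud) <= `|C'| * (e / C).
  move=> /(_ ud); rewrite -[NX _]fineK// -EFinM lee_fin => /le_trans; apply.
  apply: (@le_trans _ _ (`|C'| * fine (NX (\val ud)))).
    by apply: ler_wpM2r => //; exact: ler_norm.
  by apply: ler_wpM2l.
apply: (le_trans (cabsD _ _)).
have -> : cabs (- g2 ud) = cabs (g2 ud) by rewrite !cabsE; case: (g2 ud) => x y /=; rewrite !sqrrN.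
apply: (@le_trans _ _ (`|C1| * (e / C) + `|C2| * (e / C))); first by apply: lerD; exact: bnd.
by rewrite -mulrDl mulrCA ler_piMr ?(ltW e0)// ler_pdivrMr// mul1r /C lerDl ler01.
Qed.

Lemma bounded_on_toC m K (u : 'rV[R]_n -> R) : rbounded_on m K u -> bounded_on m K (toC u).
Proof. by move=> [mu_ uK]; split; [exact: measurable_toC|move=> x; rewrite cabs_toC]. Qed.

(** The right-hand side is the cost of the representation by the single atom u on the cube k; the
    infimum may be smaller. *)
Lemma HL_norm_hreg m K (u : 'rV[R]_n -> R) k : rbounded_on m K u ->
  (forall x, ~ dcube k x -> u x = 0) ->
  (NX (hreg (toC u)) <= (wcube w k `^ s * (\int[mu]_x (`|u x| `^ q * v x)) `^ q^-1)%:E)%E.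
Proof.
move=> ru u0; have bu := bounded_on_toC ru.
have u0' : {ae mu, forall x, ~ dcube k x -> toC u x = 0}.
  by apply: aeW => x xk; rewrite /toC u0.
have rep := hreg_representation bu u0'.
have rq := ri_qint_bounded q0 mv v0 lv ru.1 ru.2.
have E : HL_cost q rho w (single_atom k (toC u)) =
    (wcube w k `^ s * (\int[mu]_x (`|u x| `^ q * v x)) `^ q^-1)%:E.
  have Q : qint q v (fun x => cabs (toC u x)) = (\int[mu]_x (`|u x| `^ q * v x))%:E.
    rewrite -[RHS](ri_EFin rq); apply: eq_integral => x _.
    by rewrite cabs_toC normr_id.
  have H := single_atom_cost k (toC u).
  by rewrite HL_costE H /atom_cost Q poweR_EFin -EFinM.
rewrite -E; apply: ereal_inf_lbound; exists (single_atom k (toC u)); last exact: erefl.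
by split; [exact: rep|rewrite E; exact: ltry].
Qed.

(** * From a bounded functional to a Morrey function *)

Section functional.
Variable g : X -> R[i].
Hypothesis bg : bounded_linear NX g.

(** Turns g into an operation on functions, as [riesz_representation] expects. The default 0 is
    harmless: for bounded f of bounded support, [hreg f] belongs to X. *)
Definition on_regular f : R[i] :=
  if pselect (X (hreg f)) is left Xf then g (mkX Xf) else 0.

Lemma on_regularE (u : X) f : \val u = hreg f -> g u = on_regular f.
Proof.
rewrite /on_regular; case: pselect => [Xf uE|nX uE]; first by congr g; exact: val_inj.
by exfalso; apply: nX; rewrite -uE; exact: set_mem (valP u).
Qed.

Let XE m K f : bounded_on m K f -> exists u : X, \val u = hreg f.
Proof. by move=> bf; exists (mkX (hreg_HL bf)). Qed.

(** A supremum over the empty set would be minus infinity, so a member of the unit ball is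
    exhibited: the zero distribution. *)
Lemma dual_norm_ge0 : (0 <= dual_norm NX g)%E.
Proof.
have r0 : rbounded_on 0 0 (fun _ : 'rV[R]_n => 0 : R) by split => // x; rewrite normr0 mul0r.
pose X0 := hreg_HL (bounded_on_toC r0).
have N0 : (NX (\val (mkX X0)) <= 1)%E.
  have := @HL_norm_hreg 0 0 (fun=> 0) (0, 0) r0 (fun x _ => erefl).
  rewrite (_ : \int[mu]_x _ = 0); last first.
    rewrite -[RHS](mul0r (fine (mu setT))) -Rintegral_cst//; congr Rintegral; apply/funext => x.
    by rewrite normr0 (powR0 (lt0r_neq0 q0)) mul0r.
  rewrite powR0; last by rewrite gt_eqF ?invr_gt0.
  by rewrite mulr0 => /le_trans; apply; rewrite lee_fin.
apply: (@le_trans _ _ (cabs (g (mkX X0)))%:E); first by rewrite lee_fin cabs_ge0.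
by apply: ereal_sup_ubound; exists (mkX X0).
Qed.

Lemma dual_norm_fin : dual_norm NX g \is a fin_num.
Proof.
have [_ [C bC]] := bg.
rewrite ge0_fin_numE; last exact: dual_norm_ge0.
apply: (@le_lt_trans _ _ `|C|%:E); last exact: ltry.
apply: ge_ereal_sup => _ [u u1 <-].
apply: (le_trans (bC u)); apply: (@le_trans _ _ (`|C|%:E * NX (\val u))%E).
  apply: lee_wpmul2r; first exact: HL_norm_ge0.
  by rewrite lee_fin ler_norm.
by rewrite -[leRHS]mule1; apply: lee_wpmul2l; [rewrite lee_fin|exact: u1].
Qed.

Lemma on_regular_lin m K K' (c : R[i]) f f' : bounded_on m K f -> bounded_on m K' f' ->
  on_regular (fun x => c * f x + f' x) = c * on_regular f + on_regular f'.
Proof.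
move=> bf bf'.
have bl : bounded_on m (cabs c * K + K') (fun x => c * f x + f' x).
  split.
    apply: measurable_cfunD; last exact: bf'.1.
    by apply: measurable_cfunM; [exact: measurable_cfun_cst|exact: bf.1].
  move=> x; apply: (le_trans (cabsD _ _)); rewrite mulrDl lerD ?(bf'.2)//.
  by rewrite cabsM -mulrA ler_wpM2l ?cabs_ge0//; exact: bf.2.
have [u uE] := XE bf; have [u' u'E] := XE bf'; have [t tE] := XE bl.
rewrite -(on_regularE uE) -(on_regularE u'E) -(on_regularE tE).
apply: bg.1; rewrite tE uE u'E; apply/funext => phi.
rewrite -[RHS]/(c * hreg f phi + hreg f' phi) /hreg.
have [B [_ _ phiB]] := schwartz_bound phi.
have [rf _] := bounded_on_cri bf (schwartz_measurable phi) phiB.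
have [rf' _] := bounded_on_cri bf' (schwartz_measurable phi) phiB.
rewrite -cintegralZD//; congr cintegral; apply/funext => x.
by rewrite mulrDl mulrA.
Qed.

(** With [re] the real or imaginary part, u |-> re (g u) is a real functional on real functions. One
    atom on [bigcube m] gives the bound needed for the Riesz theorem; one atom on the cube k gives
    [dual_estimate] with a = w(Q)^s and D the dual norm. *)
Lemma component_representation (re : R[i] -> R) :
  (forall z z', re (z + z') = re z + re z') -> (forall (c : R) z, re (c%:C%C * z) = c * re z) ->
  (forall z, `|re z| <= cabs z) ->
  exists U : 'rV[R]_n -> R, [/\ measurable_fun setT U, loc_ri U,
    forall m K u, rbounded_on m K u -> re (on_regular (toC u)) = \int[mu]_x (U x * u x) &
    forall k, (\int[mu]_x (`|U x| `^ p * w x * \1_(dcube k) x)%:E <=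
      ((fine (dual_norm NX g) * wcube w k `^ s) `^ p)%:E)%E].
Proof.
move=> reD reZ rec.
pose L u := re (on_regular (toC u)).
have L_lin m K K' c u u' : rbounded_on m K u -> rbounded_on m K' u' ->
    L (fun x => c * u x + u' x) = c * L u + L u'.
  move=> ru ru'; rewrite /L -reZ -reD -(on_regular_lin c%:C%C (bounded_on_toC ru) (bounded_on_toC ru')).
  by congr (re (on_regular _)); apply/funext => x; rewrite /toC rmorphD rmorphM.
have L_bound m : exists2 C, 0 <= C & forall K u, rbounded_on m K u ->
    `|L u| <= C * (\int[mu]_x (`|u x| `^ q * v x)) `^ q^-1.
  have [_ [C bC]] := bg.
  exists (`|C| * wcube w (bigcube m) `^ s); first by rewrite mulr_ge0// powR_ge0.
  move=> K u ru; have [t tE] := XE (bounded_on_toC ru).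
  rewrite /L (le_trans (rec _))// -(on_regularE tE) -lee_fin (le_trans (bC t))//.
  rewrite tE; apply: (@le_trans _ _ (`|C|%:E * NX (hreg (toC u)))%E).
    by apply: lee_wpmul2r; [exact: HL_norm_ge0|rewrite lee_fin ler_norm].
  rewrite -mulrA EFinM; apply: lee_wpmul2l => //; apply: (HL_norm_hreg ru).
  move=> x xm; apply/eqP; rewrite -normr_le0 (le_trans (ru.2 x))// indicE memNset ?mulr0//.
  by move=> /ocube_bigcube.
have [U [mU lU LU]] := riesz_representation q0 mv v0 lv L_lin L_bound.
exists U; split => // k.
have D0 : 0 <= fine (dual_norm NX g) := fine_ge0 dual_norm_ge0.
apply: (dual_estimate p_gt1 ww mU _ D0); first by apply: powR_gt0; exact: (wcube_gt0 ww).
move=> m K u ru u0 u1; rewrite -(LU m K u ru) /L (le_trans (rec _))//.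
have [t tE] := XE (bounded_on_toC ru).
rewrite -(on_regularE tE) -lee_fin fineK; last exact: dual_norm_fin.
apply: ereal_sup_ubound; exists t => //=; rewrite tE.
by apply: (le_trans (HL_norm_hreg ru u0)); rewrite lee_fin.
Qed.

End functional.

Lemma represents_ae_unique (g : X -> R[i]) f f' :
  loc_cintegrable f -> loc_cintegrable f' -> represents g f -> represents g f' ->
  {ae mu, forall x, f x = f' x}.
Proof.
move=> lf lf' gf gf'.
have lc f1 : loc_cintegrable f1 -> measurable_cfun f1 /\ loc_cri f1.
  move=> [[mr lr] [mi li]]; split; first by [].
  by apply/loc_criP; split; exact: loc_integrable_ri.
have [mf cf] := lc _ lf; have [mf' cf'] := lc _ lf'.
apply: (cae_eq_of_bump mf mf' cf cf') => a b k.
have tb : test_function (toC (bump a b k)).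
  by apply: test_function_bump_rV; rewrite invr_gt0 ltr0n.
have [mb [m [K bK]]] := test_function_bounded tb.
have Xb := hreg_HL (conj mb bK).
have rb : regular (\val (mkX Xb)) (toC (bump a b k)) by [].
by rewrite -(gf _ _ tb rb) -(gf' _ _ tb rb).
Qed.

Lemma morrey_norm_le f (M : R) : (forall k, (morrey_term p s w k (fun x => cabs (f x)) <= M%:E)%E) ->
  (morrey_norm p r w f <= M%:E)%E.
Proof. by move=> fM; rewrite (morrey_normE); apply: ge_ereal_sup => _ [k _ <-]. Qed.

(** Origin of the 4: with y = (D w(Q)^s)^p, the integral for |U| + |V| is at most 2^p (y + y), and 2
    * 2^p <= 4^p since p >= 1. *)
Lemma morrey_term_complex (U V : 'rV[R]_n -> R) (D : R) k : 0 <= D ->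
  measurable_fun setT U -> measurable_fun setT V ->
  (\int[mu]_x (`|U x| `^ p * w x * \1_(dcube k) x)%:E <= ((D * wcube w k `^ s) `^ p)%:E)%E ->
  (\int[mu]_x (`|V x| `^ p * w x * \1_(dcube k) x)%:E <= ((D * wcube w k `^ s) `^ p)%:E)%E ->
  (morrey_term p s w k (fun x => cabs (Complex (U x) (V x))) <= (4 * D)%:E)%E.
Proof.
move=> D0 mU mV UD VD.
have p0 := p_gt0 p_gt1; have W0 := wcube_gt0 ww k.
have Ws : 0 <= wcube w k `^ s by exact: powR_ge0.
pose wk x := w x * \1_(dcube k) x.
have mwk : measurable_fun setT wk.
  apply: measurable_funM; first exact: weight_measurable ww.
  by apply: measurable_indic; exact: measurable_dcube.
have wk0 x : 0 <= wk x by apply: mulr_ge0; [exact: ltW (weight_gt0 ww x)|exact: indic_ge0].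
have qE u : (\int[mu]_x (`|u x| `^ p * w x * \1_(dcube k) x)%:E = qint p wk u)%E.
  by apply: eq_integral => x _; rewrite -mulrA.
have mC : measurable_fun setT (fun x => cabs (Complex (U x) (V x))) by exact: measurable_cfun_cabs.
have mnU : measurable_fun setT (fun x => `|U x|) by exact: measurableT_comp.
have mnV : measurable_fun setT (fun x => `|V x|) by exact: measurableT_comp.
have qn u : qint p wk (fun x => `|u x|) = qint p wk u.
  by apply: eq_integral => x _; rewrite normr_id.
rewrite !qE in UD VD.
have I : (qint p wk (fun x => cabs (Complex (U x) (V x))) <= ((4 * D * wcube w k `^ s) `^ p)%:E)%E.
  apply: (le_trans (qint_le p0 mwk wk0 mC (measurable_funD mnU mnV) _)).
    by move=> x; rewrite !ger0_norm ?addr_ge0 ?cabs_ge0//; exact: cabs_le_ReIm.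
  apply: (le_trans (qintD p0 mwk wk0 mnU mnV)); rewrite !qn.
  apply: (@le_trans _ _ ((2 `^ p)%:E * (((D * wcube w k `^ s) `^ p)%:E + ((D * wcube w k `^ s) `^ p)%:E))%E).
    by apply: lee_wpmul2l; [rewrite lee_fin powR_ge0|exact: (leeD UD VD)].
  rewrite -EFinD -EFinM lee_fin.
  set y := (D * wcube w k `^ s) `^ p; have -> : y + y = 2 * y by ring.
  rewrite mulrA {}/y.
  have -> : 4 * D * wcube w k `^ s = (2 * 2) * (D * wcube w k `^ s) by ring.
  have DW := mulr_ge0 D0 Ws.
  rewrite (_ : (2 * 2 * (D * wcube w k `^ s)) `^ p = 2 `^ p * 2 `^ p * (D * wcube w k `^ s) `^ p);
    last by rewrite powRM// powRM.
  apply: ler_wpM2r; first exact: powR_ge0.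
  apply: ler_wpM2l; first exact: powR_ge0.
  rewrite -[leLHS]powRr1//; apply: ler_powR; last exact: ltW.
  by rewrite ler1n.
rewrite /morrey_term; apply: (@le_trans _ _ ((wcube w k `^ (- s))%:E * ((4 * D * wcube w k `^ s) `^ p)%:E `^ p^-1)%E).
  apply: lee_wpmul2l; first by rewrite lee_fin powR_ge0.
  rewrite qE; apply: (ge0_le_poweR _ _ I); first by rewrite invr_ge0 ltW.
  exact: qint_ge0.
rewrite poweR_EFin -powRrM mulfV ?gt_eqF// powRr1; last by rewrite !mulr_ge0.
rewrite -EFinM lee_fin mulrCA -powRD; last by apply/implyP => _; rewrite gt_eqF.
by rewrite addNr powRr0 mulr1.
Qed.

(** On real functions U represents the real part of g and V the imaginary part; complex linearity
    then gives g on all test functions by integration against U + iV. *)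
Theorem dual_representation (g : X -> R[i]) : bounded_linear NX g ->
  exists f, [/\ morrey p r w f, represents g f &
    (morrey_norm p r w f <= (4 * fine (dual_norm NX g))%:E)%E].
Proof.
move=> bg.
have CR := component_representation bg.
have ReZ (c : R) z : complex.Re (c%:C%C * z) = c * complex.Re z by rewrite mulrC Re_realM mulrC.
have ImZ (c : R) z : complex.Im (c%:C%C * z) = c * complex.Im z by rewrite mulrC Im_realM mulrC.
have [U [mU lU gU UD]] := CR _ (@ReD R) ReZ (@Re_le_cabs R).
have [V [mV lV gV VD]] := CR _ (@ImD R) ImZ (@Im_le_cabs R).
have D0 : 0 <= fine (dual_norm NX g) := fine_ge0 (dual_norm_ge0 g).
pose f x := Complex (U x) (V x).
have fD : (morrey_norm p r w f <= (4 * fine (dual_norm NX g))%:E)%E.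
  by apply: morrey_norm_le => k; apply: (morrey_term_complex D0 mU mV); [exact: UD|exact: VD].
exists f; split; last exact: fD.
  split; last by apply: (le_lt_trans fD); exact: ltry.
  by split; exact: ri_loc_integrable.
move=> t u tt /regularE ut; rewrite (on_regularE g ut).
have [[mr mi] [m [K tK]]] := test_function_bounded tt.
have rr : rbounded_on m K (fun x => complex.Re (t x)).
  by split => // x; apply: (le_trans (Re_le_cabs _)); exact: tK.
have ri_ : rbounded_on m K (fun x => complex.Im (t x)).
  by split => // x; apply: (le_trans (Im_le_cabs _)); exact: tK.
have tE : t = (fun x => Complex 0 1 * toC (fun x => complex.Im (t x)) x + toC (fun x => complex.Re (t x)) x).
  apply/funext => x; rewrite /toC; case: (t x) => a b.
  by apply/eqP; rewrite eq_complex ReD ImD ReM ImM /=; apply/andP; split; apply/eqP; ring.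
rewrite {1}tE (on_regular_lin bg _ (bounded_on_toC ri_) (bounded_on_toC rr)).
have I1 (u1 u2 : 'rV[R]_n -> R) m' K' : measurable_fun setT u1 -> loc_ri u1 ->
    rbounded_on m' K' u2 -> ri mu (fun x => u1 x * u2 x).
  by move=> m1 l1 [m2 b2]; exact: loc_ri_bounded l1 m1 m2 b2.
have Ur := gU _ _ _ rr; have Ui := gU _ _ _ ri_.
have Vr := gV _ _ _ rr; have Vi := gV _ _ _ ri_.
have fr : \int[mu]_x complex.Re (f x * t x) =
    \int[mu]_x (U x * complex.Re (t x)) - \int[mu]_x (V x * complex.Im (t x)).
  rewrite addrC -mulN1r -rint_lin; [|exact: (I1 _ _ _ _ mV lV ri_)|exact: (I1 _ _ _ _ mU lU rr)].
  by congr Rintegral; apply/funext => x; rewrite ReM /=; ring.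
have fi : \int[mu]_x complex.Im (f x * t x) =
    \int[mu]_x (U x * complex.Im (t x)) + \int[mu]_x (V x * complex.Re (t x)).
  rewrite -[X in X + _]mul1r -rint_lin; [|exact: (I1 _ _ _ _ mU lU ri_)|exact: (I1 _ _ _ _ mV lV rr)].
  by congr Rintegral; apply/funext => x; rewrite ImM /=; ring.
rewrite /cintegral fr fi -Ur -Ui -Vr -Vi.
case: (on_regular g _) => a b; case: (on_regular g _) => a' b'.
by apply/eqP; rewrite eq_complex ReD ImD ReM ImM /=; apply/andP; split; apply/eqP; ring.
Qed.

(** For the lower bound, f equals almost everywhere the function built by [dual_representation]. For
    the upper bound, g must be [dual_pairing f], by uniqueness, and this obeys the estimate through
    densities. *)
Theorem dual_norm_equivalence (g : X -> R[i]) f : bounded_linear NX g -> morrey p r w f ->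
  represents g f ->
  ((4^-1)%:E * morrey_norm p r w f <= dual_norm NX g)%E /\
  (dual_norm NX g <= 2%:E * morrey_norm p r w f)%E.
Proof.
move=> bg mf gf; split.
  have [f' [mf' gf' f'D]] := dual_representation bg.
  have ff' := represents_ae_unique mf.1 mf'.1 gf gf'.
  have [[mr _] [mi _]] := mf.1; have [[mr' _] [mi' _]] := mf'.1.
  have mw := weight_measurable ww.
  rewrite (morrey_norm_ae p r mw mw (conj mr mi) (conj mr' mi') (aeW _ (fun _ => erefl)) ff').
  rewrite -[leRHS](fineK (dual_norm_fin bg)).
  apply: (le_trans (lee_wpmul2l _ f'D)); first by rewrite lee_fin invr_ge0.
  by rewrite -EFinM lee_fin mulKf.
have fM := morrey_leP mf.
have gE := represents_unique bg
  (dual_pairing_bounded_linear mf) gf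
  (dual_pairing_represents mf).
have f0 : (0 <= morrey_norm p r w f)%E.
  by apply: le_trans (morrey_term_le (0, 0) f); exact: mterm_ge0.
apply: ge_ereal_sup => _ [u u1 <-]; rewrite gE.
have [_ /(_ _ _ fM)[_ uM]] := densityP u.
rewrite -[in leRHS](fineK (x := morrey_norm p r w f)); last by rewrite ge0_fin_numE//; exact: mf.2.
rewrite -EFinM lee_fin; apply: (le_trans uM); rewrite ler_pM2l// ler_piMl ?fine_ge0//.
rewrite -lee_fin fineK//; exact: (HL_norm_fin (set_mem (valP u))).
Qed.

Lemma test_function_HL f : test_function f -> X (hreg f).
Proof.
move=> /test_function_bounded[mf [m [K fK]]].
exact: (hreg_HL (conj mf fK)).
Qed.

End weighted_duality.

(** * Muckenhoupt weights *)

Section weight_modification.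
Context {R : realType} {n : nat}.
Local Notation mu := (@lebesgue_rV R n).
Implicit Types (f : 'rV[R]_n -> R[i]).
Variables (p : R) (w : 'rV[R]_n -> R).
Hypothesis p_gt1 : 1 < p.
Hypothesis w_Ap : Ap p w.
Local Notation q := (conjugate p).

(* [is_weight] asks for positivity everywhere, so that no power of the weight is
   a junk value; [Ap] gives it only almost everywhere. *)
Definition modified_weight x : R := if 0 < w x then w x else 1.
Local Notation w' := modified_weight.

Let mw : measurable_fun setT w. Proof. by have [[]] := w_Ap. Qed.

Lemma modified_weight_ae : {ae mu, forall x, w x = w' x}.
Proof. by have [_ w0 _] := w_Ap; apply: filterS w0 => x; rewrite /w' => ->. Qed.

Let mw' : measurable_fun setT w'.
Proof. by apply: measurable_fun_ifT => //; exact: measurable_fun_ltr. Qed.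

Let w'0 x : 0 < w' x.
Proof. by rewrite /w'; case: ifP. Qed.

Let lw' : loc_ri w'.
Proof.
have [/loc_integrable_ri lw _ _] := w_Ap.
move=> m; apply: ri_ae (lw m).
  by apply: measurable_funM => //; exact: measurable_indic_ocube.
by apply: filterS modified_weight_ae => x ->.
Qed.

Let w'dcube k : (0 < \int[mu]_(x in dcube k) (w' x)%:E)%E.
Proof.
have rw := ri_dcube k mw' lw'.
by rewrite integral_indic_dcube ri_EFin// lte_fin; exact: Rintegral_dcube_gt0.
Qed.

Lemma dual_weightE x : dual_weight p w' x = w' x `^ (1 - q).
Proof.
rewrite /dual_weight -powRrM; congr (_ `^ _); rewrite /conjugate.
by field; rewrite !gt_eqF ?subr_gt0// (lt_trans ltr01).
Qed.

(** In the A_p product for the dyadic cube containing [ocube m] the factor of w is positive, so an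
    infinite integral of w^(1 - q) would make the product infinite. *)
Let lv : loc_ri (dual_weight p w').
Proof.
have [_ _ wA] := w_Ap.
move=> m; pose k := bigcube (n := n) m.
have mk := @measurable_dcube R n k.
have mv : measurable_fun setT (dual_weight p w') by do 2!apply: measurable_powR_fun.
have v0 x : 0 <= dual_weight p w' x by exact: powR_ge0.
have B : (wmeas (fun x => w x `^ (1 - q))%R (dcube k) < +oo)%E.
  have l0 : 0 < 2 * side (R := R) k by rewrite mulr_gt0// side_gt0.
  have : (wmeas w (dcube k) / mu (dcube k) *
      (wmeas (fun x => w x `^ (1 - q))%R (dcube k) / mu (dcube k)) `^ (p - 1) < +oo)%E.
    apply: le_lt_trans wA; apply: ereal_sup_ubound.
    by exists (\row_i dlo k i, 2 * side k) => //; rewrite dcube_cube.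
  have muk : mu (dcube k) = ((2 * side k) ^+ n)%:E by rewrite dcube_cube mu_cube.
  have Wk : (0 < wmeas w (dcube k))%E.
    by rewrite (wmeas_ae k mw mw' modified_weight_ae); exact: w'dcube.
  rewrite muk inver gt_eqF ?exprn_gt0//.
  set c := ((2 * side k) ^+ n)^-1; have c0 : 0 < c by rewrite invr_gt0 exprn_gt0.
  move=> h; rewrite ltey; apply/eqP => By; move: h; rewrite By.
  rewrite gt0_mulye ?lte_fin// poweRyr ?gt0_muley ?mule_gt0 ?lte_fin//.
  by rewrite gt_eqF// subr_gt0.
apply: ri_ge0.
- by apply: measurable_funM => //; exact: measurable_indic_ocube.
- by move=> x; apply: mulr_ge0; [exact: v0|exact: indic_ge0].
- apply: le_lt_trans B.
  have -> : wmeas (fun x => w x `^ (1 - q))%R (dcube k) =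
      (\int[mu]_x (dual_weight p w' x * \1_(dcube k) x)%:E)%E.
    rewrite -integral_indic_dcube; apply: wmeas_ae => //; first exact: measurable_powR_fun.
    by apply: filterS modified_weight_ae => x wx; rewrite dual_weightE wx.
  apply: ge0_le_integral; [exact: measurableT| | | |].
  - by move=> x _; rewrite lee_fin; apply: mulr_ge0; [exact: v0|exact: indic_ge0].
  - by apply/measurable_EFinP; apply: measurable_funM => //; exact: measurable_indic_ocube.
  - by apply/measurable_EFinP; apply: measurable_funM => //; exact: measurable_indic.
  - move=> x _; rewrite lee_fin; apply: ler_wpM2l; first exact: v0.
    by apply: indic_sub; exact: ocube_bigcube.
Qed.

Lemma is_weight_Ap : is_weight p w'.
Proof. by split. Qed.

Lemma wmeas_modified k : wmeas w (dcube k) = wmeas w' (dcube k).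
Proof. exact: wmeas_ae mw mw' modified_weight_ae. Qed.

Lemma morrey_norm_modified (r : R) f : measurable_cfun f -> morrey_norm p r w f = morrey_norm p r w' f.
Proof.
by move=> mf; apply: (morrey_norm_ae p r mw mw' mf mf modified_weight_ae); exact: aeW.
Qed.

Lemma morrey_modified (r : R) : morrey p r w = morrey p r w' :> set ('rV[R]_n -> R[i]).
Proof.
have mP f : loc_cintegrable f -> measurable_cfun f by move=> [[mr _] [mi _]]; exact: conj mr mi.
apply/seteqP; split => f [lf fy]; have E := morrey_norm_modified r (mP f lf).
  by split; [exact: lf|rewrite -E; exact: fy].
by split; [exact: lf|rewrite E; exact: fy].
Qed.

Lemma HL_cost_modified (rho : R) a : (forall k, measurable_cfun (a k)) ->
  HL_cost q rho w a = HL_cost q rho w' a.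
Proof.
move=> ma.
have mterm (u : 'rV[R]_n -> R) k : measurable_fun setT u ->
    measurable_fun setT (fun x => (cabs ((u x `^ (- (conjugate q)^-1))%:C%C * a k x) `^ q * 1)%:E).
  move=> mu_; apply/measurable_EFinP; apply: measurable_funM; last exact: measurable_cst.
  apply: measurable_powR_fun; apply: measurable_cfun_cabs; apply: measurable_cfunM; last exact: ma.
  by apply: measurable_toC; exact: measurable_powR_fun.
have I k : (\int[mu]_x (cabs ((w x `^ (- (conjugate q)^-1))%:C%C * a k x) `^ q * 1)%:E =
    \int[mu]_x (cabs ((w' x `^ (- (conjugate q)^-1))%:C%C * a k x) `^ q * 1)%:E)%E.
  apply: ae_eq_integral; [exact: measurableT|exact: mterm|exact: mterm|].
  by apply: filterS modified_weight_ae => x -> _.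
have E k : (wmeas w (dcube k) `^ (- (q^-1 + rho / n%:R)) * wLp_norm q (cst 1%R) setT
      (fun x => (w x `^ (- (conjugate q)^-1))%:C%C * a k x)%R =
    wmeas w' (dcube k) `^ (- (q^-1 + rho / n%:R)) * wLp_norm q (cst 1%R) setT
      (fun x => (w' x `^ (- (conjugate q)^-1))%:C%C * a k x)%R)%E.
  rewrite wmeas_modified.
  exact: (congr1 (fun y => wmeas w' (dcube k) `^ (- (q^-1 + rho / n%:R)) * y `^ q^-1)%E (I k)).
exact: (congr1 (fun F => esum setT F) (funext E)).
Qed.

Lemma HL_modified (rho : R) : @HL R n q rho w = HL q rho w'.
Proof.
apply/seteqP; split => h [th [a [ra ca]]]; have [ma _ _] := ra; have E := HL_cost_modified rho ma.
  by split; [exact: th|exists a; split; [exact: ra|rewrite -E; exact: ca]].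
by split; [exact: th|exists a; split; [exact: ra|rewrite E; exact: ca]].
Qed.

Lemma HL_norm_modified (rho : R) : @HL_norm R n q rho w = HL_norm q rho w'.
Proof.
apply/funext => h.
have S : [set HL_cost q rho w a | a in [set a | HL_representation h a /\ (HL_cost q rho w a < +oo)%E]] =
    [set HL_cost q rho w' a | a in [set a | HL_representation h a /\ (HL_cost q rho w' a < +oo)%E]].
  apply/seteqP; split => _ [a [ra ca] <-]; have [ma _ _] := ra; have E := HL_cost_modified rho ma; exists a.
  - by split; [exact: ra|rewrite -E; exact: ca].
  - exact: esym E.
  - by split; [exact: ra|rewrite E; exact: ca].
  - exact: E.
exact: (congr1 (@ereal_inf R) S).
Qed.

End weight_modification.

(** The first two conjuncts give [represents] its content: test functions define elements of X, and
    these are dense. Uniqueness of the representing function is almost everywhere because [morrey]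
    consists of functions and not of classes. *)
Theorem theorem4p1 (R : realType) (n : nat) (p r rho : R) (w : 'rV[R]_n -> R)
    (n_gt0 : (0 < n)%N) (p_gt1 : 1 < p)
    (r_gt : - (n%:R / p) < r) (r_lt0 : r < 0) (rrho : r + rho = - n%:R)
    (w_Ap : Ap p w) :
  let X : set (schwartz_space R n -> R[i]) := HL (conjugate p) rho w in
  let NX : (schwartz_space R n -> R[i]) -> \bar R :=
    HL_norm (conjugate p) rho w in
  [/\
    (forall f : 'rV[R]_n -> R[i], test_function f ->
       exists h, X h /\ regular h f),
    (forall h, X h -> forall e : R, 0 < e ->
       exists f hf, [/\ test_function f, X hf, regular hf f &
                        (NX (h - hf)%R < e%:E)%E]),
    (forall g : X -> R[i], bounded_linear NX g ->
       exists gt : 'rV[R]_n -> R[i],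
         [/\ morrey p r w gt, represents g gt &
             forall gt', morrey p r w gt' -> represents g gt' ->
               {ae @lebesgue_rV R n, forall x, gt' x = gt x}]),
    (forall gt : 'rV[R]_n -> R[i], morrey p r w gt ->
       exists! g : X -> R[i], bounded_linear NX g /\ represents g gt) &
    exists c C : R, [/\ 0 < c, 0 < C &
      forall (g : X -> R[i]) (gt : 'rV[R]_n -> R[i]),
        bounded_linear NX g -> morrey p r w gt -> represents g gt ->
        (c%:E * morrey_norm p r w gt <= dual_norm NX g)%E /\
        (dual_norm NX g <= C%:E * morrey_norm p r w gt)%E]].
Proof.
move=> X NX.
have ww := is_weight_Ap p_gt1 w_Ap.
have XE : X = HL (conjugate p) rho (modified_weight w) := HL_modified w_Ap rho.
have NE : NX = HL_norm (conjugate p) rho (modified_weight w) := HL_norm_modified w_Ap rho.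
(* The set X occurs in the types of the functionals, so the weight is exchanged by substituting for
   X and NX as variables instead of rewriting inside the statement. *)
clearbody X NX; subst X NX; rewrite (morrey_modified w_Ap r).
split.
- move=> f tf; exists (hreg f); split; last by [].
  exact: (test_function_HL n_gt0 p_gt1 rrho ww).
- move=> h Xh e e0.
  have [f [tf Xf _ hf]] := test_functions_dense n_gt0 p_gt1 r_gt r_lt0 rrho ww Xh e0.
  by exists f, (hreg f); split.
- move=> g bg.
  have [f [mf gf _]] := dual_representation n_gt0 p_gt1 rrho ww bg.
  exists f; split; [exact: mf|exact: gf|] => f' mf' gf'.
  exact: (represents_ae_unique n_gt0 p_gt1 rrho ww mf'.1 mf.1 gf' gf).
- move=> f mf; exists (dual_pairing n_gt0 p_gt1 r_gt r_lt0 rrho ww f).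
  have bf := dual_pairing_bounded_linear n_gt0 p_gt1 r_gt r_lt0 rrho ww mf.
  have rf := dual_pairing_represents n_gt0 p_gt1 r_gt r_lt0 rrho ww mf.
  split; first exact: conj bf rf.
  by move=> g [bg rg]; exact: (represents_unique n_gt0 p_gt1 r_gt r_lt0 rrho ww bf bg rf rg).
- exists 4^-1, 2; split; [by rewrite invr_gt0|exact: ltr0n|] => g f bg mf gf.
  have [[mr _] [mi _]] := mf.1; rewrite (morrey_norm_modified w_Ap r (conj mr mi)).
  exact: (dual_norm_equivalence n_gt0 p_gt1 r_gt r_lt0 rrho ww bg mf gf).
Qed.
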